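(* Let $M$ be the closure of a bounded convex domain in $\mathbb{R}^n$, $n\geq 3$, and let $\beta>0$. Let $W\in C^\beta(M,\operatorname{Lip}(S^{n-1},\mathbb{C}^{N\times N}))$ be such that the matrix $W(x,v)$ is invertible at every point $(x,v)\in SM=M\times S^{n-1}$. (This regularity assumption is true, in particular, if $W\in C^{1,\beta}(SM,\mathbb{C}^{N\times N})$.) If $f\in C(M,\mathbb{C}^N)$ satisfies $\mathcal{I}_Wf=0$, then $f=0$.
   Context: For a continuous $W\colon SM\to\mathbb{C}^{N\times N}$ and a continuous $f\colon M\to\mathbb{C}^N$, the weighted X-ray transform is $\mathcal{I}_Wf(\gamma)=\int_0^TW(\gamma(t),\dot\gamma(t))f(\gamma(t))\,dt$, defined for every maximal directed unit speed line $\gamma\colon[0,T]\to M$ (with endpoints on $\partial M$). $\operatorname{Lip}(S^{n-1},\mathbb{C}^{N\times N})$ is the Banach space of Lipschitz functions $S^{n-1}\to\mathbb{C}^{N\times N}$ with its usual norm (sup norm plus Lipschitz constant), and $C^\beta(M,X)$ is the space of $\beta$-Hölder continuous functions from $M$ to the Banach space $X$; $W$ is identified with a function on $M\times S^{n-1}$ via $W(x,v)=W(x)(v)$.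
   Formalization: The parenthetical remark that W ∈ C^{1,β}(SM) suffices is stated only for β ≤ 1; for β > 1, with C^β read as the literal Hölder condition, it fails, e.g. for N = 1 and W(x,v) = c + x_1 with c large. *)

(* Defs.v *)
From mathcomp Require Export all_boot all_order all_algebra complex.
From mathcomp Require Export all_classical all_reals all_analysis.

Set Implicit Arguments.
Unset Strict Implicit.
Unset Printing Implicit Defensive.

Export Order.TTheory GRing.Theory Num.Theory.
Export numFieldNormedType.Exports.

#[global] Open Scope classical_set_scope.
#[global] Open Scope ring_scope.

(* The library puts its norm and topology on matrices over the sort of a
   [numFieldType]; on the bare type [R[i]] these instances are not found. *)
Definition cplx (R : realType) : numFieldType := R[i].

(* The library's norm on ['M[cplx R]_(m, p)] is the largest modulus of an entry,
   as a real element of [R[i]]; [Re] turns it into an element of [R]. *)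
Definition mnorm (R : realType) (m p : nat) (A : 'M[cplx R]_(m, p)) : R :=
  complex.Re (`|A| : R[i]).

(* The library's norm on ['rV[R]_n] is the maximum norm, whence this one. *)
Definition enorm (R : realType) (n : nat) (x : 'rV[R]_n) : R :=
  Num.sqrt (\sum_(i < n) x 0 i ^+ 2).

Definition sphere (R : realType) (n : nat) : set 'rV[R]_n :=
  [set v | enorm v = 1].

Definition boundary (T : topologicalType) (A : set T) : set T :=
  closure A `\` interior A.

Definition bounded_convex_domain (R : realType) (n : nat) (D : set 'rV[R]_n) :=
  [/\ D !=set0, open D, convex_set D & bounded_set D].

Section function_spaces.
Variables (R : realType) (n N : nat).
Local Notation E := 'rV[R]_n.
Local Notation MN := 'M[cplx R]_N.

(* The supremum norm plus the best Lipschitz constant on the sphere, for the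
   chordal distance. It is infinite exactly when g is not Lipschitz there; pairs
   with v = w contribute 0, as 0 / 0 = 0. *)
Definition lip_norm (g : E -> MN) : \bar R :=
  (ereal_sup [set (mnorm (g v))%:E | v in @sphere R n] +
   ereal_sup [set (mnorm (g p.1 - g p.2) / enorm (p.1 - p.2))%:E
             | p in @sphere R n `*` @sphere R n])%E.

Definition Lip (g : E -> MN) : Prop := (lip_norm g < +oo)%E.

(* Only the values of W on M x S^{n-1} matter, here and below. *)
Definition hoelder_Lip (M : set E) (beta : R) (W : E -> E -> MN) : Prop :=
  (forall x, M x -> Lip (W x)) /\
  exists C : R, forall x y, M x -> M y ->
    (lip_norm (W x \- W y)%R <= (C * enorm (x - y) `^ beta)%:E)%E.

Definition hoelder_SM (M : set E) (beta : R) (W : E -> E -> MN) : Prop :=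
  exists C : R, forall x v y w, M x -> sphere v -> M y -> sphere w ->
    mnorm (W x v - W y w) <= C * (enorm (x - y) + enorm (v - w)) `^ beta.

(* C^{1,beta}(SM), up to the boundary of M: relative to SM, W is differentiable
   at every point of SM, with a beta-Hoelder differential. The latter is given
   by coefficients Wx i, Wv i on R^n x R^n, of which only the restriction to the
   tangent spaces of SM is determined by W. *)
Definition C1_hoelder_SM (M : set E) (beta : R) (W : E -> E -> MN) : Prop :=
  exists Wx Wv : 'I_n -> E -> E -> MN,
    [/\ forall i, hoelder_SM M beta (Wx i),
        forall i, hoelder_SM M beta (Wv i) &
        forall x v, M x -> sphere v -> forall eps : R, 0 < eps ->
          exists2 delta : R, 0 < delta &
            forall y w, M y -> sphere w ->
              enorm (y - x) + enorm (w - v) < delta ->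
              mnorm (W y w - W x v -
                  \sum_(i < n) (((y - x) 0 i)%:C%C *: Wx i x v +
                                ((w - v) 0 i)%:C%C *: Wv i x v))
              <= eps * (enorm (y - x) + enorm (w - v))].

End function_spaces.

Section xray_transform.
Variables (R : realType) (n N : nat).
Local Notation E := 'rV[R]_n.

Definition line (x v : E) (t : R) : E := x + t *: v.

(* gamma = line x v restricted to [0, T] is a unit speed line in M that is not
   the restriction of one over a larger interval [a, b]. *)
Definition maximal_line (M : set E) (x v : E) (T : R) : Prop :=
  [/\ sphere v, 0 < T,
      forall t, 0 <= t <= T -> M (line x v t),
      boundary M (line x v 0) /\ boundary M (line x v T) &
      forall a b, a <= 0 -> T <= b ->
        (forall t, a <= t <= b -> M (line x v t)) -> a = 0 /\ b = T].

Definition Cintegral (D : set R) (g : R -> R[i]) : R[i] :=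
  ((\int[lebesgue_measure]_(t in D) complex.Re (g t)) +i*
   (\int[lebesgue_measure]_(t in D) complex.Im (g t)))%C.

(* The velocity of gamma = line x v is constantly v. *)
Definition xray (W : E -> E -> 'M[cplx R]_N) (f : E -> 'cV[cplx R]_N)
    (x v : E) (T : R) : 'cV[cplx R]_N :=
  \col_i Cintegral `[0, T] (fun t => (W (line x v t) v *m f (line x v t)) i 0).

End xray_transform.

(* Main.v *)
Require Import Defs.
From mathcomp Require Import measurable_realfun lebesgue_integral ring lra.

(** Suppose f does not vanish on D, and let x0 be a point of the closure of
    {f <> 0} that is farthest from the origin. Planes orthogonal to x0 and close
    to x0 meet {f <> 0} only in a small neighbourhood of x0 (it is here that
    n >= 3 is needed), so there W(y,v) = W(x0,v) + A(y,v) with A small in the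
    Lipschitz norm in v. Integrating over the parallel lines orthogonal to a
    frequency m of a unit square in such a plane, with direction v_m, gives
      W(x0,v_m) f^(m) = - (A(.,v_m) f)^(m).
    By the Bessel inequality the map v |-> (A(.,v) f)^ is Lipschitz from the
    circle into l^2, with a small constant times the L^2 norm of f. Chaining over
    dyadic grids, this one-parameter Lipschitz family has the supremum over v of
    each coefficient still square summable, with a comparable bound. Hence
    ||f|| <= eps ||f|| by completeness of the trigonometric system (proved with
    Fejer means), so f = 0 on the plane, a contradiction. *)

Set Implicit Arguments.
Unset Strict Implicit.
Unset Printing Implicit Defensive.

Import Order.TTheory GRing.Theory Num.Theory.

(** * Integration over the unit square *)

Section UnitSquare.
Variable R : realType.
Local Notation mu := (@lebesgue_measure R).
Local Notation mu2 := (mu \x mu)%E.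
Implicit Types g h : R * R -> R.

(** The obstacle is that the direction [v_m] changes with the frequency [m]: the numbers (A(.,v_m)
    f)^(m) are not the coefficients of one function, so Bessel's inequality does not bound their sum
    directly. Chaining pays for this choice. A grid of mesh 2^-J on the directions of a plane has
    about 2^J points, while the squared increments from the next coarser grid are of order 4^-J, so
    a union bound over each grid still leaves a convergent series. To have one real parameter,
    directions are described by slopes in [-1, 1], in two charts; C^N is replaced by its real
    coordinates and exponentials by cosines and sines. The unit square is placed so that f lives in
    its middle part [1/4, 3/4]^2. Differences with points of the square then stay below 3/4 in
    modulus, so the period-1 Fejer kernel is concentrated at one point only. The claim on C^{1,beta}
    weights is independent of all this. It rests on a mean value inequality, applied along segments
    of the convex set M to bound the sup norm of W(x) - W(y), and along normalized chords of the
    sphere to bound its Lipschitz constant. *)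

Definition bdd_mfun g := measurable_fun setT g /\ exists M : R, forall x, `|g x| <= M.
Definition unit_square : set (R * R) := `[0, 1] `*` `[0, 1].
Definition sq_int g : R := \int[mu2]_(z in unit_square) g z.

Lemma measurable_unit_square : measurable unit_square.
Proof. by apply: measurableX; exact: measurable_itv. Qed.

Lemma unit_square_measure : (mu2 unit_square = 1)%E.
Proof.
rewrite product_measure1E; [|exact: measurable_itv|exact: measurable_itv].
suff E : (mu `[0%R, 1%R] = 1)%E.
  by transitivity (1 * 1 : \bar R)%E; [congr (_ * _)%E; exact: E|rewrite mule1].
by rewrite lebesgue_measure_itv/= lte_fin ltr01 oppr0 adde0.
Qed.

Lemma bdd_mfun_cst c : bdd_mfun (cst c).
Proof. by split; [exact: measurable_cst|exists `|c|]. Qed.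

Lemma bdd_mfunD g h : bdd_mfun g -> bdd_mfun h -> bdd_mfun (fun z => g z + h z).
Proof.
move=> [mg [M Mg]] [mh [M' Mh]]; split; first exact: measurable_funD.
by exists (M + M') => x; rewrite (le_trans (ler_normD _ _))// lerD.
Qed.

Lemma bdd_mfunN g : bdd_mfun g -> bdd_mfun (fun z => - g z).
Proof.
move=> [mg [M Mg]]; split; first exact: measurable_funN.
by exists M => x; rewrite normrN.
Qed.

Lemma bdd_mfunM g h : bdd_mfun g -> bdd_mfun h -> bdd_mfun (fun z => g z * h z).
Proof.
move=> [mg [M Mg]] [mh [M' Mh]]; split; first exact: measurable_funM.
by exists (M * M') => x; rewrite normrM ler_pM.
Qed.

Lemma bdd_mfunZ c g : bdd_mfun g -> bdd_mfun (fun z => c * g z).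
Proof. exact/bdd_mfunM/bdd_mfun_cst. Qed.

Lemma bdd_mfunB g h : bdd_mfun g -> bdd_mfun h -> bdd_mfun (fun z => g z - h z).
Proof. by move=> bg bh; apply: bdd_mfunD => //; exact: bdd_mfunN. Qed.

Lemma bdd_mfun_sum (T : Type) (s : seq T) (P : pred T) (F : T -> R * R -> R) :
  (forall t, bdd_mfun (F t)) -> bdd_mfun (fun z => \sum_(t <- s | P t) F t z).
Proof.
move=> bF; elim: s => [|t s IH].
  by under eq_fun do rewrite big_nil; exact: bdd_mfun_cst.
case Pt : (P t); under eq_fun do rewrite big_cons Pt; last exact: IH.
exact: bdd_mfunD.
Qed.

Lemma bdd_mfun_integrable g : bdd_mfun g -> mu2.-integrable unit_square (EFin \o g).
Proof.
move=> [mg [M Mg]]; apply: measurable_bounded_integrable.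
- exact: measurable_unit_square.
- by rewrite [X in (X < _)%E]unit_square_measure ltry.
- exact: measurable_funTS.
- exists M; split; first exact: num_real.
  by move=> x Mx z _ /=; rewrite (le_trans (Mg z))// ltW.
Qed.

Lemma sq_intD g h : bdd_mfun g -> bdd_mfun h -> sq_int (fun z => g z + h z) = sq_int g + sq_int h.
Proof.
by move=> bg bh; apply: RintegralD; [exact: measurable_unit_square|exact: bdd_mfun_integrable..].
Qed.

Lemma sq_intB g h : bdd_mfun g -> bdd_mfun h -> sq_int (fun z => g z - h z) = sq_int g - sq_int h.
Proof.
by move=> bg bh; apply: RintegralB; [exact: measurable_unit_square|exact: bdd_mfun_integrable..].
Qed.

Lemma sq_intZ c g : bdd_mfun g -> sq_int (fun z => c * g z) = c * sq_int g.
Proof.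
by move=> bg; apply: RintegralZl; [exact: measurable_unit_square|exact: bdd_mfun_integrable].
Qed.

Lemma sq_int_cst c : sq_int (cst c) = c.
Proof.
rewrite /sq_int Rintegral_cst; last exact: measurable_unit_square.
by rewrite [X in fine X]unit_square_measure mulr1.
Qed.

Lemma sq_int_sum (T : Type) (s : seq T) (P : pred T) (F : T -> R * R -> R) :
  (forall t, bdd_mfun (F t)) ->
  sq_int (fun z => \sum_(t <- s | P t) F t z) = \sum_(t <- s | P t) sq_int (F t).
Proof.
move=> bF; elim: s => [|t s IH].
  by under eq_fun do rewrite big_nil; rewrite big_nil; exact: sq_int_cst.
case Pt : (P t); under eq_fun do rewrite big_cons Pt; rewrite big_cons Pt//.
by rewrite sq_intD ?IH//; exact: bdd_mfun_sum.
Qed.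

Lemma sq_int_le g h : bdd_mfun g -> bdd_mfun h -> (forall z, unit_square z -> g z <= h z) ->
  sq_int g <= sq_int h.
Proof.
by move=> bg bh gh; apply: le_Rintegral; [exact: measurable_unit_square|
  exact: bdd_mfun_integrable..|].
Qed.

Lemma sq_int_ge0 g : (forall z, 0 <= g z) -> 0 <= sq_int g.
Proof. by move=> g0; apply: Rintegral_ge0. Qed.

Lemma sq_int_norm g : bdd_mfun g -> `|sq_int g| <= sq_int (fun z => `|g z|).
Proof.
by move=> bg; apply: le_normr_Rintegral; [exact: measurable_unit_square|exact: bdd_mfun_integrable].
Qed.

Lemma sq_int_cvg (G : nat -> R * R -> R) g M :
  (forall k, bdd_mfun (G k)) -> bdd_mfun g ->
  (forall k z, unit_square z -> `|G k z| <= M) ->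
  (forall z, unit_square z -> G ^~ z @ \oo --> g z) ->
  sq_int \o G @ \oo --> sq_int g.
Proof.
move=> bG bg GM Gg.
have [||||| ig _ cv] := @dominated_convergence _ _ _ mu2 unit_square measurable_unit_square
  (fun k => EFin \o G k) (EFin \o g) (cst M%:E).
- by move=> k; apply/measurable_EFinP/measurable_funTS; exact: (bG k).1.
- by apply/measurable_EFinP/measurable_funTS; exact: bg.1.
- by apply: aeW => z uz; apply: cvg_EFin; [exact: nearW|exact: Gg].
- by apply: (bdd_mfun_integrable (bdd_mfun_cst M)).
- by apply: aeW => z k uz; rewrite /= lee_fin GM.
have I2E h : bdd_mfun h -> (\int[mu2]_(z in unit_square) (h z)%:E)%E = (sq_int h)%:E.
  by move=> bh; rewrite /sq_int /Rintegral fineK//; apply: integrable_fin_num;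
    [exact: measurable_unit_square|exact: bdd_mfun_integrable].
by apply: fine_cvg; rewrite -I2E.
Qed.

(** * Compact support, Fubini and shears *)

Definition itv_int (a : R -> R) : R := \int[mu]_(t in `[0, 1]) a t.

(** Shears do not preserve the unit square, so integrands cut off to it are viewed on the whole
    plane, where some bounding box survives the change of variables. *)
Definition box_supp (c : R) g := forall x y, c < `|x| \/ c < `|y| -> g (x, y) = 0.

Definition box (c : R) : set (R * R) := `[- c, c] `*` `[- c, c].

Lemma measurable_box c : measurable (box c).
Proof. by apply: measurableX; exact: measurable_itv. Qed.

Lemma box_measure c : (mu2 (box c) < +oo)%E.
Proof.
rewrite product_measure1E; [|exact: measurable_itv|exact: measurable_itv].
suff h : (mu `[(- c)%R, c] < +oo)%E.
  by apply: lte_mul_pinfty; [exact: measure_ge0|rewrite ge0_fin_numE|exact: h].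
by rewrite lebesgue_measure_itv/=; case: ifP => _; rewrite -?EFinD ltry.
Qed.

Lemma box_supp_integrable c g : bdd_mfun g -> box_supp c g ->
  mu2.-integrable setT (EFin \o g).
Proof.
move=> [mg [M Mg]] sg.
have -> : EFin \o g = (EFin \o g) \_ (box c).
  apply/funext => -[x y]; rewrite /patch; case: ifPn => // /negP nb.
  rewrite /= sg//; apply: contra_notP nb => /not_orP[/negP + /negP].
  by rewrite -!leNgt inE /box/= !in_itv/= -!ler_norml.
rewrite -integrable_mkcond; last exact: measurable_box.
apply: measurable_bounded_integrable.
- exact: measurable_box.
- exact: box_measure.
- exact: measurable_funTS.
- exists M; split; first exact: num_real.
  by move=> x Mx z _ /=; rewrite (le_trans (Mg z))// ltW.
Qed.

Lemma box_supp1_integrable c (a : R -> R) : measurable_fun setT a ->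
  (exists M : R, forall t, `|a t| <= M) -> (forall t, c < `|t| -> a t = 0) ->
  mu.-integrable setT (EFin \o a).
Proof.
move=> ma [M Ma] sa.
have -> : EFin \o a = (EFin \o a) \_ `[- c, c].
  apply/funext => x; rewrite /patch; case: ifPn => // /negP nb.
  rewrite /= sa//; apply: contra_notP nb => /negP.
  by rewrite -!leNgt inE/= !in_itv/= -!ler_norml.
rewrite -integrable_mkcond; last exact: measurable_itv.
apply: measurable_bounded_integrable.
- exact: measurable_itv.
- by rewrite [X in (X < _)%E]lebesgue_measure_itv/=; case: ifP => _; rewrite -?EFinD ltry.
- exact: measurable_funTS.
- exists M; split; first exact: num_real.
  by move=> x Mx z _ /=; rewrite (le_trans (Ma z))// ltW.
Qed.

Lemma box_supp_fubini1 c g : bdd_mfun g -> box_supp c g ->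
  \int[mu2]_z g z = \int[mu]_x \int[mu]_y g (x, y).
Proof.
move=> bg sg; rewrite {1}/Rintegral.
have := integral12_prod_meas1 (box_supp_integrable bg sg); rewrite /fubini_F /= => <-.
rewrite /Rintegral; congr fine; apply: eq_integral => x _.
rewrite fineK//; apply: integrable_fin_num => //.
apply: (@box_supp1_integrable c); first exact: (measurable_fun_pair2 _ bg.1).
  by have [_ [M Mg]] := bg; exists M.
by move=> t ct; apply: sg; right.
Qed.

Lemma box_supp_fubini2 c g : bdd_mfun g -> box_supp c g ->
  \int[mu2]_z g z = \int[mu]_y \int[mu]_x g (x, y).
Proof.
move=> bg sg; rewrite {1}/Rintegral.
have := integral21_prod_meas1 (box_supp_integrable bg sg); rewrite /fubini_G /= => <-.
rewrite /Rintegral; congr fine; apply: eq_integral => x _.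
rewrite fineK//; apply: integrable_fin_num => //.
apply: (@box_supp1_integrable c); first exact: (measurable_fun_pair1 _ bg.1).
  by have [_ [M Mg]] := bg; exists M.
by move=> t ct; apply: sg; left.
Qed.

(** Lebesgue measure is the image of [s] times itself under [t |-> s * t + a], because the two
    measures agree on half-open intervals. *)
Lemma integral_affine (s a : R) (g : R -> R) : 0 < s -> measurable_fun setT g ->
  mu.-integrable setT (EFin \o (fun t => g (s * t + a))) ->
  \int[mu]_t g t = s * \int[mu]_t g (s * t + a).
Proof.
move=> s0 mg ig.
pose phi : R -> measurableTypeR R := fun t => s * t + a.
have mphi : measurable_fun setT phi.
  apply: measurable_funD; last exact: measurable_cst.
  by apply: measurable_funM; [exact: measurable_cst|exact: measurable_id].
(* Despite its name, [sin_wave] is here the scale [s] as a nonnegative number. *)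
pose sin_wave : {nonneg R} := NngNum (ltW s0).
have mgE : measurable_fun setT (EFin \o g) by exact/measurable_EFinP.
have E : (\int[mu]_t (g t)%:E = s%:E * \int[mu]_t (g (s * t + a))%:E)%E.
  transitivity (\int[pushforward (mscale sin_wave mu) phi]_t (g t)%:E)%E.
    apply: eq_measure_integral => A mA _.
    apply: lebesgue_measure_unique => //= _ [[x y]] _ <-.
    rewrite /pushforward/= /mscale/=.
    have -> : phi @^-1` `]x, y] = `](x - a) / s, (y - a) / s]%classic.
      apply/seteqP; split => t /=; rewrite !in_itv/= /phi ltr_pdivrMr// ler_pdivlMr//;
      by rewrite [t * s]mulrC ltrBlDr lerBrDr.
    rewrite !lebesgue_measure_itv/= !lte_fin ltr_pM2r ?invr_gt0// ltrD2r.
    case: ifP => _; last by rewrite mule0.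
    rewrite -!EFinB -EFinM; congr EFin; field.
    by rewrite gt_eqF.
  have sc f : measurable_fun setT f -> (forall t, 0 <= f t)%E ->
    (\int[pushforward (mscale sin_wave mu) phi]_t f t =
      s%:E * \int[mu]_t f (s * t + a)%R)%E.
    move=> mf f0; rewrite ge0_integral_pushforward//=.
    by rewrite preimage_setT ge0_integral_mscale//; exact: (measurableT_comp mf mphi).
  have A1 := integralE (pushforward (mscale sin_wave mu) phi) setT (EFin \o g).
  pose phi' t := s * t + a.
  have A2 := integralE mu setT ((EFin \o g) \o phi').
  have I3 : mu.-integrable setT ((EFin \o g) \o phi') by exact: ig.
  (* Integrability excludes [+oo - +oo] in the difference of positive and negative parts, so that
     [s] can be factored out. *)
  have := integrable_add_def measurableT I3.
  rewrite funepos_comp funeneg_comp in A2 *; move=> I3'.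
  have B1 := sc _ (measurable_funepos mgE) (funepos_ge0 _).
  have B2 := sc _ (measurable_funeneg mgE) (funeneg_ge0 _).
  apply: (etrans (A1 mphi)); rewrite B1 B2 -muleBr//.
  by congr (_ * _)%E; exact/esym/A2.
rewrite /Rintegral E fineM//; apply: integrable_fin_num => //.
Qed.

(** The shear [(x, y) |-> (x, y + k * x)] preserves area and turns [h (y - k * x)] into a function
    of [y] alone. That factor leaves the inner integral over [x], and what remains is the integral
    of [g] over a line of slope [k]: the Fourier slice principle for an arbitrary profile [h]. *)
Lemma ridge_vanish c k g (h : R -> R) : bdd_mfun g -> box_supp c g ->
  measurable_fun setT h -> (exists M : R, forall t, `|h t| <= M) ->
  (forall b, \int[mu]_t g (t, b + k * t) = 0) ->
  \int[mu2]_z (g z * h (z.2 - k * z.1)) = 0.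
Proof.
move=> bg sg mh [M Mh] gk.
have mshear l : measurable_fun setT (fun z : R * R => (z.1, z.2 + l * z.1)).
  apply: measurable_fun_pair; first exact: measurable_fst.
  apply: measurable_funD; first exact: measurable_snd.
  by apply: measurable_funM; [exact: measurable_cst|exact: measurable_fst].
have bG : bdd_mfun (fun z => g z * h (z.2 - k * z.1)).
  apply: bdd_mfunM => //; split; last by exists M.
  apply: (measurableT_comp mh); under eq_fun do rewrite -mulNr.
  exact: (measurableT_comp measurable_snd (mshear (- k))).
have sG : box_supp c (fun z => g z * h (z.2 - k * z.1)).
  by move=> x y cxy; rewrite sg ?mul0r.
rewrite (box_supp_fubini1 bG sG).
pose G z := g (z.1, z.2 + k * z.1) * h z.2.
have bG' : bdd_mfun G.
  have [mg [M' Mg]] := bg.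
  apply: bdd_mfunM; split; [exact: (measurableT_comp mg)|by exists M'| |by exists M].
  exact: (measurableT_comp mh measurable_snd).
(* From [|x| <= |c|] and [|y + k * x| <= |c|] follows [|y| <= |c| + |k| * |c|]; the absolute values
   allow [c] of any sign. *)
have sG' : box_supp (`|c| + `|k| * `|c|) G.
  move=> x y cxy; rewrite /G/= sg ?mul0r//.
  have [cx|xc] := ltP c `|x|; [by left|right].
  have xc' : `|x| <= `|c| by rewrite (le_trans xc)// ler_norm.
  have kx : `|k * x| <= `|k| * `|c| by rewrite normrM ler_wpM2l.
  have := normr_ge0 k; have := normr_ge0 c => c0 k0.
  case: cxy => h1.
    have : 0 <= `|k| * `|c| by rewrite mulr_ge0.
    by move: h1 xc'; lra.
  have h2 : `|y| <= `|y + k * x| + `|k * x|.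
    by rewrite -{1}(addrK (k * x) y); exact: ler_normB.
  have h3 := ler_norm c.
  lra.
transitivity (\int[mu]_x \int[mu]_y G (x, y)); last first.
  rewrite -(box_supp_fubini1 bG' sG') (box_supp_fubini2 bG' sG').
  rewrite -[RHS](_ : \int[mu]_(y in setT) 0 = 0); last first.
    by rewrite /Rintegral integral0.
  apply: eq_Rintegral => y _; rewrite /G/=.
  rewrite RintegralZr ?gk ?mul0r//.
  apply: (@box_supp1_integrable c).
  - by have H := measurable_fun_pair1 y (measurableT_comp bg.1 (mshear k)); refine H.
  - by have [_ [M' Mg]] := bg; exists M'.
  - by move=> t ct; apply: sg; left.
apply: eq_Rintegral => x _.
have int a : mu.-integrable setT (EFin \o (fun t => g (x, t + a) * h (t + a - k * x))).
  apply: (@box_supp1_integrable (`|c| + `|a|)).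
  - apply: (measurableT_comp (f := fun t => g (x, t) * h (t - k * x))).
      exact: (measurable_fun_pair2 _ bG.1).
    by apply: measurable_funD; [exact: measurable_id|exact: measurable_cst].
  - by have [_ [M' Mg]] := bG; exists M' => t; exact: (Mg (x, t + a)).
  - move=> t ct; rewrite sg ?mul0r//; right.
    have : `|t| <= `|t + a| + `|a| by rewrite -{1}(addrK a t); exact: ler_normB.
    by have := ler_norm c; lra.
rewrite (@integral_affine 1 (k * x)) ?mul1r//.
- by apply: eq_Rintegral => y _; rewrite /G/= mul1r; congr (_ * h _); ring.
- exact: (measurable_fun_pair2 _ bG.1).
- by under eq_fun do rewrite /= mul1r; exact: int.
Qed.

Lemma sq_int_box_supp g : (forall z, ~ unit_square z -> g z = 0) -> sq_int g = \int[mu2]_z g z.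
Proof.
move=> g0; rewrite /sq_int Rintegral_mkcond; congr Rintegral; apply/funext => z.
by rewrite /patch; case: ifPn => // /negP nz; rewrite g0// => uz; apply: nz; rewrite inE.
Qed.

Lemma unit_square_box_supp g : (forall z, ~ unit_square z -> g z = 0) -> box_supp 1 g.
Proof.
move=> g0 x y h; apply: g0; rewrite /unit_square/= !in_itv/= => -[/andP[x0 x1] /andP[y0 y1]].
by case: h; rewrite ger0_norm// ltNge ?x1 ?y1.
Qed.

Lemma sq_int_ridge k g (h : R -> R) : bdd_mfun g -> (forall z, ~ unit_square z -> g z = 0) ->
  measurable_fun setT h -> (exists M : R, forall t, `|h t| <= M) ->
  (forall b, \int[mu]_t g (t, b + k * t) = 0) ->
  sq_int (fun z => g z * h (z.2 - k * z.1)) = 0.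
Proof.
move=> bg g0 mh hM gk; rewrite sq_int_box_supp; last by move=> z /g0 ->; rewrite mul0r.
by apply: (@ridge_vanish 1) => //; exact: unit_square_box_supp.
Qed.

Lemma bdd_mfun_swap g : bdd_mfun g -> bdd_mfun (fun z => g (z.2, z.1)).
Proof.
move=> [mg [M Mg]]; split; last by exists M.
exact: (measurableT_comp mg (measurable_fun_pair measurable_snd measurable_fst)).
Qed.

Definition cutoff (g : R * R -> R) z := g z * \1_unit_square z.

Lemma bdd_mfun_cutoff g : bdd_mfun g -> bdd_mfun (cutoff g).
Proof.
move=> bg; apply: bdd_mfunM => //; split.
  by apply: measurable_indic; exact: measurable_unit_square.
by exists 1 => z; rewrite indicE; case: (_ \in _); rewrite ?normr1// normr0 ler01.
Qed.

Lemma sq_int_cutoff g : sq_int g = \int[mu2]_z cutoff g z.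
Proof.
rewrite /sq_int Rintegral_mkcond; congr Rintegral; apply/funext => z.
by rewrite /patch /cutoff indicE; case: ifPn; rewrite ?mulr1 ?mulr0.
Qed.

Lemma box_supp_cutoff g : box_supp 1 (cutoff g).
Proof.
apply: unit_square_box_supp => z nz; rewrite /cutoff indicE.
by case: (boolP (_ \in _)) => //; rewrite ?inE// mulr0.
Qed.

Lemma sq_int_swap g : bdd_mfun g -> sq_int (fun z => g (z.2, z.1)) = sq_int g.
Proof.
move=> bg; rewrite !sq_int_cutoff.
rewrite (box_supp_fubini1 (bdd_mfun_cutoff bg) (@box_supp_cutoff _)).
rewrite (box_supp_fubini2 (bdd_mfun_cutoff (bdd_mfun_swap bg)) (@box_supp_cutoff _)).
apply: eq_Rintegral => x _; apply: eq_Rintegral => y _.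
rewrite /cutoff/= !indicE; congr (_ * _%:R); apply: congr1.
by apply/idP/idP; rewrite !inE /unit_square/= => -[].
Qed.

Lemma itv_intE (a : R -> R) : itv_int a = \int[mu]_t (a t * \1_`[0, 1] t).
Proof.
rewrite /itv_int Rintegral_mkcond; congr Rintegral; apply/funext => z.
by rewrite /patch indicE; case: ifPn; rewrite ?mulr1 ?mulr0.
Qed.

Lemma sq_int_tensor (a b : R -> R) :
  measurable_fun setT a -> measurable_fun setT b ->
  (exists M : R, forall t, `|a t| <= M) -> (exists M : R, forall t, `|b t| <= M) ->
  sq_int (fun z => a z.1 * b z.2) = itv_int a * itv_int b.
Proof.
move=> ma mb [M Ma] [M' Mb].
have bab : bdd_mfun (fun z => a z.1 * b z.2).
  apply: bdd_mfunM; split; [|by exists M| |by exists M'].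
    exact: (measurableT_comp ma measurable_fst).
  exact: (measurableT_comp mb measurable_snd).
have int (f : R -> R) N : measurable_fun setT f -> (forall t, `|f t| <= N) ->
    mu.-integrable setT (EFin \o (fun t => f t * \1_`[0, 1] t)).
  move=> mf fN; apply: (@box_supp1_integrable 1).
  - by apply: measurable_funM => //; apply: measurable_indic; exact: measurable_itv.
  - exists N => t; rewrite normrM indicE; case: (_ \in _); rewrite ?normr1 ?mulr1//.
    by rewrite normr0 mulr0 (le_trans _ (fN t)).
  - move=> t t1; rewrite indicE; case: (boolP (_ \in _)); last by rewrite mulr0.
    rewrite inE/= in_itv/= => /andP[t0 tl].
    by move: t1; rewrite ger0_norm// ltNge tl.
rewrite sq_int_cutoff (box_supp_fubini1 (bdd_mfun_cutoff bab) (@box_supp_cutoff _)) !itv_intE.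
rewrite -RintegralZr//; last exact: (int a M).
apply: eq_Rintegral => x _; rewrite -RintegralZl//; last exact: (int b M').
apply: eq_Rintegral => y _; rewrite /cutoff/= !indicE.
have -> : ((x, y) \in unit_square) = (x \in `[0, 1]%classic) && (y \in `[0, 1]%classic).
  by apply/idP/andP; rewrite !inE.
by case: (x \in _); case: (y \in _); rewrite /= ?mulr1 ?mulr0 ?mul0r ?mul1r.
Qed.

(** The plane carries the product sigma-algebra, so an open set has to be exhibited as a countable
    union of products: squares with rational centres and radii 1/(n+1). *)
Lemma open_measurable2 (U : set (R * R)) : open U -> measurable U.
Proof.
move=> oU.
pose B (i : rat * rat * nat) : set (R * R) :=
  ball (ratr i.1.1 : R) i.2.+1%:R^-1 `*` ball (ratr i.1.2 : R) i.2.+1%:R^-1.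
have -> : U = \bigcup_(i in [set i | B i `<=` U]) B i.
  apply/seteqP; split => [[x y] Uxy|z [i iU /iU//]].
  have /nbhs_ballP[e /= e0 eU] : nbhs (x, y) U by exact: open_nbhs_nbhs.
  have [n ne] : exists n : nat, n.+1%:R^-1 < e / 2.
    have := @near_infty_natSinv_lt R (PosNum (divr_gt0 e0 (ltr0n _ 2))).
    by case=> n _ /(_ n (leqnn n)); exists n.
  have rat_near (t : R) : exists q : rat, `|t - ratr q| < n.+1%:R^-1.
    have [|q] := @rat_in_itvoo R (t - n.+1%:R^-1) (t + n.+1%:R^-1) _.
      by rewrite ltrBlDr -addrA ltrDl addr_gt0// invr_gt0.
    by rewrite in_itv/= => h; exists q; rewrite distrC ltr_distl.
  have [p px] := rat_near x; have [q qy] := rat_near y.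
  exists (p, q, n); last first.
    by split; rewrite /= /ball/= distrC.
  move=> [x' y'] []; rewrite /ball/= => hx hy; apply: eU.
  have tri (a b c : R) : `|a - c| <= `|a - b| + `|b - c| by exact: ler_distD.
  split; rewrite /ball/=.
    apply: le_lt_trans (tri x (ratr p) x') _.
    by rewrite (splitr e) ltrD// (lt_trans _ ne).
  apply: le_lt_trans (tri y (ratr q) y') _.
  by rewrite (splitr e) ltrD// (lt_trans _ ne).
rewrite bigcup_mkcond; apply: countable_bigcupT_measurable => // i.
by case: ifP => // _; apply: measurableX; exact: measurable_ball.
Qed.

(** Meant for functions extended by zero, which may jump at the boundary of [U]. The preimage of a
    ray is an open part of [U], together with the whole complement of [U] when the ray contains
    0. *)
Lemma continuous_on_open_measurable (U : set (R * R)) g : open U ->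
  (forall z, U z -> {for z, continuous g}) -> (forall z, ~ U z -> g z = 0) ->
  measurable_fun setT g.
Proof.
move=> oU cg g0; apply: (measurability _ (RGenOInfty.measurableE R)) => //.
move=> _ [_ [a ->] <-]; rewrite setTI.
have oV : open (U `&` g @^-1` `]a, +oo[).
  rewrite openE => z [Uz gz]; apply: filterI; first exact: open_nbhs_nbhs.
  by apply: cg => //; apply: open_nbhs_nbhs; split => //; exact: interval_open.
have -> : g @^-1` `]a, +oo[ = (U `&` g @^-1` `]a, +oo[) `|`
    (if 0 > a then ~` U else set0).
  apply/seteqP; split => z.
    have [Uz|nUz] := pselect (U z); first by left.
    by rewrite /= in_itv/= g0// andbT => ->; right.
  move=> [[]//|]; case: ifPn => // a0 nUz.
  by rewrite /= g0// in_itv/= a0.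
apply: measurableU; first exact: open_measurable2.
by case: ifP => // _; apply: measurableC; exact: open_measurable2.
Qed.

End UnitSquare.

(** * Trigonometric system and Bessel inequality *)

Section Fourier.
Variable R : realType.
Local Notation mu := (@lebesgue_measure R).
Implicit Types (g : R * R -> R) (m : int * int).

(** The argument of the exponential of frequency [m]; [cos_wave] and [sin_wave] are its real and
    imaginary parts, and pairs ([cos_coef], [sin_coef]) stand for Fourier coefficients. *)
Definition phase m (z : R * R) : R := pi *+ 2 * (m.1%:~R * z.1 + m.2%:~R * z.2).
Definition cos_wave m z := cos (phase m z).
Definition sin_wave m z := sin (phase m z).

Lemma phaseB m m' z : phase (m.1 - m'.1, m.2 - m'.2) z = phase m z - phase m' z.
Proof. by rewrite /phase/= !intrB; ring. Qed.

Lemma phase_shift m x y : phase m (x.1 - y.1, x.2 - y.2) = phase m x - phase m y.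
Proof. by rewrite /phase/=; ring. Qed.

Lemma measurable_phase m : measurable_fun setT (phase m).
Proof.
apply: measurable_funM; first exact: measurable_cst.
by apply: measurable_funD; apply: measurable_funM; [exact: measurable_cst|
  exact: measurable_fst|exact: measurable_cst|exact: measurable_snd].
Qed.

Lemma bdd_mfun_cos_wave m : bdd_mfun (cos_wave m).
Proof.
split; last by exists 1 => z; exact: cos_max.
apply: (measurableT_comp _ (measurable_phase m)).
by apply: continuous_measurable_fun; exact: continuous_cos.
Qed.

Lemma bdd_mfun_sin_wave m : bdd_mfun (sin_wave m).
Proof.
split; last by exists 1 => z; exact: sin_max.
apply: (measurableT_comp _ (measurable_phase m)).
by apply: continuous_measurable_fun; exact: continuous_sin.
Qed.

Let mlin (a : R) : measurable_fun setT (fun t : R => a * t).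
Proof. by apply: measurable_funM; [exact: measurable_cst|exact: measurable_id]. Qed.

Let sin_2pik (k : int) : sin (pi *+ 2 * k%:~R) = 0 :> R.
Proof.
have sin_wave' (j : nat) : sin (pi *+ 2 * j%:R) = 0 :> R.
  by rewrite mulr_natr -[_ *+ j]add0r (periodicn (@sinD2pi R)) sin0.
by case: k => j; rewrite ?NegzE ?mulrNz ?mulrN ?sinN sin_wave' ?oppr0.
Qed.

Let cos_2pik (k : int) : cos (pi *+ 2 * k%:~R) = 1 :> R.
Proof.
have cos_wave' (j : nat) : cos (pi *+ 2 * j%:R) = 1 :> R.
  by rewrite mulr_natr -[_ *+ j]add0r (periodicn (@cosD2pi R)) cos0.
by case: k => j; rewrite ?NegzE ?mulrNz ?mulrN ?cosN cos_wave'.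
Qed.

Let FTC01 (f F : R -> R) : continuous f ->
  (forall t, is_derive t (1 : R) F (f t)) -> itv_int f = F 1 - F 0.
Proof.
move=> cf dF.
have cF : continuous F.
  by move=> t; apply: differentiable_continuous; apply/derivable1_diffP; exact: ex_derive.
rewrite /itv_int /Rintegral (@continuous_FTC2 _ f F)//=.
- exact: continuous_subspaceT.
- split; [by move=> t _; exact: ex_derive|by apply: cvg_at_right_filter; exact: cF|
    by apply: cvg_at_left_filter; exact: cF].
- by move=> t _; rewrite derive1E; exact: derive_val.
Qed.

Let dlin (a t : R) : is_derive t (1 : R) (fun u : R => a * u) a.
Proof. by apply: (is_derive_eq (is_deriveZ a (is_derive_id t 1))); rewrite scaler1. Qed.

Lemma itv_int_sin (k : int) : itv_int (fun t : R => sin (pi *+ 2 * (k%:~R * t))) = 0.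
Proof.
have [->|k0] := eqVneq k 0.
  under eq_fun do rewrite mul0r mulr0 sin0.
  by rewrite /itv_int /Rintegral integral0.
have w0 : pi *+ 2 * k%:~R != 0 :> R.
  by rewrite mulf_neq0// ?intr_eq0// mulrn_eq0/= gt_eqF// pi_gt0.
pose F t : R := - (pi *+ 2 * k%:~R)^-1 * cos (pi *+ 2 * k%:~R * t).
have dF t : is_derive t (1 : R) F (sin (pi *+ 2 * (k%:~R * t))).
  apply: (is_derive_eq (is_deriveZ _ (is_derive1_comp (is_derive_cos _) (dlin (pi *+ 2 * k%:~R)
    t)))).
  rewrite /GRing.scale/= [pi *+ 2 * (_ * t)]mulrA.
  by move: (pi *+ 2 * k%:~R) w0 => w w0; field.
have cf : continuous (fun t : R => sin (pi *+ 2 * (k%:~R * t))).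
  under eq_fun do rewrite mulrA; move=> t.
  by apply: continuous_comp; [exact: mulrl_continuous|exact: continuous_sin].
rewrite (FTC01 cf dF) /F; by rewrite mulr1 mulr0 cos_2pik cos0 subrr.
Qed.

Lemma itv_int_cos (k : int) : itv_int (fun t : R => cos (pi *+ 2 * (k%:~R * t))) = (k == 0)%:R.
Proof.
have [->|k0] := eqVneq k 0.
  under eq_fun do rewrite mul0r mulr0 cos0.
  rewrite /itv_int /Rintegral integral_cst//= lebesgue_measure_itv/= lte_fin ltr01.
  by rewrite oppr0 adde0 mule1.
have w0 : pi *+ 2 * k%:~R != 0 :> R.
  by rewrite mulf_neq0// ?intr_eq0// mulrn_eq0/= gt_eqF// pi_gt0.
pose F t : R := (pi *+ 2 * k%:~R)^-1 * sin (pi *+ 2 * k%:~R * t).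
have dF t : is_derive t (1 : R) F (cos (pi *+ 2 * (k%:~R * t))).
  apply: (is_derive_eq (is_deriveZ _ (is_derive1_comp (is_derive_sin _) (dlin (pi *+ 2 * k%:~R)
    t)))).
  rewrite /GRing.scale/= [pi *+ 2 * (_ * t)]mulrA.
  by move: (pi *+ 2 * k%:~R) w0 => w w0; field.
have cf : continuous (fun t : R => cos (pi *+ 2 * (k%:~R * t))).
  under eq_fun do rewrite mulrA; move=> t.
  by apply: continuous_comp; [exact: mulrl_continuous|exact: continuous_cos].
rewrite (FTC01 cf dF) /F; by rewrite mulr1 mulr0 sin_2pik sin0 subrr.
Qed.

Let mcos (k : int) : measurable_fun setT (fun t : R => cos (pi *+ 2 * (k%:~R * t))).
Proof.
apply: (measurableT_comp (continuous_measurable_fun (@continuous_cos R))).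
apply: (measurableT_comp (mlin _)); exact: mlin.
Qed.

Let msin (k : int) : measurable_fun setT (fun t : R => sin (pi *+ 2 * (k%:~R * t))).
Proof.
apply: (measurableT_comp (continuous_measurable_fun (@continuous_sin R))).
apply: (measurableT_comp (mlin _)); exact: mlin.
Qed.

Let bcos (k : int) : exists M : R, forall t : R, `|cos (pi *+ 2 * (k%:~R * t))| <= M.
Proof. by exists 1 => t; exact: cos_max. Qed.

Let bsin (k : int) : exists M : R, forall t : R, `|sin (pi *+ 2 * (k%:~R * t))| <= M.
Proof. by exists 1 => t; exact: sin_max. Qed.

Let bdd_mfun_tensor (a b : R -> R) : measurable_fun setT a -> measurable_fun setT b ->
  (exists M : R, forall t, `|a t| <= M) -> (exists M : R, forall t, `|b t| <= M) ->
  bdd_mfun (fun z => a z.1 * b z.2).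
Proof.
move=> ma mb [M Ma] [M' Mb].
apply: bdd_mfunM; split; [|by exists M| |by exists M'].
  exact: (measurableT_comp ma measurable_fst).
exact: (measurableT_comp mb measurable_snd).
Qed.

Lemma sq_int_cos_wave m : sq_int (cos_wave m) = (m == (0, 0))%:R.
Proof.
have -> : cos_wave m = fun z => cos (pi *+ 2 * (m.1%:~R * z.1)) * cos (pi *+ 2 * (m.2%:~R * z.2))
   - sin (pi *+ 2 * (m.1%:~R * z.1)) * sin (pi *+ 2 * (m.2%:~R * z.2)).
  by apply/funext => z; rewrite -cosD -mulrDr.
rewrite sq_intB; [|by apply: (bdd_mfun_tensor (mcos _) (mcos _)) |
  by apply: (bdd_mfun_tensor (msin _) (msin _))].
rewrite (sq_int_tensor (mcos _) (mcos _) (bcos _) (bcos _)).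
rewrite (sq_int_tensor (msin _) (msin _) (bsin _) (bsin _)) !itv_int_sin !itv_int_cos mulr0
  subr0 -natrM mulnb.
by case: m => a b; rewrite xpair_eqE.
Qed.

Lemma sq_int_sin_wave m : sq_int (sin_wave m) = 0.
Proof.
have -> : sin_wave m = fun z => sin (pi *+ 2 * (m.1%:~R * z.1)) * cos (pi *+ 2 * (m.2%:~R * z.2))
   + cos (pi *+ 2 * (m.1%:~R * z.1)) * sin (pi *+ 2 * (m.2%:~R * z.2)).
  by apply/funext => z; rewrite -sinD -mulrDr.
rewrite sq_intD; [|by apply: (bdd_mfun_tensor (msin _) (mcos _)) |
  by apply: (bdd_mfun_tensor (mcos _) (msin _))].
rewrite (sq_int_tensor (msin _) (mcos _) (bsin _) (bcos _)).
by rewrite (sq_int_tensor (mcos _) (msin _) (bcos _) (bsin _)) !itv_int_sin mulr0 mul0r addr0.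
Qed.

Definition cos_coef g m := sq_int (fun z => g z * cos_wave m z).
Definition sin_coef g m := sq_int (fun z => g z * sin_wave m z).

(** In the proof [p + i q] is the sum of (a - i b) e^{i phase}. The real waves of [m] and [-m] are
    not independent, so [p] alone has no orthogonal expansion; the complex exponentials do, whence
    the integral of p^2 + q^2 is [Q]. Dropping q^2 bounds the integral of p^2 by [Q], and expanding
    (g - p)^2 concludes. *)
Lemma bessel (T : finType) (S : pred T) (m : T -> int * int) g :
  injective m -> bdd_mfun g ->
  \sum_(i | S i) (cos_coef g (m i) ^+ 2 + sin_coef g (m i) ^+ 2) <= sq_int (fun z => g z ^+ 2).
Proof.
move=> mI bg.
pose a i := cos_coef g (m i); pose b i := sin_coef g (m i).
pose p z := \sum_(i | S i) (a i * cos_wave (m i) z + b i * sin_wave (m i) z).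
pose q z := \sum_(i | S i) (a i * sin_wave (m i) z - b i * cos_wave (m i) z).
have bp : bdd_mfun p by apply: bdd_mfun_sum => i; apply: bdd_mfunD; apply: bdd_mfunZ;
  [exact: bdd_mfun_cos_wave|exact: bdd_mfun_sin_wave].
have bq : bdd_mfun q by apply: bdd_mfun_sum => i; apply: bdd_mfunB; apply: bdd_mfunZ;
  [exact: bdd_mfun_sin_wave|exact: bdd_mfun_cos_wave].
set Q := (X in X <= _).
have gp : sq_int (fun z => g z * p z) = Q.
  transitivity (sq_int (fun z => \sum_(i |
    S i) (a i * (g z * cos_wave (m i) z) + b i * (g z * sin_wave (m i) z)))).
    congr sq_int; apply/funext => z; rewrite /p mulr_sumr; apply: eq_bigr => i _; ring.
  have bc i : bdd_mfun (fun z => g z * cos_wave (m i) z) by apply: bdd_mfunM => //;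
    exact: bdd_mfun_cos_wave.
  have bs i : bdd_mfun (fun z => g z * sin_wave (m i) z) by apply: bdd_mfunM => //;
    exact: bdd_mfun_sin_wave.
  rewrite sq_int_sum => [|i]; last by apply: bdd_mfunD; exact: bdd_mfunZ.
  apply: eq_bigr => i _; rewrite sq_intD; [|exact: bdd_mfunZ..].
  by rewrite !sq_intZ//= !expr2.
pose c i j : R := a i * a j + b i * b j; pose d i j : R := a i * b j - b i * a j.
pose mm i j := ((m i).1 - (m j).1, (m i).2 - (m j).2).
have pq z : p z ^+ 2 + q z ^+ 2 =
    \sum_(i | S i) \sum_(j | S j) (c i j * cos_wave (mm i j) z - d i j * sin_wave (mm i j) z).
  rewrite !expr2 {1}/p {2}/q !mulr_suml -big_split; apply: eq_bigr => i _ /=.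
  rewrite /p /q !mulr_sumr -big_split; apply: eq_bigr => j _ /=.
  by rewrite /cos_wave /sin_wave phaseB cosB sinB /c /d; ring.
have Ipq : sq_int (fun z => p z ^+ 2) + sq_int (fun z => q z ^+ 2) = Q.
  rewrite -sq_intD; [|exact: bdd_mfunM..].
  transitivity (sq_int (fun z => \sum_(i | S i) \sum_(j | S j)
      (c i j * cos_wave (mm i j) z - d i j * sin_wave (mm i j) z))).
    by congr sq_int; apply/funext => z; exact: pq.
  have bt i j : bdd_mfun (fun z => c i j * cos_wave (mm i j) z - d i j * sin_wave (mm i j) z).
    by apply: bdd_mfunB; apply: bdd_mfunZ; [exact: bdd_mfun_cos_wave|exact: bdd_mfun_sin_wave].
  rewrite sq_int_sum => [|i]; last exact: bdd_mfun_sum.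
  apply: eq_bigr => i Si; rewrite sq_int_sum// (bigD1 i)//= big1 => [|j /andP[_ ji]].
    rewrite addr0 sq_intB; [|exact/bdd_mfunZ/bdd_mfun_cos_wave|exact/bdd_mfunZ/bdd_mfun_sin_wave].
    rewrite sq_intZ; last exact: bdd_mfun_cos_wave. rewrite sq_intZ; last exact: bdd_mfun_sin_wave.
    by rewrite sq_int_cos_wave sq_int_sin_wave /mm !subrr eqxx mulr1 mulr0 subr0 /c !expr2.
  rewrite sq_intB; [|exact/bdd_mfunZ/bdd_mfun_cos_wave|exact/bdd_mfunZ/bdd_mfun_sin_wave].
  rewrite sq_intZ; last exact: bdd_mfun_cos_wave. rewrite sq_intZ; last exact: bdd_mfun_sin_wave.
  rewrite sq_int_cos_wave sq_int_sin_wave /mm xpair_eqE !subr_eq0.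
  have -> : ((m i).1 == (m j).1) && ((m i).2 == (m j).2) = false.
    apply/negP; rewrite -xpair_eqE -!surjective_pairing => /eqP/mI ij.
    by rewrite ij eqxx in ji.
  by rewrite !mulr0 subr0.
have q0 : 0 <= sq_int (fun z => q z ^+ 2) by apply: sq_int_ge0 => z; exact: sqr_ge0.
have : 0 <= sq_int (fun z => (g z - p z) ^+ 2) by apply: sq_int_ge0 => z; exact: sqr_ge0.
have -> : sq_int (fun z => (g z - p z) ^+ 2) =
    sq_int (fun z => g z ^+ 2) - 2 * sq_int (fun z => g z * p z) + sq_int (fun z => p z ^+ 2).
  have bgp : bdd_mfun (fun z => g z * p z) by exact: bdd_mfunM.
  have bg2 : bdd_mfun (fun z => g z ^+ 2) by exact: bdd_mfunM.
  have bp2 : bdd_mfun (fun z => p z ^+ 2) by exact: bdd_mfunM.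
  rewrite -sq_intZ// -sq_intB//; last exact: bdd_mfunZ.
  rewrite -sq_intD//; last by apply: bdd_mfunB => //; exact: bdd_mfunZ.
  by congr sq_int; apply/funext => z; ring.
rewrite gp; lra.
Qed.

End Fourier.

(** * Fejer means *)

Section Fejer.
Variable R : realType.
Implicit Types (g : R * R -> R) (m : int * int) (x y z : R * R).

Definition freq_sub m m' : int * int := (m.1 - m'.1, m.2 - m'.2).
Definition point_sub x y : R * R := (x.1 - y.1, x.2 - y.2).

Lemma cos_wave_point_sub m x y : cos_wave m (point_sub x y) = cos_wave m x * cos_wave m y +
  sin_wave m x * sin_wave m y.
Proof. by rewrite /cos_wave phase_shift cosB. Qed.

Lemma bdd_mfun_cos_wave_point_sub m x : bdd_mfun (fun y => cos_wave m (point_sub x y)).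
Proof.
under eq_fun do rewrite cos_wave_point_sub.
by apply: bdd_mfunD; apply: bdd_mfunZ; [exact: bdd_mfun_cos_wave|exact: bdd_mfun_sin_wave].
Qed.

Lemma sq_int_cos_wave_point_sub m x : sq_int (fun y => cos_wave m (point_sub x y)) = (m == (0,
  0))%:R.
Proof.
under eq_fun do rewrite cos_wave_point_sub.
rewrite sq_intD; [|exact/bdd_mfunZ/bdd_mfun_cos_wave|exact/bdd_mfunZ/bdd_mfun_sin_wave].
rewrite sq_intZ; last exact: bdd_mfun_cos_wave.
rewrite sq_intZ; last exact: bdd_mfun_sin_wave.
rewrite sq_int_cos_wave sq_int_sin_wave mulr0 addr0; case: eqP => [->|_]; last by rewrite mulr0.
by rewrite /cos_wave /phase !mul0r addr0 mulr0 cos0 mulr1.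
Qed.

(** The squared modulus of a sum of exponentials, expanded; the sines cancel by symmetry in [i] and
    [j]. *)
Lemma sqr_sum_cos_wave_sin_wave (T : finType) (m : T -> int * int) z :
  (\sum_i cos_wave (m i) z) ^+ 2 + (\sum_i sin_wave (m i) z) ^+ 2 =
  \sum_i \sum_j cos_wave (freq_sub (m i) (m j)) z.
Proof.
rewrite !expr2 !mulr_suml -big_split; apply: eq_bigr => i _ /=.
rewrite !mulr_sumr -big_split; apply: eq_bigr => j _ /=.
by rewrite /cos_wave /sin_wave /freq_sub phaseB cosB.
Qed.

Definition csum n (t : R) := \sum_(j < n) cos (j%:R * t).
Definition ssum n (t : R) := \sum_(j < n) sin (j%:R * t).

(* Real and imaginary part of (1 - e^it) (1 + ... + e^i(n-1)t) = 1 - e^int. *)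
Lemma geometric_cos_sin n t :
  ((1 - cos t) * csum n t + sin t * ssum n t = 1 - cos (n%:R * t)) /\
  ((1 - cos t) * ssum n t - sin t * csum n t = - sin (n%:R * t)).
Proof.
elim: n => [|n [IHc IHs]].
  by rewrite /csum /ssum !big_ord0 mul0r cos0 sin0 !mulr0 subrr addr0 subr0 oppr0.
rewrite -[n.+1%:R]natr1 [(_ + 1) * t]mulrDl mul1r cosD sinD /csum /ssum !big_ord_recr /=.
rewrite -/(csum n t) -/(ssum n t); split.
  transitivity (((1 - cos t) * csum n t + sin t * ssum n t) +
    (1 - cos t) * cos (n%:R * t) + sin t * sin (n%:R * t)); first ring.
  by rewrite IHc; ring.
transitivity (((1 - cos t) * ssum n t - sin t * csum n t) +
    (1 - cos t) * sin (n%:R * t) - sin t * cos (n%:R * t)); first ring.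
by rewrite IHs; ring.
Qed.

(** Squared moduli in the geometric sum formula: |1 - e^it|^2 = 2 (1 - cos t) and |1 - e^int|^2 <=
    4. *)
Lemma dirichlet_bound n t :
  (1 - cos t) * (csum n t ^+ 2 + ssum n t ^+ 2) <= 2.
Proof.
have [c s] := geometric_cos_sin n t.
have : ((1 - cos t) * csum n t + sin t * ssum n t) ^+ 2 +
  ((1 - cos t) * ssum n t - sin t * csum n t) ^+ 2 =
  2 * ((1 - cos t) * (csum n t ^+ 2 + ssum n t ^+ 2)).
  transitivity (((1 - cos t) ^+ 2 + sin t ^+ 2) * (csum n t ^+ 2 + ssum n t ^+ 2)).
    ring.
  by rewrite sin2cos2; ring.
rewrite c s => E; rewrite -(@ler_pM2l _ 2)// -E.
have := cos2Dsin2 (n%:R * t); have := cos_geN1 (n%:R * t); nra.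
Qed.

(** The Fejer kernel of period 1, as the squared modulus of a geometric sum. Nonnegativity and the
    expansion into a double sum of waves are then immediate. *)
Definition fejer n (t : R) := n.+1%:R^-1 *
  (csum n.+1 (pi *+ 2 * t) ^+ 2 + ssum n.+1 (pi *+ 2 * t) ^+ 2).

Lemma fejer_ge0 n t : 0 <= fejer n t.
Proof. by rewrite mulr_ge0// addr_ge0// sqr_ge0. Qed.

(** The range up to 3/4 is that of differences between a point of [1/4, 3/4] and one of [0, 1].
    Beyond 1/2 the kernel is folded back by evenness and periodicity to [1 - |t|], which is at least
    1/4 and hence at least [d]. *)
Lemma fejer_decay n (t d : R) : 0 < d -> d <= 1 / 4 -> d <= `|t| -> `|t| <= 3 / 4 ->
  fejer n t <= 2 / (1 - cos (pi *+ 2 * d)) / n.+1%:R.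
Proof.
move=> d0 d4 dt t4; have pi0 := pi_gt0 R.
have p2 : 0 < pi *+ 2 :> R by rewrite pmulrn_lgt0.
have incr s : d <= s -> s <= 1 / 2 -> cos (pi *+ 2 * s) <= cos (pi *+ 2 * d).
  move=> ds s2; have [->//|sd] := eqVneq s d.
  apply: ltW; rewrite ltr_cos ?in_itv/=; first by rewrite (ltr_pM2l p2) lt_neqAle ds andbT eq_sym.
    apply/andP; split; nra.
  apply/andP; split; nra.
have cd1 : 0 < 1 - cos (pi *+ 2 * d).
  rewrite subr_gt0 -cos0 ltr_cos ?in_itv/=; first by nra.
    by rewrite lexx ltW.
  apply/andP; split; nra.
have cd : 1 - cos (pi *+ 2 * d) <= 1 - cos (pi *+ 2 * t).
  rewrite lerD2l lerN2.
  have -> : cos (pi *+ 2 * t) = cos (pi *+ 2 * `|t|).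
    by rewrite -(ger0_norm (ltW pi0)) -normrMn -normrM cos_norm; congr cos; rewrite ger0_norm// ltW.
  have [t2|t2] := leP `|t| (1 / 2); first exact: incr.
  have -> : pi *+ 2 * `|t| = - (pi *+ 2 * (1 - `|t|)) + pi *+ 2 by ring.
  rewrite cosD2pi cosN; apply: incr; lra.
rewrite /fejer mulrC; apply: ler_pM => //; first by rewrite addr_ge0// sqr_ge0.
rewrite ler_pdivlMr// mulrC; apply: le_trans (dirichlet_bound n.+1 (pi *+ 2 * t)).
by rewrite ler_wpM2r// addr_ge0// sqr_ge0.
Qed.

(** Frequencies on the two axes: they make a kernel in one variable a double sum of plane waves, so
    that [sum_delta] treats it exactly like the product kernel. *)
Let ord1 n (j : 'I_n.+1) : int * int := ((j : nat)%:Z, 0).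
Let ord2 n (j : 'I_n.+1) : int * int := (0, (j : nat)%:Z).
Definition freq_of_pair n (j : 'I_n.+1 * 'I_n.+1) : int * int := ((j.1 : nat)%:Z, (j.2 : nat)%:Z).

Local Notation dfreq n i j := (freq_sub (@freq_of_pair n i) (@freq_of_pair n j)).

Lemma freq_of_pair_inj n : injective (@freq_of_pair n).
Proof. by move=> [a b] [c d] [] /ord_inj -> /ord_inj ->. Qed.

Lemma fejer1 n z : fejer n z.1 = n.+1%:R^-1 *
  \sum_(i < n.+1) \sum_(j < n.+1) cos_wave (freq_sub (ord1 i) (ord1 j)) z.
Proof.
rewrite -(sqr_sum_cos_wave_sin_wave (@ord1 n)) /fejer /csum /ssum.
by congr (_ * (_ ^+ 2 + _ ^+ 2)); apply: eq_bigr => j _; rewrite /cos_wave /sin_wave /phase/=;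
  congr (_ _); ring.
Qed.

Lemma fejer2 n z : fejer n z.2 = n.+1%:R^-1 *
  \sum_(i < n.+1) \sum_(j < n.+1) cos_wave (freq_sub (ord2 i) (ord2 j)) z.
Proof.
rewrite -(sqr_sum_cos_wave_sin_wave (@ord2 n)) /fejer /csum /ssum.
by congr (_ * (_ ^+ 2 + _ ^+ 2)); apply: eq_bigr => j _; rewrite /cos_wave /sin_wave /phase/=;
  congr (_ _); ring.
Qed.

Lemma fejer12 n z : fejer n z.1 * fejer n z.2 = n.+1%:R^-1 ^+ 2 *
  \sum_i \sum_j cos_wave (dfreq n i j) z.
Proof.
rewrite -sqr_sum_cos_wave_sin_wave /fejer.
set a := pi *+ 2 * z.1; set b := pi *+ 2 * z.2.
have -> : \sum_i cos_wave (@freq_of_pair n i) z = csum n.+1 a * csum n.+1 b - ssum n.+1 a *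
  ssum n.+1 b.
  rewrite /csum /ssum !mulr_suml -sumrB -(pair_bigA _ (fun i j => cos_wave (@freq_of_pair n (i,
    j)) z))/=.
  apply: eq_bigr => i _; rewrite !mulr_sumr -sumrB; apply: eq_bigr => j _.
  by rewrite -cosD /cos_wave /phase /a /b/=; congr cos; ring.
have -> : \sum_i sin_wave (@freq_of_pair n i) z = ssum n.+1 a * csum n.+1 b + csum n.+1 a *
  ssum n.+1 b.
  rewrite /csum /ssum !mulr_suml -big_split -(pair_bigA _ (fun i j => sin_wave (@freq_of_pair n
    (i, j)) z))/=.
  apply: eq_bigr => i _; rewrite !mulr_sumr -big_split; apply: eq_bigr => j _ /=.
  by rewrite -sinD /sin_wave /phase /a /b/=; congr sin; ring.
ring.
Qed.

(** By injectivity only the [n] diagonal terms have a nonzero mean, and each of these is 1. *)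
Let sum_delta n (T : finType) (m : T -> int * int) x : injective m -> #|T| = n ->
  (0 < n)%N ->
  bdd_mfun (fun y => n%:R^-1 * \sum_i \sum_j cos_wave (freq_sub (m i) (m j)) (point_sub x y)) /\
  sq_int (fun y => n%:R^-1 * \sum_i \sum_j cos_wave (freq_sub (m i) (m j)) (point_sub x y)) = 1.
Proof.
move=> mI Tn n0.
have bs i : bdd_mfun (fun y => \sum_j cos_wave (freq_sub (m i) (m j)) (point_sub x y)).
  by apply: bdd_mfun_sum => j; exact: bdd_mfun_cos_wave_point_sub.
split; first by apply: bdd_mfunZ; exact: bdd_mfun_sum.
rewrite sq_intZ; last exact: bdd_mfun_sum.
rewrite sq_int_sum// (eq_bigr (fun=> 1)) => [|i _].
  by rewrite sumr_const Tn mulVf// pnatr_eq0 -lt0n.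
rewrite sq_int_sum => [|j]; last exact: bdd_mfun_cos_wave_point_sub.
rewrite (bigD1 i)//= big1 => [|j ji].
  by rewrite sq_int_cos_wave_point_sub /freq_sub !subrr eqxx addr0.
rewrite sq_int_cos_wave_point_sub /freq_sub xpair_eqE !subr_eq0 -xpair_eqE -!surjective_pairing.
by rewrite (inj_eq mI) eq_sym (negPf ji).
Qed.

Lemma fejer_mean1 n x : bdd_mfun (fun y => fejer n (x.1 - y.1)) /\
  sq_int (fun y => fejer n (x.1 - y.1)) = 1.
Proof.
have -> : (fun y => fejer n (x.1 - y.1)) = fun y : R * R => n.+1%:R^-1 *
  \sum_(i < n.+1) \sum_(j < n.+1) cos_wave (freq_sub (ord1 i) (ord1 j)) (point_sub x y).
  by apply/funext => y; rewrite -fejer1.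
by apply: sum_delta; rewrite ?card_ord// => i j [] /ord_inj.
Qed.

Lemma fejer_mean2 n x : bdd_mfun (fun y => fejer n (x.2 - y.2)) /\
  sq_int (fun y => fejer n (x.2 - y.2)) = 1.
Proof.
have -> : (fun y => fejer n (x.2 - y.2)) = fun y : R * R => n.+1%:R^-1 *
  \sum_(i < n.+1) \sum_(j < n.+1) cos_wave (freq_sub (ord2 i) (ord2 j)) (point_sub x y).
  by apply/funext => y; rewrite -fejer2.
by apply: sum_delta; rewrite ?card_ord// => i j [] /ord_inj.
Qed.

Lemma fejer_mean12 n x : bdd_mfun (fun y => fejer n (x.1 - y.1) * fejer n (x.2 - y.2)) /\
  sq_int (fun y => fejer n (x.1 - y.1) * fejer n (x.2 - y.2)) = 1.
Proof.
have -> : (fun y => fejer n (x.1 - y.1) * fejer n (x.2 - y.2)) =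
  fun y : R * R => (n.+1 * n.+1)%:R^-1 *
  \sum_i \sum_j cos_wave (dfreq n i j) (point_sub x y).
  by apply/funext => y; rewrite (fejer12 n (point_sub x y)) natrM invfM.
by apply: sum_delta; [exact: freq_of_pair_inj|rewrite card_prod card_ord|].
Qed.

Definition fejer_conv n g x := sq_int (fun y => g y * (fejer n (x.1 - y.1) * fejer n (x.2 - y.2))).

Lemma fejer_convE n g x : bdd_mfun g -> fejer_conv n g x = n.+1%:R^-1 ^+ 2 *
  \sum_i \sum_j (cos_coef g (dfreq n i j) * cos_wave (dfreq n i j) x +
                 sin_coef g (dfreq n i j) * sin_wave (dfreq n i j) x).
Proof.
move=> bg; rewrite /fejer_conv.
pose h m y := cos_wave m x * (g y * cos_wave m y) + sin_wave m x * (g y * sin_wave m y).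
have bc m : bdd_mfun (fun y => g y * cos_wave m y) by apply: bdd_mfunM => //;
  exact: bdd_mfun_cos_wave.
have bs m : bdd_mfun (fun y => g y * sin_wave m y) by apply: bdd_mfunM => //;
  exact: bdd_mfun_sin_wave.
have bh m : bdd_mfun (h m) by apply: bdd_mfunD; exact: bdd_mfunZ.
have -> : (fun y => g y * (fejer n (x.1 - y.1) * fejer n (x.2 - y.2))) =
  fun y => n.+1%:R^-1 ^+ 2 * \sum_i \sum_j h (dfreq n i j) y.
  apply/funext => y; rewrite (fejer12 n (point_sub x y)) mulrCA; congr (_ * _).
  rewrite mulr_sumr; apply: eq_bigr => i _; rewrite mulr_sumr; apply: eq_bigr => j _.
  by rewrite cos_wave_point_sub /h; ring.
have bsh i : bdd_mfun (fun y => \sum_j h (dfreq n i j) y) by exact: bdd_mfun_sum.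
rewrite sq_intZ; last exact: bdd_mfun_sum.
rewrite sq_int_sum//; congr (_ * _); apply: eq_bigr => i _.
rewrite sq_int_sum//; apply: eq_bigr => j _.
rewrite /h sq_intD; [|exact: bdd_mfunZ..].
by rewrite !sq_intZ// mulrC [sin_wave _ _ * _]mulrC.
Qed.

Lemma bdd_mfun_fejer_conv n g : bdd_mfun g -> bdd_mfun (fejer_conv n g).
Proof.
move=> bg; rewrite (_ : fejer_conv n g = fun x => n.+1%:R^-1 ^+ 2 *
  \sum_i \sum_j (cos_coef g (dfreq n i j) * cos_wave (dfreq n i j) x +
                 sin_coef g (dfreq n i j) * sin_wave (dfreq n i j) x)).
  apply: bdd_mfunZ; apply: bdd_mfun_sum => i; apply: bdd_mfun_sum => j; apply: bdd_mfunD;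
    apply: bdd_mfunZ.
    exact: bdd_mfun_cos_wave.
  exact: bdd_mfun_sin_wave.
by apply/funext => x; exact: fejer_convE.
Qed.

(** The Fejer-weighted sum of squared Fourier coefficients: a frequency counts as often as it is a
    difference of two frequencies of the block. Left as a double sum, it is an average over [j] of
    families that are injective in [i], and a bound uniform over injective families applies to
    each. *)
Definition fejer_energy n g := n.+1%:R^-1 ^+ 2 *
  \sum_i \sum_j (cos_coef g (dfreq n i j) ^+ 2 +
                 sin_coef g (dfreq n i j) ^+ 2).

Lemma sq_int_fejer_conv n g : bdd_mfun g ->
  sq_int (fun x => g x * fejer_conv n g x) = fejer_energy n g.
Proof.
move=> bg.
pose h m y := cos_coef g m * (g y * cos_wave m y) + sin_coef g m * (g y * sin_wave m y).
have bc m : bdd_mfun (fun y => g y * cos_wave m y) by apply: bdd_mfunM => //;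
  exact: bdd_mfun_cos_wave.
have bs m : bdd_mfun (fun y => g y * sin_wave m y) by apply: bdd_mfunM => //;
  exact: bdd_mfun_sin_wave.
have bh m : bdd_mfun (h m) by apply: bdd_mfunD; exact: bdd_mfunZ.
have -> : (fun x => g x * fejer_conv n g x) =
  fun y => n.+1%:R^-1 ^+ 2 * \sum_i \sum_j h (dfreq n i j) y.
  apply/funext => y; rewrite fejer_convE// mulrCA; congr (_ * _).
  rewrite mulr_sumr; apply: eq_bigr => i _; rewrite mulr_sumr; apply: eq_bigr => j _.
  by rewrite /h; ring.
have bsh i : bdd_mfun (fun y => \sum_j h (dfreq n i j) y) by exact: bdd_mfun_sum.
rewrite sq_intZ; last exact: bdd_mfun_sum.
rewrite sq_int_sum//; congr (_ * _); apply: eq_bigr => i _.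
rewrite sq_int_sum//; apply: eq_bigr => j _.
rewrite /h sq_intD; [|exact: bdd_mfunZ..].
by rewrite !sq_intZ// !expr2.
Qed.

Lemma fejer_conv_bound n g M x : bdd_mfun g -> (forall z, `|g z| <= M) ->
  `|fejer_conv n g x| <= M.
Proof.
move=> bg gM; have [bK K1] := fejer_mean12 n x.
have bgK := bdd_mfunM bg bK.
apply: (le_trans (sq_int_norm bgK)).
have -> : M = sq_int (fun y => M * (fejer n (x.1 - y.1) * fejer n (x.2 - y.2))).
  by rewrite sq_intZ// K1 mulr1.
apply: sq_int_le; last 1 first.
- move=> y _; rewrite normrM; apply: ler_pM => //.
  by rewrite ger0_norm// mulr_ge0// fejer_ge0.
- have [m [N hN]] := bgK; split; last by exists N => z; rewrite normr_id.
  by apply: (measurableT_comp _ m); exact: normr_measurable.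
- exact: bdd_mfunZ.
Qed.

Lemma fejer_conv_cvg g x : bdd_mfun g -> 1 / 4 <= x.1 <= 3 / 4 -> 1 / 4 <= x.2 <= 3 / 4 ->
  {for x, continuous g} -> fejer_conv n g x @[n --> \oo] --> g x.
Proof.
move=> bg /andP[x11 x12] /andP[x21 x22] cg.
have [_ [M gM]] := bg.
apply/cvgrPdist_le => e e0.
have e2 : 0 < e / 2 by rewrite divr_gt0.
have [d0 /= d0_gt0 dg] : exists2 d : R, 0 < d & forall y, ball x d y -> `|g x - g y| <= e / 2.
  move/cvgrPdist_le: cg => /(_ _ e2) /nbhs_ballP[d /= d_gt0 dg].
  by exists d => // y /dg.
pose d := Num.min d0 (1 / 4).
have d_gt0 : 0 < d by rewrite lt_min d0_gt0 divr_gt0.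
have d4 : d <= 1 / 4 by rewrite ge_min lexx orbT.
have dd0 : d <= d0 by rewrite ge_min lexx.
pose c := 2 / (1 - cos (pi *+ 2 * d)).
have M0 : 0 <= M by rewrite (le_trans _ (gM x)).
pose L := 4 * M * `|c|.
have L0 : 0 <= L by rewrite !mulr_ge0.
have [n0 hn0] : exists n0, forall n, (n0 <= n)%N -> L / n.+1%:R <= e / 2.
  exists (Num.truncn (L / (e / 2))) => n hn.
  rewrite ler_pdivrMr// mulrC -ler_pdivrMr//; apply: ltW.
  apply: lt_le_trans (truncnS_gt _) _; by rewrite ler_nat ltnS.
exists n0 => // n /= /hn0 hn.
have [bK K1] := fejer_mean12 n x; have [b1 F1] := fejer_mean1 n x.
have [b2 F2] := fejer_mean2 n x.
rewrite distrC.
have -> : fejer_conv n g x - g x =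
  sq_int (fun y => (g y - g x) * (fejer n (x.1 - y.1) * fejer n (x.2 - y.2))).
  under eq_fun do rewrite mulrBl.
  by rewrite sq_intB; [rewrite sq_intZ// K1 mulr1|exact: bdd_mfunM|exact: bdd_mfunZ].
have bint : bdd_mfun (fun y => (g y - g x) * (fejer n (x.1 - y.1) * fejer n (x.2 - y.2))).
  by apply: bdd_mfunM => //; apply: bdd_mfunB => //; exact: bdd_mfun_cst.
apply: (le_trans (sq_int_norm bint)).
(* Near [x] continuity gives e / 2 times the kernel. If one coordinate differs by at least [d], its
   factor is at most [|c| / n.+1%:R], and the other factor is kept because its mean is 1. The bound
   2 * M of the increment and the two coordinates make the 4 in [L]. *)
apply: (@le_trans _ _ (sq_int (fun y => e / 2 * (fejer n (x.1 - y.1) * fejer n (x.2 - y.2))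
  + 2 * M * `|c| / n.+1%:R * (fejer n (x.1 - y.1) + fejer n (x.2 - y.2))))); last first.
  have b12 : bdd_mfun (fun y => fejer n (x.1 - y.1) + fejer n (x.2 - y.2)) by exact: bdd_mfunD.
  rewrite sq_intD; [|exact: bdd_mfunZ..].
  rewrite sq_intZ// sq_intZ// sq_intD// K1 F1 F2 mulr1.
  have -> : 2 * M * `|c| / n.+1%:R * (1 + 1) = L / n.+1%:R by rewrite /L; ring.
  by rewrite [leRHS]splitr lerD2l.
apply: sq_int_le.
- have [m [N hN]] := bint; split; last by exists N => z; rewrite normr_id.
  by apply: (measurableT_comp _ m); exact: normr_measurable.
- by apply: bdd_mfunD; apply: bdd_mfunZ => //; exact: bdd_mfunD.
move=> y [] /=; rewrite !in_itv/= => /andP[y10 y11] /andP[y20 y21].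
have f1 := fejer_ge0 n (x.1 - y.1); have f2 := fejer_ge0 n (x.2 - y.2).
rewrite normrM (ger0_norm (mulr_ge0 f1 f2)).
have g2 : `|g y - g x| <= 2 * M.
  by rewrite (le_trans (ler_normB _ _))// mulr_natl mulr2n lerD.
have cn0 : 0 <= `|c| / n.+1%:R by rewrite divr_ge0.
have far (t : R) : d <= `|t| -> `|t| <= 3 / 4 -> fejer n t <= `|c| / n.+1%:R.
  move=> dt t4; apply: (le_trans (fejer_decay n d_gt0 d4 dt t4)).
  by rewrite ler_wpM2r ?invr_ge0// ler_norm.
have t34 (a b : R) : 1 / 4 <= a -> a <= 3 / 4 -> 0 <= b -> b <= 1 -> `|a - b| <= 3 / 4.
  by move=> *; rewrite ler_norml; apply/andP; split; lra.
have t1 := t34 _ _ x11 x12 y10 y11.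
have t2 := t34 _ _ x21 x22 y20 y21.
set A := fejer n (x.1 - y.1) in f1 *; set B := fejer n (x.2 - y.2) in f2 *.
have AB : 0 <= A * B by exact: mulr_ge0.
have -> : 2 * M * `|c| / n.+1%:R * (A + B) = 2 * M * (`|c| / n.+1%:R * A) + 2 * M * (`|c|
  / n.+1%:R * B).
  ring.
have cA : 0 <= `|c| / n.+1%:R * A by exact: mulr_ge0.
have cB : 0 <= `|c| / n.+1%:R * B by exact: mulr_ge0.
have M2 : 0 <= 2 * M by rewrite mulr_ge0.
have eAB : 0 <= e / 2 * (A * B) by rewrite mulr_ge0// ltW.
have [n1|n1] := leP d `|x.1 - y.1|.
  apply: (@le_trans _ _ (2 * M * (`|c| / n.+1%:R * B))).
    by apply: ler_pM => //; rewrite ler_wpM2r// far.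
  by rewrite [leRHS]addrA lerDr addr_ge0// (mulr_ge0 M2 cA).
have [n2|n2] := leP d `|x.2 - y.2|.
  apply: (@le_trans _ _ (2 * M * (`|c| / n.+1%:R * A))).
    by apply: ler_pM => //; rewrite mulrC ler_wpM2r// far.
  by rewrite [leRHS]addrCA lerDl addr_ge0// (mulr_ge0 M2 cB).
apply: (@le_trans _ _ (e / 2 * (A * B))).
  rewrite ler_wpM2r// distrC dg//; split; rewrite /ball/=.
    exact: lt_le_trans n1 _.
  exact: lt_le_trans n2 _.
by rewrite lerDl addr_ge0// (mulr_ge0 M2 cA, mulr_ge0 M2 cB).
Qed.

(* Completeness of the trigonometric system, tested on a single function. *)
Lemma fejer_energy_cvg g : bdd_mfun g ->
  (forall x, g x != 0 -> 1 / 4 <= x.1 <= 3 / 4 /\ 1 / 4 <= x.2 <= 3 / 4) ->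
  (forall x, g x != 0 -> {for x, continuous g}) ->
  fejer_energy n g @[n --> \oo] --> sq_int (fun x => g x ^+ 2).
Proof.
move=> bg g4 cg; have [_ [M gM]] := bg.
have -> : (fejer_energy ^~ g) = @sq_int R \o (fun n x => g x * fejer_conv n g x).
  by apply/funext => n /=; rewrite sq_int_fejer_conv.
apply: (@sq_int_cvg _ _ _ (M * M)).
- by move=> n; apply: bdd_mfunM => //; exact: bdd_mfun_fejer_conv.
- exact: bdd_mfunM.
- by move=> n z _; rewrite normrM ler_pM// fejer_conv_bound.
- move=> z _; rewrite expr2; have [->|gz] := eqVneq (g z) 0.
    by under eq_fun do rewrite mul0r; rewrite mul0r; exact: cvg_cst.
  have [z1 z2] := g4 _ gz.
  by apply: cvgMr; apply: fejer_conv_cvg => //; exact: cg.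
Qed.

End Fejer.

(** * Chaining over dyadic grids *)

(** The last step of the chaining produces less than 2 * (2 * 2048) + 2; any larger number will
    do. *)
Definition chain_cst {R : realType} : R := 2 ^+ 14.

Section Chaining.
Variables (R : realType) (T : finType) (S : pred T) (F : T -> R -> R) (P : R).
Hypothesis P0 : 0 <= P.
Hypothesis F_bound : forall x, `|x| <= 1 -> \sum_(m | S m) F m x ^+ 2 <= P.
Hypothesis F_lip : forall x y, `|x| <= 1 -> `|y| <= 1 ->
  \sum_(m | S m) (F m x - F m y) ^+ 2 <= P * (x - y) ^+ 2.

(** Mesh 2^-J on [-1, 1], with indices from 0 to 2^(J+1) included. The point of index [q] at level
    J+1 has the parent of index [q./2], at distance 0 or 2^-(J+1) according to the parity of [q]. *)
Let grid (J q : nat) : R := q%:R / 2 ^+ J - 1.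

Let grid_le1 J q : (q <= 2 ^ J.+1)%N -> `|grid J q| <= 1.
Proof.
move=> qJ; have p2 : (0 : R) < 2 ^+ J by rewrite exprn_gt0.
have : q%:R / 2 ^+ J <= 2 :> R.
  by rewrite ler_pdivrMr// -exprS -natrX ler_nat.
have : 0 <= q%:R / 2 ^+ J :> R by rewrite divr_ge0// ltW.
by rewrite /grid ler_norml => *; apply/andP; split; lra.
Qed.

(** Union bound: the term at the chosen index is replaced by the sum over all [M.+1] indices, each
    of which satisfies the bound for a fixed index. *)
Let sum_max (k : T -> nat) M (G : T -> nat -> R) (B : R) :
  (forall m q, 0 <= G m q) -> (forall m, (k m <= M)%N) ->
  (forall q, (q <= M)%N -> \sum_(m | S m) G m q <= B) ->
  \sum_(m | S m) G m (k m) <= M.+1%:R * B.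
Proof.
move=> G0 kM GB; apply: (@le_trans _ _ (\sum_(m | S m) \sum_(q < M.+1) G m q)).
  apply: ler_sum => m _.
  by rewrite (bigD1 (Ordinal (kM m : (k m < M.+1)%N)))//= lerDl sumr_ge0.
rewrite exchange_big/= -[leRHS]mulr1 -mulrA mulr1 mulr_natl.
rewrite -[X in _ *+ X]card_ord -sumr_const; apply: ler_sum => q _.
by apply: GB; rewrite -ltnS.
Qed.

(* Going one level down in the grid, (a + b)^2 <= (1 + e) a^2 + (1 + 1/e) b^2
   with e = (3/4)^J / 16: this beats the 2^J points of the grid, since the
   squared increments are of order 4^-J. *)
Let grid_bound J (q : T -> nat) : (forall m, (q m <= 2 ^ J.+1)%N) ->
  \sum_(m | S m) F m (grid J (q m)) ^+ 2 <= 2048 * P * (2 - (3 / 4) ^+ J).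
Proof.
elim: J q => [|J IH] q qJ.
  have := @sum_max q 2 (fun m i => F m (grid 0 i) ^+ 2) P.
  move=> /(_ (fun _ _ => sqr_ge0 _) qJ) /(_ _) /le_trans -> //.
    by move=> i i2; apply: F_bound; exact: grid_le1.
  by rewrite expr0; have := P0; lra.
pose r : R := (3 / 4) ^+ J.
have r0 : 0 < r by rewrite exprn_gt0// divr_gt0.
have r1 : r <= 1 by rewrite exprn_ile1 ?divr_ge0// ler_pdivrMr// mul1r ler_nat.
pose e : R := r / 16.
have e0 : 0 < e by rewrite divr_gt0.
have e1 : e <= 1 by rewrite /e; lra.
pose p m := (q m)./2.
have pJ m : (p m <= 2 ^ J.+1)%N.
  by rewrite /p -[X in (_ <= X)%N]doubleK half_leq// -mul2n -expnS.
pose D m i := F m (grid J.+1 i) - F m (grid J i./2).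
have step : \sum_(m | S m) F m (grid J.+1 (q m)) ^+ 2 <=
   (1 + e) * \sum_(m | S m) F m (grid J (p m)) ^+ 2 +
   (1 + e^-1) * \sum_(m | S m) D m (q m) ^+ 2.
  rewrite !mulr_sumr -big_split; apply: ler_sum => m _ /=.
  rewrite -subr_ge0 (_ : _ - _ = (e * F m (grid J (p m)) - D m (q m)) ^+ 2 / e).
    by rewrite divr_ge0 ?sqr_ge0// ltW.
  by rewrite /D /p; field; rewrite gt_eqF.
apply: (le_trans step).
have p2 : (0 : R) < 2 ^+ J by rewrite exprn_gt0.
have hJ : (1 / 2 : R) ^+ J = (2 ^+ J)^-1 by rewrite expr_div_n expr1n mul1r.
have Dsum : \sum_(m | S m) D m (q m) ^+ 2 <= 2 * P * (1 / 2) ^+ J.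
  have := @sum_max q (2 ^ J.+2) (fun m i => D m i ^+ 2) (P * ((1 / 2) ^+ J.+1) ^+ 2).
  move=> /(_ (fun _ _ => sqr_ge0 _) qJ) /(_ _) /le_trans -> //.
    move=> i iJ; apply: (le_trans (F_lip _ _)); rewrite ?grid_le1//.
      by rewrite -[X in (_ <= X)%N]doubleK half_leq// -mul2n -expnS.
    apply: ler_wpM2l => //.
    have h0 : 0 <= (1 / 2) ^+ J.+1 :> R by rewrite exprn_ge0// divr_ge0.
    rewrite -[leLHS]real_normK ?num_real// ler_sqr ?nnegrE//.
    have -> : grid J.+1 i - grid J i./2 = (odd i)%:R * (1 / 2) ^+ J.+1.
      rewrite /grid -{1}(odd_double_half i) natrD -mul2n natrM.
      by rewrite !exprS hJ; field; rewrite gt_eqF.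
    rewrite normrM (ger0_norm h0) ger0_norm//.
    by case: (odd i); rewrite ?mul1r ?mul0r.
  (* The 2^(J+2) + 1 grid points are at most 8 * 2^J, and each contributes at most P * 4^-(J+1). *)
  have -> : 2 * P * (1 / 2) ^+ J = (8 * 2 ^+ J) * (P * ((1 / 2) ^+ J.+1) ^+ 2).
    by rewrite [(1 / 2) ^+ J.+1]exprS hJ; field; rewrite gt_eqF.
  rewrite ler_wpM2r//; first by rewrite mulr_ge0// sqr_ge0.
  rewrite -natr1 natrX !exprS.
  have : 1 <= 2 ^+ J :> R by rewrite exprn_ege1// ler1n.
  lra.
(* The ratio 3/4 is chosen for 1/2 <= (3/4)^2: after division by [e = r / 16] the increments still
   decay like [r]. *)
have half_r : (1 / 2) ^+ J <= r ^+ 2.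
  rewrite /r -exprM mulnC exprM; apply: lerXn2r; rewrite ?nnegrE; lra.
have -> : (3 / 4 : R) ^+ J.+1 = 3 / 4 * r by rewrite exprS.
have S1 : (1 + e) * \sum_(m | S m) F m (grid J (p m)) ^+ 2 <=
    (1 + e) * (2048 * P * (2 - r)).
  by rewrite ler_wpM2l ?IH// addr_ge0// ltW.
have S2 : (1 + e^-1) * \sum_(m | S m) D m (q m) ^+ 2 <= 2 * e^-1 * (2 * P * r ^+ 2).
  apply: ler_pM => //.
  - by rewrite addr_ge0// invr_ge0 ltW.
  - by apply: sumr_ge0 => m _; exact: sqr_ge0.
  - have : 1 <= e^-1 by rewrite -invr1 lef_pV2 ?posrE.
    lra.
  - by apply: (le_trans Dsum); rewrite ler_wpM2l// mulr_ge0.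
apply: (le_trans (lerD S1 S2)).
have -> : 2 / e * (2 * P * r ^+ 2) = 64 * P * r by rewrite /e; field; rewrite gt_eqF.
rewrite /e -subr_ge0.
(* In units of P, the room gained is 2048 * r / 4 = 512 r. The factor 1 + e costs 256 r - 128 r^2
   and the increments cost 64 r, which leaves 192 r + 128 r^2. *)
have -> : 2048 * P * (2 - 3 / 4 * r) -
  ((1 + r / 16) * (2048 * P * (2 - r)) + 64 * P * r) = P * (192 * r + 128 * r ^+ 2) by field.
by rewrite mulr_ge0// addr_ge0 ?mulr_ge0 ?sqr_ge0 ?ltW.
Qed.

Lemma chaining (k : T -> R) : (forall m, `|k m| <= 1) ->
  \sum_(m | S m) F m (k m) ^+ 2 <= chain_cst * P.
Proof.
(* The grid bound is uniform in the level, so a very fine level may be used. There rounding is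
   handled crudely: each term costs at most P * 4^-J, as one summand of [F_lip], and #|T| * 4^-J <=
   1. *)
move=> k1; pose J := #|T|.
have p2 : (0 : R) < 2 ^+ J by rewrite exprn_gt0.
pose q m := Num.truncn (2 ^+ J * (k m + 1)).
have kq m : (q m)%:R <= 2 ^+ J * (k m + 1) < (q m).+1%:R.
  apply: truncn_itv; rewrite mulr_ge0 ?(ltW p2)//.
  have := k1 m; rewrite ler_norml => /andP[? _]; lra.
have qJ m : (q m <= 2 ^ J.+1)%N.
  rewrite -(@ler_nat R) natrX exprSr; case/andP: (kq m) => h _; apply: (le_trans h).
  apply: ler_wpM2l; first exact: ltW.
  by have := k1 m; rewrite ler_norml => /andP[_ ?]; lra.
have close m : (k m - grid J (q m)) ^+ 2 <= ((1 / 2) ^+ J) ^+ 2.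
  have -> : k m - grid J (q m) = (2 ^+ J * (k m + 1) - (q m)%:R) * (1 / 2) ^+ J.
    by rewrite /grid expr_div_n expr1n; field; rewrite gt_eqF.
  rewrite exprMn -[leRHS]mul1r ler_wpM2r ?sqr_ge0//.
  case/andP: (kq m) => h0 h1; rewrite -natr1 in h1.
  have {}h0 : 0 <= 2 ^+ J * (k m + 1) - (q m)%:R by rewrite subr_ge0.
  by rewrite expr_le1//; lra.
have T4 : #|T|%:R * ((1 / 2) ^+ J) ^+ 2 <= 1 :> R.
  have JJ : J%:R <= 2 ^+ J :> R by rewrite -natrX ler_nat ltnW// ltn_expl.
  rewrite exprMn expr1n mul1r exprVn expr2 mulrA ler_pdivrMr// mul1r.
  apply: (@le_trans _ _ 1); first by rewrite ler_pdivrMr// mul1r.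
  by rewrite exprn_ege1// ler1n.
have E : \sum_(m | S m) F m (k m) ^+ 2 <=
   2 * \sum_(m | S m) F m (grid J (q m)) ^+ 2 +
   2 * \sum_(m | S m) (F m (k m) - F m (grid J (q m))) ^+ 2.
  rewrite !mulr_sumr -big_split; apply: ler_sum => m _ /=.
  rewrite -subr_ge0 (_ : _ - _ = (F m (k m) - 2 * F m (grid J (q m))) ^+ 2) ?sqr_ge0//.
  ring.
apply: (le_trans E).
have S2 : \sum_(m | S m) (F m (k m) - F m (grid J (q m))) ^+ 2 <= P.
  apply: (@le_trans _ _ (\sum_(m : T) P * ((1 / 2) ^+ J) ^+ 2)); last first.
    rewrite sumr_const -[leLHS]mulr_natl mulrCA; apply: (@le_trans _ _ (P * 1)).
      exact: (ler_wpM2l P0 T4).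
    by rewrite mulr1.
  rewrite [leLHS]big_mkcond; apply: ler_sum => m _; case: ifP => Sm; last first.
    by rewrite mulr_ge0// sqr_ge0.
  have := F_lip (k1 m) (grid_le1 (qJ m)); rewrite (bigD1 m)//= => h.
  apply: (@le_trans _ _ (P * (k m - grid J (q m)) ^+ 2)); last by rewrite ler_wpM2l.
  apply: le_trans h; rewrite lerDl; apply: sumr_ge0 => *; exact: sqr_ge0.
have := grid_bound qJ.
have : 0 <= P * (3 / 4) ^+ J by rewrite mulr_ge0// exprn_ge0// divr_ge0.
have -> : chain_cst = 8 * 2048 :> R by rewrite /chain_cst; ring.
by have := P0; lra.
Qed.

End Chaining.

(** * The estimate in a plane *)

Section PlaneEstimate.
Variable R : realType.
Local Notation mu := (@lebesgue_measure R).
Local Notation dfreq n i j := (freq_sub (@freq_of_pair n i) (@freq_of_pair n j)).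
Implicit Types (g : R * R -> R) (m : int * int) (z : R * R).

(* Lines of slope k (for c = true) or of inverse slope k (for c = false);
   |k| <= 1 suffices for all directions. *)
Definition chart (c : bool) (k b t : R) : R * R :=
  if c then (t, b + k * t) else (b + k * t, t).

Definition chart_of m : bool := `|m.1| <= `|m.2|.
(** Makes the direction (1, k), respectively (k, 1), orthogonal to [m]. At the zero frequency the
    convention 0 / 0 = 0 selects slope 0, which is as good as any other. *)
Definition slope m : R :=
  if chart_of m then - (m.1%:~R / m.2%:~R) else - (m.2%:~R / m.1%:~R).

Lemma slope_le1 m : `|slope m| <= 1.
Proof.
have aux (a b : int) : `|a| <= `|b| -> `|- (a%:~R / b%:~R)| <= 1 :> R.
  move=> ab; rewrite normrN normrM normfV.
  have [->|b0] := eqVneq b 0; first by rewrite normr0 invr0 mulr0 ler01.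
  by rewrite ler_pdivrMr ?normr_gt0 ?intr_eq0// mul1r -!intr_norm ler_int.
by rewrite /slope /chart_of; case: ifPn => [/aux//|]; rewrite -ltNge => /ltW/aux.
Qed.

(** The phase of [m] is constant along lines orthogonal to [m], hence a function of [z.2 - k * z.1]
    in the first chart; the second chart is reduced to the first by swapping the coordinates. *)
Lemma sq_int_chart_vanish m g (h : R -> R) : bdd_mfun g -> (forall z, ~ unit_square z -> g z = 0) ->
  continuous h -> (exists M : R, forall t, `|h t| <= M) ->
  (forall b, \int[mu]_t g (chart (chart_of m) (slope m) b t) = 0) ->
  sq_int (fun z => g z * h (phase m z)) = 0.
Proof.
move=> bg g0 ch [M hM]; rewrite /slope /chart_of.
have mhc (a : R) : measurable_fun setT (fun t => h (a * t)).
  apply: (measurableT_comp (continuous_measurable_fun ch)).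
  by apply: measurable_funM; [exact: measurable_cst|exact: measurable_id].
case: ifPn => [ab|]; last rewrite -ltNge => ab.
  set k := - _ => gk.
  have mk : m.1%:~R = - (m.2%:~R * k) :> R.
    rewrite /k; have [m20|m20] := eqVneq m.2 0.
      by move: ab; rewrite m20 normr0 normr_le0 => /eqP ->; rewrite mul0r oppr0.
    by rewrite mulrN opprK mulrCA mulfV ?intr_eq0// mulr1.
  rewrite -[RHS](@sq_int_ridge _ k g (fun t => h (pi *+ 2 * m.2%:~R * t)))//; last by exists M.
  by congr sq_int; apply/funext => z; rewrite /phase mk; congr (_ * h _); ring.
set k := - _ => gk.
have m10 : m.1 != 0 by apply: contraTneq ab => ->; rewrite normr0 normr_lt0.
have mk : m.2%:~R = - (m.1%:~R * k) :> R.
  by rewrite /k mulrN opprK mulrCA mulfV ?intr_eq0// mulr1.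
rewrite -[RHS](@sq_int_ridge _ k (fun z => g (z.2, z.1)) (fun t => h (pi *+ 2 * m.1%:~R * t)))//.
- rewrite -sq_int_swap; last first.
    apply: bdd_mfunM => //; split; last by exists M.
    apply: (measurableT_comp (continuous_measurable_fun ch)); exact: measurable_phase.
  by congr sq_int; apply/funext => z; rewrite /phase mk/=; congr (_ * h _); ring.
- exact: bdd_mfun_swap.
- by move=> z nz; apply: g0 => -[? ?]; apply: nz.
- by exists M.
Qed.

(** Here [f] stands for the real coordinates of the unknown on a plane, [w c k] for the weight
    frozen at the extreme point in the direction of slope [k] in chart [c], and [G c k] for the
    remaining part of the weight applied to the unknown. *)
Variables (I : finType) (f : I -> R * R -> R) (w : bool -> R -> I -> I -> R).
Variables (G : bool -> R -> I -> R * R -> R) (C0 delta : R).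

Definition sum_sqr z := \sum_j f j z ^+ 2.

Hypothesis bf : forall j, bdd_mfun (f j).
Hypothesis f_supp : forall j z, f j z != 0 -> 1 / 4 <= z.1 <= 3 / 4 /\ 1 / 4 <= z.2 <= 3 / 4.
Hypothesis f_cont : forall j z, f j z != 0 -> {for z, continuous (f j)}.
Hypothesis bG : forall c k i, `|k| <= 1 -> bdd_mfun (G c k i).
Hypothesis G_bound : forall c k i z, `|k| <= 1 -> G c k i z ^+ 2 <= delta * sum_sqr z.
Hypothesis G_lip : forall c k k' i z, `|k| <= 1 -> `|k'| <= 1 ->
  (G c k i z - G c k' i z) ^+ 2 <= delta * sum_sqr z * (k - k') ^+ 2.
Hypothesis C00 : 0 <= C0.
Hypothesis delta0 : 0 <= delta.
Hypothesis w_inv : forall c k (x : I -> R), `|k| <= 1 ->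
  \sum_j x j ^+ 2 <= C0 * \sum_i (\sum_j w c k i j * x j) ^+ 2.
Hypothesis lines : forall c k b i, `|k| <= 1 ->
  \int[mu]_t (\sum_j w c k i j * f j (chart c k b t) + G c k i (chart c k b t)) = 0.

Let f_unit_square j z : ~ unit_square z -> f j z = 0.
Proof.
move=> nz; apply/eqP; apply: contra_notT nz => /f_supp[/andP[? ?] /andP[? ?]].
by split; rewrite /= in_itv/=; apply/andP; split; lra.
Qed.

Let sqn_unit_square z : ~ unit_square z -> sum_sqr z = 0.
Proof. by move=> nz; apply: big1 => j _; rewrite f_unit_square// expr0n. Qed.

Let G_unit_square c k i z : `|k| <= 1 -> ~ unit_square z -> G c k i z = 0.
Proof.
move=> k1 nz; apply/eqP; rewrite -sqrf_eq0 eq_le sqr_ge0 andbT.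
by rewrite (le_trans (G_bound c i z k1))// sqn_unit_square// mulr0.
Qed.

Let bdd_mfun_sqn : bdd_mfun sum_sqr.
Proof. by apply: bdd_mfun_sum => j; exact: bdd_mfunM. Qed.

Let E := sq_int sum_sqr.

Let E0 : 0 <= E.
Proof. by apply: sq_int_ge0 => z; apply: sumr_ge0 => j _; exact: sqr_ge0. Qed.

Let bdd_mfun_trig (h : R -> R) m : continuous h -> (forall t, `|h t| <= 1) ->
  bdd_mfun (fun z => h (phase m z)).
Proof.
move=> ch h1; split; last by exists 1.
by apply: (measurableT_comp (continuous_measurable_fun ch)); exact: measurable_phase.
Qed.

Let frequency_eq (h : R -> R) m i : continuous h -> (forall t, `|h t| <= 1) ->
  \sum_j w (chart_of m) (slope m) i j * sq_int (fun z => f j z * h (phase m z)) =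
  - sq_int (fun z => G (chart_of m) (slope m) i z * h (phase m z)).
Proof.
move=> ch h1; have k1 := slope_le1 m.
set c := chart_of m; set k := slope m.
pose g z := \sum_j w c k i j * f j z + G c k i z.
have bh := bdd_mfun_trig m ch h1.
have bg : bdd_mfun g by apply: bdd_mfunD; [apply: bdd_mfun_sum => j; exact: bdd_mfunZ|exact: bG].
have := @sq_int_chart_vanish m g h bg; move=> /(_ _ ch (ex_intro _ 1 h1)).
have g0 z : ~ unit_square z -> g z = 0.
  by move=> nz; rewrite /g G_unit_square// big1 ?addr0// => j _; rewrite f_unit_square// mulr0.
move=> /(_ g0 (fun b => lines _ _ _ k1)) gh; apply/eqP.
rewrite -addr_eq0; apply/eqP; rewrite -[RHS]gh.
have bfh j : bdd_mfun (fun z => f j z * h (phase m z)) by exact: bdd_mfunM.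
have bGh : bdd_mfun (fun z => G c k i z * h (phase m z)) by apply: bdd_mfunM => //; exact: bG.
pose F j z := w c k i j * (f j z * h (phase m z)).
have bF j : bdd_mfun (F j) by exact: bdd_mfunZ.
have -> : \sum_j w c k i j * sq_int (fun z => f j z * h (phase m z)) = \sum_j sq_int (F j).
  by apply: eq_bigr => j _; rewrite /F sq_intZ.
rewrite -sq_int_sum//.
rewrite -sq_intD//; last exact: bdd_mfun_sum.
congr sq_int; apply/funext => z; rewrite /g mulrDl mulr_suml.
by congr (_ + _); apply: eq_bigr => j _; rewrite /F mulrA.
Qed.

(** For a fixed slope, Bessel's inequality applied to [G c k i], and to differences of two such
    functions, yields the two hypotheses of [chaining]; the slope may then depend on the frequency.
    The charts are kept apart because the parameter has to range over one interval. *)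
Let chart_sum (T : finType) (m : T -> int * int) (h : R -> R) c i : injective m ->
  continuous h -> (forall t, `|h t| <= 1) ->
  (forall (S : pred T) g, bdd_mfun g ->
     \sum_(t | S t) (sq_int (fun z => g z * h (phase (m t) z))) ^+ 2 <= sq_int (fun z => g z ^+
       2)) ->
  \sum_(t | chart_of (m t) == c)
     sq_int (fun z => G c (slope (m t)) i z * h (phase (m t) z)) ^+ 2 <= chain_cst * (delta * E).
Proof.
move=> mI ch h1 bes.
apply: (@chaining R T (fun t => chart_of (m t) == c)
   (fun t k => sq_int (fun z => G c k i z * h (phase (m t) z))) (delta * E) _ _ _
   (fun t => slope (m t))) => [|k k1|k k' k1 k'1|t].
- exact: mulr_ge0.
- apply: (le_trans (bes _ _ (bG c i k1))); rewrite -sq_intZ//; apply: sq_int_le.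
  + by apply: bdd_mfunM; exact: bG.
  + exact: bdd_mfunZ.
  + by move=> z _; exact: G_bound.
- have bB : bdd_mfun (fun z => G c k i z - G c k' i z) by apply: bdd_mfunB; exact: bG.
  rewrite (eq_bigr (fun t => sq_int (fun z => (G c k i z - G c k' i z) * h (phase (m t) z)) ^+ 2)).
    apply: (le_trans (bes _ _ bB)).
    rewrite mulrAC -mulrA -sq_intZ// -sq_intZ; last exact: bdd_mfunZ.
    apply: sq_int_le; [exact: bdd_mfunM|exact/bdd_mfunZ/bdd_mfunZ|].
    by move=> z _; rewrite [_ * sum_sqr z]mulrC mulrA; exact: G_lip.
  move=> t _; congr (_ ^+ 2); have bh := bdd_mfun_trig (m t) ch h1.
  rewrite -sq_intB; [|by apply: bdd_mfunM => //; exact: bG..].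
  by congr sq_int; apply/funext => z; rewrite mulrBl.
- exact: slope_le1.
Qed.

(** The factor 4 counts two charts and the two waves, cosine and sine; [#|I|] comes from summing the
    same bound over the components of [G]. *)
Let family_sum (T : finType) (m : T -> int * int) : injective m ->
  \sum_j \sum_t (cos_coef (f j) (m t) ^+ 2 + sin_coef (f j) (m t) ^+ 2) <=
  4 * chain_cst * C0 * #|I|%:R * delta * E.
Proof.
move=> mI.
have trig (h : R -> R) : continuous h -> (forall t, `|h t| <= 1) ->
  (forall (S : pred T) g, bdd_mfun g ->
     \sum_(t | S t) (sq_int (fun z => g z * h (phase (m t) z))) ^+ 2 <= sq_int (fun z => g z ^+
       2)) ->
  \sum_j \sum_t sq_int (fun z => f j z * h (phase (m t) z)) ^+ 2 <=
  2 * chain_cst * C0 * #|I|%:R * delta * E.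
  move=> ch h1 bes; rewrite exchange_big/=.
  apply: (@le_trans _ _ (\sum_t C0 * \sum_i
     sq_int (fun z => G (chart_of (m t)) (slope (m t)) i z * h (phase (m t) z)) ^+ 2)).
    apply: ler_sum => t _.
    apply: (le_trans (w_inv (chart_of (m t)) _ (slope_le1 (m t)))).
    by rewrite ler_wpM2l//; apply: ler_sum => i _; rewrite frequency_eq// sqrrN.
  rewrite -mulr_sumr exchange_big/= (_ : 2 * chain_cst * C0 * _ * delta * E =
    C0 * \sum_(i : I) 2 * (chain_cst * (delta * E))); last first.
    by rewrite sumr_const -[_ *+ _]mulr_natl; ring.
  rewrite ler_wpM2l//; apply: ler_sum => i _.
  rewrite (bigID (fun t => chart_of (m t)))/=.
  rewrite (_ : 2 * (chain_cst * _) = chain_cst * (delta * E) + chain_cst * (delta * E));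
    last by ring.
  apply: lerD.
    rewrite (eq_big (fun t => chart_of (m t) == true)
     (fun t => sq_int (fun z => G true (slope (m t)) i z * h (phase (m t) z)) ^+ 2)).
    - exact: chart_sum.
    - by move=> t; rewrite eqb_id.
    - by move=> t ->.
  rewrite (eq_big (fun t => chart_of (m t) == false)
     (fun t => sq_int (fun z => G false (slope (m t)) i z * h (phase (m t) z)) ^+ 2)).
  - exact: chart_sum.
  - by move=> t; rewrite eqbF_neg.
  - by move=> t /negPf ->.
have bes_c (S : pred T) g : bdd_mfun g ->
    \sum_(t | S t) (sq_int (fun z => g z * cos (phase (m t) z))) ^+ 2 <= sq_int (fun z => g z ^+ 2).
  move=> bg; apply: le_trans (bessel S mI bg); apply: ler_sum => t _.
  by rewrite lerDl sqr_ge0.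
have bes_s (S : pred T) g : bdd_mfun g ->
    \sum_(t | S t) (sq_int (fun z => g z * sin (phase (m t) z))) ^+ 2 <= sq_int (fun z => g z ^+ 2).
  move=> bg; apply: le_trans (bessel S mI bg); apply: ler_sum => t _.
  by rewrite lerDr sqr_ge0.
have := lerD (trig _ (@continuous_cos R) (@cos_max R) bes_c)
             (trig _ (@continuous_sin R) (@sin_max R) bes_s).
rewrite -big_split/= => h.
rewrite (_ : 4 * chain_cst * C0 * #|I|%:R * delta * E = 2 * chain_cst * C0 * #|I|%:R * delta * E +
   2 * chain_cst * C0 * #|I|%:R * delta * E); last by ring.
by under eq_bigr do rewrite big_split.
Qed.

Lemma plane_estimate : sq_int sum_sqr <= 4 * chain_cst * C0 * #|I|%:R * delta * sq_int sum_sqr.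
Proof.
have cvE : (\sum_j fejer_energy n (f j)) @[n --> \oo] --> \sum_j sq_int (fun z => f j z ^+ 2).
  apply: cvg_big => [|j _]; first exact: add_continuous.
  by apply: fejer_energy_cvg => //; [exact: f_supp|exact: f_cont].
have ES : sq_int sum_sqr = \sum_j sq_int (fun z => f j z ^+ 2)
  by rewrite /sum_sqr sq_int_sum// => j; exact: bdd_mfunM.
suff : limn (fun n => \sum_j fejer_energy n (f j)) <=
    4 * chain_cst * C0 * #|I|%:R * delta * sq_int sum_sqr by rewrite (cvg_lim _ cvE)// -ES.
apply: limr_le; first by apply/cvg_ex; eexists; exact: cvE.
apply: nearW => n.
(* The shift [p] is moved outside: for fixed [p] the frequencies are pairwise distinct, so
   [family_sum] applies, and the number of shifts cancels the normalizing factor. *)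
have -> : \sum_j fejer_energy n (f j) = n.+1%:R^-1 ^+ 2 * \sum_p \sum_j \sum_i
   (cos_coef (f j) (dfreq n i p) ^+ 2 + sin_coef (f j) (dfreq n i p) ^+ 2).
  rewrite exchange_big/= mulr_sumr; apply: eq_bigr => j _.
  by rewrite /fejer_energy exchange_big.
rewrite mulrC -ler_pdivlMr ?exprn_gt0 ?invr_gt0// -exprVn invrK.
apply: (@le_trans _ _ (\sum_(p : 'I_n.+1 * 'I_n.+1) 4 * chain_cst * C0 * #|I|%:R * delta * E)).
  apply: ler_sum => p _; apply: family_sum => i j.
  move=> [] /addIr ij1 /addIr ij2; apply: (@freq_of_pair_inj n).
  by rewrite /freq_of_pair ij1 ij2.
by rewrite sumr_const card_prod !card_ord -[leLHS]mulr_natr natrM expr2.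
Qed.

End PlaneEstimate.

(** * Complex and Euclidean norms *)

Section ComplexNorms.
Variable R : realType.

Definition cmod (z : R[i]) : R := complex.Re `|z|.

Lemma cmod_sqr z : cmod z ^+ 2 = complex.Re z ^+ 2 + complex.Im z ^+ 2.
Proof. by rewrite /cmod normc_def/= sqr_sqrtr// addr_ge0// sqr_ge0. Qed.

Lemma cmod_ge0 z : 0 <= cmod z.
Proof. by rewrite /cmod normc_def/= sqrtr_ge0. Qed.

Lemma cmod0 : cmod 0 = 0.
Proof. by rewrite /cmod normr0. Qed.

Lemma cmodD z w : cmod (z + w) <= cmod z + cmod w.
Proof. by have := ler_normD z w; rewrite lecE => /andP[_]; rewrite raddfD. Qed.

Lemma cmodM z w : cmod (z * w) = cmod z * cmod w.
Proof. by rewrite /cmod normrM !normc_def/= mulr0 subr0. Qed.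

Lemma cmod_real (a : R) : cmod (a%:C)%C = `|a|.
Proof. by rewrite /cmod normc_def/= expr0n addr0 sqrtr_sqr. Qed.

Lemma cmod_sum (I : Type) (s : seq I) (P : pred I) (F : I -> R[i]) :
  cmod (\sum_(i <- s | P i) F i) <= \sum_(i <- s | P i) cmod (F i).
Proof.
elim/big_ind2 : _ => [|x1 x2 y1 y2 h1 h2|//]; first by rewrite cmod0.
by rewrite (le_trans (cmodD _ _))// lerD.
Qed.

Definition part (b : bool) (z : R[i]) : R := if b then complex.Re z else complex.Im z.

Lemma part_le_cmod b z : `|part b z| <= cmod z.
Proof.
rewrite -ler_sqr ?nnegrE ?cmod_ge0// real_normK ?num_real// cmod_sqr.
by case: b; rewrite /= ?lerDl ?lerDr sqr_ge0.
Qed.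

Lemma partD b z w : part b (z + w) = part b z + part b w.
Proof. by case: b z w => -[? ?] [? ?]. Qed.

Lemma partN b z : part b (- z) = - part b z.
Proof. by case: b z => -[? ?]. Qed.

Lemma partB b z w : part b (z - w) = part b z - part b w.
Proof. by rewrite partD partN. Qed.

Lemma part0 b : part b 0 = 0.
Proof. by case: b. Qed.

Lemma part_sum b (I : Type) (s : seq I) (P : pred I) (F : I -> R[i]) :
  part b (\sum_(i <- s | P i) F i) = \sum_(i <- s | P i) part b (F i).
Proof. by elim/big_ind2 : _ => [|x1 x2 y1 y2 <- <-|//]; rewrite ?part0 ?partD. Qed.

Section Mnorm.
Variables m p : nat.
Implicit Types A B : 'M[cplx R]_(m, p).

Lemma mnorm_entry A i j : cmod (A i j) <= mnorm A.
Proof.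
have : `|A i j| <= `|A| :> cplx R.
  rewrite [leRHS]/Num.norm/= mx_normE -[A i j]/(A (i, j).1 (i, j).2).
  by rewrite -[leLHS]nngE num_le; exact: le_bigmax.
by rewrite lecE => /andP[].
Qed.

Lemma mnorm_attained A : mnorm A = 0 \/ exists i j, mnorm A = cmod (A i j).
Proof.
have [A0|/mx_norm_neq0[[i j] Aij]] := eqVneq (mx_norm A) 0; [left|right].
  by rewrite /mnorm [X in complex.Re X]A0.
by exists i, j; rewrite /mnorm [X in complex.Re X]Aij.
Qed.

Lemma mnorm_le A M : 0 <= M -> (forall i j, cmod (A i j) <= M) -> mnorm A <= M.
Proof. by move=> M0 AM; have [->//|[i [j ->]]] := mnorm_attained A. Qed.

Lemma mnorm_ge0 A : 0 <= mnorm A.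
Proof. by have [->//|[i [j ->]]] := mnorm_attained A; exact: cmod_ge0. Qed.

Lemma mnormD A B : mnorm (A + B) <= mnorm A + mnorm B.
Proof.
apply: mnorm_le => [|i j]; first by rewrite addr_ge0// mnorm_ge0.
by rewrite mxE (le_trans (cmodD _ _))// lerD// mnorm_entry.
Qed.

Lemma mnorm0 : mnorm (0 : 'M[cplx R]_(m, p)) = 0.
Proof. by rewrite /mnorm normr0. Qed.

Lemma mnormN A : mnorm (- A) = mnorm A.
Proof. by rewrite /mnorm normrN. Qed.

Lemma mnorm_distC A B : mnorm (A - B) = mnorm (B - A).
Proof. by rewrite -mnormN opprB. Qed.

Lemma mnormB A B : mnorm (A - B) <= mnorm A + mnorm B.
Proof. by rewrite (le_trans (mnormD _ _))// mnormN. Qed.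

Lemma mnorm_dist_le A B : `|mnorm A - mnorm B| <= mnorm (A - B).
Proof.
rewrite ler_norml; apply/andP; split.
  have := mnormD (B - A) A; rewrite subrK mnorm_distC; lra.
by have := mnormD (A - B) B; rewrite subrK; lra.
Qed.

Lemma mnormZ (a : R) A : mnorm ((a%:C)%C *: A) <= `|a| * mnorm A.
Proof.
apply: mnorm_le => [|i j]; first by rewrite mulr_ge0// mnorm_ge0.
by rewrite mxE [cmod _]cmodM cmod_real ler_wpM2l// mnorm_entry.
Qed.

Lemma mnorm_sum (I : Type) (s : seq I) (P : pred I) (F : I -> 'M[cplx R]_(m, p)) :
  mnorm (\sum_(i <- s | P i) F i) <= \sum_(i <- s | P i) mnorm (F i).
Proof.
elim/big_ind2 : _ => [|x1 x2 y1 y2 h1 h2|//]; first by rewrite mnorm0.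
by rewrite (le_trans (mnormD _ _))// lerD.
Qed.

End Mnorm.

Lemma mnormM m p q (A : 'M[cplx R]_(m, p)) (B : 'M[cplx R]_(p, q)) :
  mnorm (A *m B) <= p%:R * mnorm A * mnorm B.
Proof.
apply: mnorm_le => [|i j]; first by rewrite !mulr_ge0// mnorm_ge0.
rewrite mxE; apply: (le_trans (cmod_sum _ _ _)).
apply: (@le_trans _ _ (\sum_(k < p) mnorm A * mnorm B)).
  apply: ler_sum => k _; rewrite [cmod _]cmodM.
  by apply: ler_pM; rewrite ?cmod_ge0 ?mnorm_entry.
by rewrite sumr_const card_ord -[leLHS]mulr_natl mulrA.
Qed.

Lemma sqr_sum_le (N : nat) (x : 'I_N -> R) :
  (\sum_i x i) ^+ 2 <= N%:R * \sum_i x i ^+ 2.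
Proof.
have : 0 <= \sum_i \sum_j (x i - x j) ^+ 2.
  by apply: sumr_ge0 => i _; apply: sumr_ge0 => j _; exact: sqr_ge0.
have -> : \sum_i \sum_j (x i - x j) ^+ 2 =
    2 * (N%:R * \sum_i x i ^+ 2) - 2 * (\sum_i x i) ^+ 2.
  transitivity (\sum_(i < N) (N%:R * x i ^+ 2 + \sum_j x j ^+ 2 - 2 * (x i * \sum_j x j))).
    apply: eq_bigr => i _.
    rewrite (mulr_sumr (index_enum 'I_N) xpredT x (x i)) mulr_sumr.
    have -> : N%:R * x i ^+ 2 = \sum_(j < N) x i ^+ 2.
      by rewrite sumr_const card_ord mulr_natl.
    by rewrite -big_split -sumrB; apply: eq_bigr => j _ /=; ring.
  rewrite sumrB big_split/= -!mulr_sumr -mulr_suml sumr_const card_ord -mulr_natl; ring.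
lra.
Qed.

(* The real coordinates of C^N are indexed by (j, true) for the real part of the
   j-th entry and (j, false) for its imaginary part. *)
Definition realify N (A : 'M[cplx R]_N) (i j : 'I_N * bool) : R :=
  if i.2 then (if j.2 then complex.Re (A i.1 j.1) else - complex.Im (A i.1 j.1))
  else (if j.2 then complex.Im (A i.1 j.1) else complex.Re (A i.1 j.1)).

Definition coords N (v : 'cV[cplx R]_N) (i : 'I_N * bool) : R := part i.2 (v i.1 0).

Lemma sum_realify N (A : 'M[cplx R]_N) (v : 'cV[cplx R]_N) i :
  \sum_j realify A i j * coords v j = coords (A *m v) i.
Proof.
rewrite -(pair_bigA _ (fun j b => realify A i (j, b) * coords v (j, b)))/=.
rewrite /coords mxE part_sum; apply: eq_bigr => j _.
rewrite big_bool /realify/=; case: i.2; case: (A i.1 j) => a b; case: (v j 0) => c d /=; ring.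
Qed.

Lemma sum_coords_sqr N (v : 'cV[cplx R]_N) :
  \sum_i coords v i ^+ 2 = \sum_(j < N) cmod (v j 0) ^+ 2.
Proof.
rewrite -(pair_bigA _ (fun j b => coords v (j, b) ^+ 2))/=.
by apply: eq_bigr => j _; rewrite big_bool cmod_sqr.
Qed.

Lemma coordsK N (x : 'I_N * bool -> R) :
  x =1 coords (\col_j (x (j, true) +i* x (j, false))%C).
Proof. by move=> [j b]; rewrite /coords mxE; case: b. Qed.

(** In the maximum norm, applying the inverse costs [N%:R * M]; the outer [N%:R] is the passage from
    the maximum to the sum of squares. *)
Lemma realify_inv N (A : 'M[cplx R]_N) M (x : 'I_N * bool -> R) : A \in unitmx ->
  mnorm (invmx A) <= M ->
  \sum_j x j ^+ 2 <= N%:R * (N%:R * M) ^+ 2 * \sum_i (\sum_j realify A i j * x j) ^+ 2.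
Proof.
move=> Au AM; set v := (\col_j (x (j, true) +i* x (j, false))%C : 'cV[cplx R]_N).
have -> : \sum_j x j ^+ 2 = \sum_j coords v j ^+ 2 by apply: eq_bigr => j _; rewrite (coordsK x).
have -> : \sum_i (\sum_j realify A i j * x j) ^+ 2 = \sum_i coords (A *m v) i ^+ 2.
  apply: eq_bigr => i _; rewrite -sum_realify; congr (_ ^+ 2).
  by apply: eq_bigr => j _; rewrite (coordsK x).
rewrite !sum_coords_sqr; set u := A *m v.
have vu : mnorm v <= N%:R * M * mnorm u.
  have -> : v = invmx A *m u by rewrite /u mulKmx.
  apply: (le_trans (mnormM _ _)); rewrite ler_wpM2r ?mnorm_ge0//.
  by rewrite ler_wpM2l.
have M0 : 0 <= M by rewrite (le_trans _ AM)// mnorm_ge0.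
have u2 : mnorm u ^+ 2 <= \sum_(i < N) cmod (u i 0) ^+ 2.
  rewrite -(@ler_sqrt _ _ _) ?sumr_ge0// => [|i _]; last exact: sqr_ge0.
  rewrite sqrtr_sqr ger0_norm ?mnorm_ge0//; apply: mnorm_le => [|i j]; first exact: sqrtr_ge0.
  rewrite -(ger0_norm (cmod_ge0 _)) -sqrtr_sqr ler_wsqrtr// ord1 (bigD1 i)//= lerDl.
  by apply: sumr_ge0 => k _; exact: sqr_ge0.
apply: (@le_trans _ _ (\sum_(j < N) (N%:R * M * mnorm u) ^+ 2)).
  apply: ler_sum => j _; rewrite ler_sqr ?nnegrE ?cmod_ge0//.
    by rewrite (le_trans _ vu)// mnorm_entry.
  by rewrite !mulr_ge0// mnorm_ge0.
rewrite sumr_const card_ord -[leLHS]mulr_natl exprMn mulrA ler_wpM2l//.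
by rewrite mulr_ge0// sqr_ge0.
Qed.

End ComplexNorms.

Section Euclidean.
Variables (R : realType) (n : nat).
Implicit Types x y u v : 'rV[R]_n.

Definition dot x y : R := \sum_i x 0 i * y 0 i.

Lemma dotC x y : dot x y = dot y x.
Proof. by apply: eq_bigr => i _; rewrite mulrC. Qed.

Lemma dotDl x y u : dot (x + y) u = dot x u + dot y u.
Proof. by rewrite /dot -big_split; apply: eq_bigr => i _; rewrite mxE mulrDl. Qed.

Lemma dotZl a x u : dot (a *: x) u = a * dot x u.
Proof. by rewrite /dot mulr_sumr; apply: eq_bigr => i _; rewrite mxE mulrA. Qed.

Lemma dotNl x u : dot (- x) u = - dot x u.
Proof. by rewrite -scaleN1r dotZl mulN1r. Qed.

Lemma dotDr x y u : dot u (x + y) = dot u x + dot u y.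
Proof. by rewrite dotC dotDl !(dotC _ u). Qed.

Lemma dotZr a x u : dot u (a *: x) = a * dot u x.
Proof. by rewrite dotC dotZl dotC. Qed.

Lemma dotNr x u : dot u (- x) = - dot u x.
Proof. by rewrite dotC dotNl dotC. Qed.

Lemma enorm_sqr x : enorm x ^+ 2 = dot x x.
Proof.
rewrite /enorm sqr_sqrtr; first by apply: eq_bigr => i _; rewrite expr2.
by apply: sumr_ge0 => i _; exact: sqr_ge0.
Qed.

Lemma enorm_ge0 x : 0 <= enorm x.
Proof. exact: sqrtr_ge0. Qed.

Lemma enorm0 : enorm (0 : 'rV[R]_n) = 0.
Proof. by rewrite /enorm big1 ?sqrtr0// => i _; rewrite mxE expr0n. Qed.

Lemma enormZ a x : enorm (a *: x) = `|a| * enorm x.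
Proof.
have h : enorm (a *: x) ^+ 2 = (`|a| * enorm x) ^+ 2.
  by rewrite exprMn !enorm_sqr dotZl dotZr real_normK ?num_real// mulrA.
have := congr1 Num.sqrt h; rewrite !sqrtr_sqr (ger0_norm (enorm_ge0 _)).
by rewrite (ger0_norm (mulr_ge0 (normr_ge0 a) (enorm_ge0 x))).
Qed.

Lemma enormN x : enorm (- x) = enorm x.
Proof. by rewrite -scaleN1r enormZ normrN1 mul1r. Qed.

Lemma enorm_distC x y : enorm (x - y) = enorm (y - x).
Proof. by rewrite -enormN opprB. Qed.

Lemma cauchy_schwarz x y : dot x y <= enorm x * enorm y.
Proof.
have x0 := enorm_ge0 x; have y0 := enorm_ge0 y.
have : 0 <= enorm (enorm y *: x - enorm x *: y) ^+ 2 by exact: sqr_ge0.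
rewrite enorm_sqr dotDl !dotDr !dotZl !dotNl !dotNr !dotZl !dotZr -!enorm_sqr (dotC y x).
have [xy0|xy0] := eqVneq (enorm x * enorm y) 0.
  have nz (z : 'rV[R]_n) : enorm z = 0 -> forall i, z 0 i = 0.
    move=> z0 i; apply/eqP; rewrite -sqrf_eq0 eq_le sqr_ge0 andbT.
    have <- : \sum_i z 0 i ^+ 2 = 0.
      transitivity (enorm z ^+ 2); last by rewrite z0 expr0n.
      by rewrite enorm_sqr; apply: eq_bigr => j _; rewrite expr2.
    by rewrite [leRHS](bigD1 i)//= lerDl sumr_ge0// => j _; exact: sqr_ge0.
  move=> _; rewrite xy0; move/eqP: xy0; rewrite mulf_eq0 => /orP[|] /eqP/nz h.
    by rewrite /dot big1// => i _; rewrite h mul0r.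
  by rewrite /dot big1// => i _; rewrite h mulr0.
have xy : 0 < enorm x * enorm y by rewrite lt_neqAle eq_sym xy0 mulr_ge0.
have xy2 : 0 < 2 * (enorm x * enorm y) by rewrite mulr_gt0.
rewrite -[dot x y <= _]subr_ge0 -(pmulr_rge0 _ xy2) => /le_trans -> //.
by rewrite le_eqVlt; apply/orP; left; apply/eqP; ring.
Qed.

Lemma enormD x y : enorm (x + y) <= enorm x + enorm y.
Proof.
rewrite -ler_sqr ?nnegrE ?addr_ge0 ?enorm_ge0//.
rewrite enorm_sqr dotDl !dotDr -!enorm_sqr (dotC y x).
by have := cauchy_schwarz x y; nra.
Qed.

Lemma enormB x y : enorm (x - y) <= enorm x + enorm y.
Proof. by rewrite (le_trans (enormD _ _))// enormN. Qed.

Lemma enorm_entry x i : `|x 0 i| <= enorm x.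
Proof.
rewrite -ler_sqr ?nnegrE ?enorm_ge0// real_normK ?num_real// enorm_sqr /dot.
rewrite (bigD1 i)//= -expr2 lerDl; apply: sumr_ge0 => j _.
by rewrite -expr2 sqr_ge0.
Qed.

Lemma enorm_eq0 x : enorm x = 0 -> x = 0.
Proof.
move=> x0; apply/rowP => i; rewrite mxE; apply/eqP; rewrite -normr_le0 -x0.
exact: enorm_entry.
Qed.

Lemma entry_norm x i : `|x 0 i| <= `|x|.
Proof.
by rewrite [leRHS]/Num.norm/= mx_normrE; apply: (le_bigmax _ (fun ij => `|x ij.1 ij.2|) (0, i)).
Qed.

Lemma enorm_le_norm x : enorm x <= n%:R * `|x|.
Proof.
rewrite -ler_sqr ?nnegrE ?mulr_ge0 ?enorm_ge0// enorm_sqr.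
apply: (@le_trans _ _ (\sum_(i < n) `|x| ^+ 2)).
  apply: ler_sum => i _; rewrite -expr2 -[leLHS]real_normK ?num_real//.
  by rewrite ler_sqr ?nnegrE// entry_norm.
rewrite sumr_const card_ord -[leLHS]mulr_natl exprMn ler_wpM2r ?sqr_ge0//.
by rewrite -natrX ler_nat; case: (n) => // k; rewrite leq_pmulr.
Qed.

Lemma norm_le_enorm x : `|x| <= enorm x.
Proof.
rewrite [leLHS]/Num.norm/= mx_normrE; apply/bigmax_leP; split; first exact: enorm_ge0.
by move=> [i j] _; rewrite ord1; exact: enorm_entry.
Qed.

Lemma enorm_dist_le x y : `|enorm x - enorm y| <= enorm (x - y).
Proof.
rewrite ler_norml; apply/andP; split.
  have := enormD (y - x) x; rewrite subrK enorm_distC; lra.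
by have := enormD (x - y) y; rewrite subrK; lra.
Qed.

(** One copy of |x - y| comes from moving the vector, one from changing the normalizing factor;
    outside the unit ball both carry 1/|x| <= 1. *)
Lemma normalize_lip x y : 1 <= enorm x -> 1 <= enorm y ->
  enorm ((enorm x)^-1 *: x - (enorm y)^-1 *: y) <= 2 * enorm (x - y).
Proof.
move=> x1 y1; have x0 : 0 < enorm x by exact: lt_le_trans x1.
have y0 : 0 < enorm y by exact: lt_le_trans y1.
have -> : (enorm x)^-1 *: x - (enorm y)^-1 *: y =
   (enorm x)^-1 *: (x - y) + ((enorm x)^-1 - (enorm y)^-1) *: y.
  by rewrite scalerBr scalerBl addrA subrK.
apply: (le_trans (enormD _ _)); rewrite !enormZ.
have -> : `|(enorm x)^-1 - (enorm y)^-1| * enorm y = (enorm x)^-1 * `|enorm x - enorm y|.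
  have -> : (enorm x)^-1 - (enorm y)^-1 = (enorm x)^-1 * (enorm y)^-1 * (enorm y - enorm x).
    by field; rewrite !gt_eqF.
  rewrite !normrM !normfV (gtr0_norm x0) (gtr0_norm y0) distrC; field.
  by rewrite !gt_eqF.
rewrite gtr0_norm ?invr_gt0// -mulrDr -[leRHS]mul1r.
have h := enorm_dist_le x y.
apply: ler_pM; rewrite ?invr_ge0 ?addr_ge0 ?enorm_ge0//; first by rewrite invf_le1.
lra.
Qed.

End Euclidean.

(** * Sets and functions in Euclidean space *)

Section EuclideanTopology.
Variables (R : realType) (n : nat).
Local Notation E := 'rV[R]_n.
Implicit Types (D : set E) (x y v : E).

(** The ambient topology is that of the maximum norm, while all geometry is Euclidean; this
    comparison, with [enorm_ball], is behind the Euclidean criteria for open sets, closures and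
    interiors. *)
Lemma enorm_lt_ball x (e : R) : 0 < e -> exists2 d : R, 0 < d &
  forall y, ball x d y -> enorm (y - x) < e.
Proof.
move=> e0; exists (e / n.+1%:R) => [|y]; first by rewrite divr_gt0.
rewrite -ball_normE/= distrC ltr_pdivlMr// mulrC => h.
apply: le_lt_trans h; apply: (le_trans (enorm_le_norm _)).
by rewrite ler_wpM2r// ler_nat.
Qed.

Lemma enorm_ball x (e : R) y : enorm (y - x) < e -> ball x e y.
Proof. by rewrite -ball_normE/= distrC => h; apply: le_lt_trans h; exact: norm_le_enorm. Qed.

Lemma open_enormP D : open D <->
  forall x, D x -> exists2 e : R, 0 < e & forall y, enorm (y - x) < e -> D y.
Proof.
split=> [oD x Dx|h].
  have /nbhs_ballP[e /= e0 eD] : nbhs x D by exact: open_nbhs_nbhs.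
  by exists e => // y /enorm_ball/eD.
rewrite openE => x /h[e e0 eD]; have [d d0 de] := enorm_lt_ball x e0.
by apply/nbhs_ballP; exists d => // y /de/eD.
Qed.

Lemma closure_enormP D x : closure D x <->
  forall e : R, 0 < e -> exists2 y, D y & enorm (y - x) < e.
Proof.
split=> [cD e e0|h B /nbhs_ballP[e /= e0 eB]].
  have [d d0 de] := enorm_lt_ball x e0.
  by have [y [Dy /de]] := cD _ (nbhsx_ballx x d d0); exists y.
by have [y Dy /enorm_ball/eB] := h _ e0; exists y.
Qed.

Lemma interior_enormP D x : D^° x <->
  exists2 e : R, 0 < e & forall y, enorm (y - x) < e -> D y.
Proof.
split=> [/nbhs_ballP[e /= e0 eD]|[e e0 eD]]; first by exists e => // y /enorm_ball/eD.
have [d d0 de] := enorm_lt_ball x e0.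
by apply/nbhs_ballP; exists d => // y /de/eD.
Qed.

Lemma bounded_enormP D : bounded_set D -> exists2 B : R, 0 < B & forall x, D x -> enorm x <= B.
Proof.
move=> [M [_ hM]]; pose M' := `|M| + 1.
have M0 : 0 < M' by rewrite ltr_wpDl.
exists (n.+1%:R * M') => [|x Dx]; first by rewrite mulr_gt0.
apply: (le_trans (enorm_le_norm _)); apply: ler_pM => //; first by rewrite ler_nat.
by apply: hM => //; rewrite (le_lt_trans (ler_norm M))// ltrDl.
Qed.

Lemma closure_enorm_le D (B : R) : (forall x, D x -> enorm x <= B) ->
  forall x, closure D x -> enorm x <= B.
Proof.
move=> DB x /closure_enormP cD; apply/ler_addgt0Pr => e e0.
have [y /DB yB yx] := cD _ e0.
have := enormD (x - y) y; rewrite subrK enorm_distC; lra.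
Qed.

Lemma convexP D : convex_set D ->
  forall x y (t : R), D x -> D y -> 0 <= t -> t <= 1 -> D (x + t *: (y - x)).
Proof.
move=> cD x y t Dx Dy t0 t1.
have t01 : t \in `[0, 1] by rewrite in_itv/= t0.
have := cD y x (Itv01 t0 t1); rewrite !inE => /(_ Dy Dx).
have <- : t *: y + (1 - t) *: x = x + t *: (y - x).
  by rewrite scalerBl scale1r scalerBr addrCA.
exact.
Qed.

Section Convex.
Variable D : set E.
Hypotheses (oD : open D) (cD : convex_set D).

Lemma closure_convex x y (t : R) : closure D x -> closure D y -> 0 <= t -> t <= 1 ->
  closure D (x + t *: (y - x)).
Proof.
move=> /closure_enormP cx /closure_enormP cy t0 t1; apply/closure_enormP => e e0.
have e2 : 0 < e / 2 by rewrite divr_gt0.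
have [x' Dx' xx'] := cx _ e2; have [y' Dy' yy'] := cy _ e2.
exists (x' + t *: (y' - x')); first exact: convexP.
have -> : x' + t *: (y' - x') - (x + t *: (y - x)) = (1 - t) *: (x' - x) + t *: (y' - y).
  by apply/rowP => i; rewrite !mxE; ring.
apply: (le_lt_trans (enormD _ _)); rewrite !enormZ !ger0_norm ?subr_ge0//.
have h1 := enorm_ge0 (x' - x); have h2 := enorm_ge0 (y' - y); nra.
Qed.

Lemma segment_open x y (t : R) : D x -> closure D y -> 0 <= t -> t < 1 ->
  D (x + t *: (y - x)).
Proof.
move=> Dx /closure_enormP cy t0 t1.
have [e e0 eD] := (open_enormP D).1 oD x Dx.
have t1' : 0 < 1 - t by rewrite subr_gt0.
have [y' Dy' yy'] := cy _ (mulr_gt0 e0 t1').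
(* Approximating [y] by [y'] moves the point at parameter [t]; [x] is moved the other way to
   compensate exactly, and stays in [D] because [y'] is close enough. *)
pose x' := x + (t / (1 - t)) *: (y - y').
have Dx' : D x'.
  apply: eD; rewrite /x' addrAC subrr add0r enormZ enorm_distC ger0_norm ?divr_ge0// ?ltW//.
  rewrite mulrAC ltr_pdivrMr//; have := enorm_ge0 (y' - y); nra.
have -> : x + t *: (y - x) = x' + t *: (y' - x').
  by apply/rowP => i; rewrite !mxE; field; rewrite gt_eqF.
by apply: convexP => //; exact: ltW.
Qed.

End Convex.

Section Plane.
Variables (c u v : E).

Definition plane (z : R * R) : E := c + z.1 *: u + z.2 *: v.

Lemma plane_near (z : R * R) (e : R) : 0 < e -> exists2 d : R, 0 < d &
  forall z', ball z d z' -> enorm (plane z' - plane z) < e.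
Proof.
move=> e0; pose L := enorm u + enorm v + 1.
have u0 := enorm_ge0 u; have v0 := enorm_ge0 v.
have L0 : 0 < L by rewrite /L; lra.
exists (e / L) => [|z' [h1 h2]]; first by rewrite divr_gt0.
have {}h1 : `|z'.1 - z.1| < e / L by rewrite distrC.
have {}h2 : `|z'.2 - z.2| < e / L by rewrite distrC.
have -> : plane z' - plane z = (z'.1 - z.1) *: u + (z'.2 - z.2) *: v.
  by apply/rowP => i; rewrite !mxE; ring.
apply: (le_lt_trans (enormD _ _)); rewrite !enormZ.
have eL : e = e / L * L by rewrite mulfVK// gt_eqF.
have eL0 : 0 < e / L by rewrite divr_gt0.
have h3 : `|z'.1 - z.1| * enorm u <= e / L * enorm u by rewrite ler_wpM2r// ltW.
have h4 : `|z'.2 - z.2| * enorm v <= e / L * enorm v by rewrite ler_wpM2r// ltW.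
rewrite [ltRHS]eL /L !mulrDr mulr1; lra.
Qed.

End Plane.

(** Functions on [D] extended by zero: continuity is required along [D] only, so a jump at its
    boundary is allowed. *)
Definition tame D (F : E -> R) : Prop :=
  [/\ forall x, D x -> forall e : R, 0 < e -> exists2 d : R, 0 < d &
        forall y, D y -> enorm (y - x) < d -> `|F y - F x| < e,
      forall x, ~ D x -> F x = 0 &
      exists M : R, forall x, `|F x| <= M].

Lemma tame_plane_continuous D F c u v z : open D -> tame D F -> D (plane c u v z) ->
  {for z, continuous (F \o plane c u v)}.
Proof.
move=> oD [cF _ _] Dz; apply/cvgrPdist_lt => e e0.
have [d d0 dF] := cF _ Dz _ e0; have [d' d'0 d'D] := (open_enormP D).1 oD _ Dz.
have m0 : 0 < Num.min d d' by rewrite lt_min d0.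
have [r r0 rP] := plane_near c u v z m0.
apply: filterS (nbhsx_ballx z r r0) => z' /rP; rewrite lt_min => /andP[h1 h2].
by rewrite /= distrC; apply: dF => //; exact: d'D.
Qed.

Lemma plane_open D c u v : open D -> open (plane c u v @^-1` D).
Proof.
move=> oD; rewrite openE => z Dz; have [d d0 dD] := (open_enormP D).1 oD _ Dz.
have [r r0 rP] := plane_near c u v z d0.
by apply: filterS (nbhsx_ballx z r r0) => z' /rP/dD.
Qed.

Lemma tame_bm D F c u v : open D -> tame D F -> bdd_mfun (F \o plane c u v).
Proof.
move=> oD tF; have [cF F0 [M FM]] := tF; split; last by exists M => z; exact: FM.
apply: (@continuous_on_open_measurable _ (plane c u v @^-1` D)).
- exact: plane_open.
- by move=> z Dz; have H := tame_plane_continuous oD tF Dz; refine H.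
- by move=> z nDz; exact: F0.
Qed.

Lemma tame_line_measurable D F x v : open D -> tame D F ->
  measurable_fun setT (fun t : R => F (x + t *: v)).
Proof.
move=> oD tF; have [m _] := tame_bm x v 0 oD tF.
have -> : (fun t : R => F (x + t *: v)) = fun t => (F \o plane x v 0) (t, 0).
  by apply/funext => t; rewrite /= /plane/= scaler0 addr0.
by have H := measurable_fun_pair1 (0 : R) m; refine H.
Qed.

End EuclideanTopology.

(** * Chords and line integrals *)

Section Regularity.
Variables (R : realType) (n N : nat).
Local Notation E := 'rV[R]_n.
Local Notation MN := 'M[cplx R]_N.

Lemma lip_norm_bounds (g : E -> MN) (c : R) : (lip_norm g <= c%:E)%E ->
  (forall v, sphere v -> mnorm (g v) <= c) /\
  (forall v w, sphere v -> sphere w -> mnorm (g v - g w) <= c * enorm (v - w)).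
Proof.
rewrite /lip_norm; set S1 := ereal_sup _; set S2 := ereal_sup _ => S12.
have S1g v : sphere v -> ((mnorm (g v))%:E <= S1)%E.
  by move=> sv; apply: ereal_sup_ubound; exists v.
have S2g v w : sphere v -> sphere w -> ((mnorm (g v - g w) / enorm (v - w))%:E <= S2)%E.
  by move=> sv sw; apply: ereal_sup_ubound; exists (v, w).
(* Each supremum is at most the sum because the other is nonnegative. This uses a point of the
   sphere, as the supremum of an empty set is [-oo]. *)
have S1_ge0 (v : E) : sphere v -> (0 <= S1)%E.
  by move=> sv; apply: (le_trans _ (S1g v sv)); rewrite lee_fin mnorm_ge0.
have S2_ge0 (v : E) : sphere v -> (0 <= S2)%E.
  by move=> sv; apply: (le_trans _ (S2g v v sv sv)); rewrite lee_fin divr_ge0 ?mnorm_ge0 ?enorm_ge0.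
split=> [v sv|v w sv sw].
  rewrite -lee_fin; apply: (le_trans (S1g v sv)); apply: (le_trans _ S12).
  by rewrite leeDl// (S2_ge0 v).
have [vw0|vw0] := eqVneq (enorm (v - w)) 0.
  have /eqP := enorm_eq0 vw0; rewrite subr_eq0 => /eqP ->.
  by rewrite !subrr mnorm0 enorm0 mulr0.
rewrite -ler_pdivrMr; last by rewrite lt_neqAle eq_sym vw0 enorm_ge0.
rewrite -lee_fin; apply: (le_trans (S2g v w sv sw)); apply: (le_trans _ S12).
by rewrite leeDr// (S1_ge0 v).
Qed.

Lemma lip_norm_le (g : E -> MN) (a c : R) :
  (forall v, sphere v -> mnorm (g v) <= a) -> 0 <= c ->
  (forall v w, sphere v -> sphere w -> mnorm (g v - g w) <= c * enorm (v - w)) ->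
  (lip_norm g <= (a + c)%:E)%E.
Proof.
move=> ga c0 gc; rewrite EFinD; apply: leeD; apply: ge_ereal_sup => x.
  by move=> [v sv <-]; rewrite lee_fin ga.
move=> [[v w] [/= sv sw] <-]; rewrite lee_fin.
have [vw0|vw0] := eqVneq (enorm (v - w)) 0; first by rewrite vw0 invr0 mulr0.
by rewrite ler_pdivrMr ?gc// lt_neqAle eq_sym vw0 enorm_ge0.
Qed.

Lemma within_continuous_mnorm p q (K : set E) (f : E -> 'M[cplx R]_(p, q)) :
  {within K, continuous f} -> forall x, K x -> forall e : R, 0 < e ->
  exists2 d : R, 0 < d & forall y, K y -> enorm (y - x) < d -> mnorm (f y - f x) < e.
Proof.
move=> /subspace_continuousP cf x Kx e e0.
have e0' : 0 < (e%:C)%C :> cplx R by rewrite ltcR.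
move/cvgrPdist_lt: (cf x Kx) => /(_ _ e0'); rewrite near_withinE.
move=> /nbhs_ballP[d /= d0 hd]; exists d => // y Ky /enorm_ball yx.
by have := hd _ yx Ky; rewrite ltcE => /andP[_]; rewrite /mnorm distrC.
Qed.

Lemma within_continuous_real (K : set E) (g : E -> R) :
  (forall x, K x -> forall e : R, 0 < e ->
  exists2 d : R, 0 < d & forall y, K y -> enorm (y - x) < d -> `|g y - g x| < e) ->
  {within K, continuous g}.
Proof.
move=> cg; apply/subspace_continuousP => x Kx; apply/cvgrPdist_lt => e e0.
have [d d0 hd] := cg x Kx e e0; rewrite near_withinE.
have [r r0 hr] := enorm_lt_ball x d0.
apply/nbhs_ballP; exists r => //= y /hr yx Ky; rewrite distrC; exact: hd.
Qed.

End Regularity.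

Section Xray.
Variables (R : realType) (n N : nat) (D : set 'rV[R]_n).
Local Notation E := 'rV[R]_n.
Local Notation MN := 'M[cplx R]_N.
Local Notation mu := (@lebesgue_measure R).
Hypotheses (oD : open D) (cD : convex_set D) (bD : bounded_set D).
Variable f : E -> 'cV[cplx R]_N.
Hypothesis cf : {within closure D, continuous f}.

Lemma closure_compact (U : set E) : U `<=` D -> compact (closure U).
Proof.
move=> UD; apply: bounded_closed_compact; last exact: closed_closure.
have [B B0 DB] := bounded_enormP bD.
exists B; split; first exact: num_real.
move=> M BM x Ux; apply: (le_trans (norm_le_enorm x)).
apply: (closure_enorm_le _ Ux) => y /UD/DB /le_trans -> //; exact: ltW.
Qed.

Lemma f_bounded : exists2 M : R, 0 < M & forall x, closure D x -> mnorm (f x) <= M.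
Proof.
have [K0|/set0P K0] := eqVneq (closure D) set0.
  by exists 1 => // x; rewrite K0.
have [|c _ hc] := compact_EVT_max (f := fun x => mnorm (f x)) K0 (closure_compact (@subset_refl
  _ D)).
  apply: within_continuous_real => x Kx e e0.
  have [d d0 hd] := within_continuous_mnorm cf Kx e0.
  by exists d => // y Ky yx; apply: le_lt_trans (mnorm_dist_le _ _) _; exact: hd.
exists (mnorm (f c) + 1) => [|x Kx]; first by rewrite ltr_wpDl// mnorm_ge0.
by apply: (le_trans (hc x _)); rewrite ?inE// lerDl.
Qed.

Definition Dcoords (A : E -> MN) i x : R := coords (A x *m f x) i * \1_D x.

Lemma tame_Dcoords (A : E -> MN) i :
  (forall x, D x -> forall e : R, 0 < e -> exists2 d : R, 0 < d &
     forall y, D y -> enorm (y - x) < d -> mnorm (A y - A x) < e) ->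
  (exists M : R, forall x, D x -> mnorm (A x) <= M) ->
  tame D (Dcoords A i).
Proof.
move=> cA [M AM]; have [F F0 fF] := f_bounded.
have DK x : D x -> closure D x by exact: subset_closure.
split=> [x Dx e e0|x nDx|].
- pose a := N%:R * (mnorm (A x) + F) + 1.
  have Ax0 := mnorm_ge0 (A x).
  have a0 : 0 < a by rewrite ltr_wpDl// mulr_ge0// addr_ge0// ltW.
  have ea : 0 < e / a by rewrite divr_gt0.
  have [d d0 hd] := cA x Dx _ ea.
  have [d' d'0 hd'] := within_continuous_mnorm cf (DK _ Dx) ea.
  exists (Num.min d d') => [|y Dy]; first by rewrite lt_min d0.
  rewrite lt_min => /andP[yd yd'].
  rewrite /Dcoords !indicE !mem_set// !mulr1 /coords -partB.
  apply: (le_lt_trans (part_le_cmod _ _)).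
  have -> : (A y *m f y) i.1 0 - (A x *m f x) i.1 0 = (A y *m f y - A x *m f x) i.1 0.
    by rewrite !mxE.
  apply: (le_lt_trans (mnorm_entry _ _ _)).
  have -> : A y *m f y - A x *m f x = (A y - A x) *m f y + A x *m (f y - f x).
    by rewrite mulmxBl mulmxBr addrA subrK.
  apply: (le_lt_trans (mnormD _ _)).
  have h1 := mnormM (A y - A x) (f y); have h2 := mnormM (A x) (f y - f x).
  have h3 : N%:R * mnorm (A y - A x) * mnorm (f y) <= N%:R * (e / a) * F.
    apply: ler_pM; rewrite ?mulr_ge0 ?mnorm_ge0//; first by rewrite ler_wpM2l// ltW// hd.
    exact/fF/DK.
  have h4 : N%:R * mnorm (A x) * mnorm (f y - f x) <= N%:R * mnorm (A x) * (e / a).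
    by rewrite ler_wpM2l ?mulr_ge0 ?mnorm_ge0// ltW// hd'//; exact: DK.
  have -> : e = e / a * a by rewrite mulfVK// gt_eqF.
  rewrite {2}/a; lra.
- by rewrite /Dcoords indicE memNset// mulr0.
- exists (N%:R * `|M| * F) => x; rewrite /Dcoords indicE.
  have [Dx|nDx] := pselect (D x); last first.
    by rewrite memNset// mulr0 normr0 !mulr_ge0// ltW.
  rewrite mem_set// mulr1 (le_trans (part_le_cmod _ _))//.
  apply: (le_trans (mnorm_entry _ _ _)); apply: (le_trans (mnormM _ _)).
  apply: ler_pM; rewrite ?mulr_ge0 ?mnorm_ge0//; last exact/fF/DK.
  by rewrite ler_wpM2l// (le_trans (AM _ Dx))// ler_norm.
Qed.

Lemma tame_line_integrable F y v s c : tame D F -> sphere v -> 0 < s ->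
  mu.-integrable setT (EFin \o (fun t => F (y + (s * t + c) *: v))).
Proof.
move=> tF sv s0; have [_ F0 [M FM]] := tF.
have [B B0 DB] := bounded_enormP bD.
apply: (@box_supp1_integrable _ ((B + enorm y + `|c|) / s)).
- have -> : (fun t : R => F (y + (s * t + c) *: v)) = fun t => F ((y + c *: v) + t *: (s *: v)).
    by apply/funext => t; congr F; apply/rowP => i; rewrite !mxE; ring.
  by have H x := tame_line_measurable x (s *: v) oD tF; refine (H _).
- by exists M => t; exact: FM.
- move=> t ht; apply: F0 => /DB hB; move: ht; rewrite ltNge => /negP; apply.
  have h1 : `|s * t + c| <= B + enorm y.
    have <- : enorm ((s * t + c) *: v) = `|s * t + c| by rewrite enormZ sv mulr1.
    have -> : (s * t + c) *: v = y + (s * t + c) *: v - y by rewrite addrAC subrr add0r.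
    by apply: (le_trans (enormB _ _)); rewrite lerD2r.
  rewrite ler_pdivlMr// mulrC -{1}(gtr0_norm s0) -normrM.
  have := ler_normB (s * t + c) c; rewrite addrK; lra.
Qed.

Variable W : E -> E -> MN.
Hypothesis W_cont : forall v, sphere v -> forall x, closure D x -> forall e : R, 0 < e ->
  exists2 d : R, 0 < d &
     forall y, closure D y -> enorm (y - x) < d -> mnorm (W y v - W x v) < e.
Hypothesis W_bounded : forall v, sphere v -> exists M : R, forall x, closure D x ->
  mnorm (W x v) <= M.
Hypothesis xray0 : forall x v T, maximal_line (closure D) x v T -> xray W f x v T = 0.

Lemma tame_W v i : sphere v -> tame D (Dcoords (W ^~ v) i).
Proof.
move=> sv; have DK x : D x -> closure D x by exact: subset_closure.
apply: tame_Dcoords => [x Dx e e0|].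
  have [d d0 hd] := W_cont sv (DK _ Dx) e0.
  by exists d => // y /DK; exact: hd.
by have [M hM] := W_bounded sv; exists M => x /DK/hM.
Qed.

(** Take for [b] the supremum of the times spent in the closure. Earlier times lie in [D], since a
    half-open segment from a point of [D] to a point of the closure does; an interior point at time
    [b] would allow the ray to continue. *)
Lemma chord_end y v : D y -> sphere v -> exists b : R,
  [/\ 0 < b, boundary (closure D) (y + b *: v),
      forall t, closure D (y + t *: v) -> t <= b &
      forall t, 0 <= t -> D (y + t *: v) <-> t < b].
Proof.
move=> Dy sv; have [B B0 DB] := bounded_enormP bD.
have KB := closure_enorm_le DB.
pose S := [set t : R | closure D (y + t *: v)].
have S0 : S 0 by rewrite /S/= scale0r addr0; exact: subset_closure.
have SB t : S t -> t <= B + enorm y.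
  move=> /KB hB; apply: (le_trans (ler_norm t)).
  have <- : enorm (t *: v) = `|t| by rewrite enormZ sv mulr1.
  have -> : t *: v = y + t *: v - y by rewrite addrAC subrr add0r.
  by apply: (le_trans (enormB _ _)); rewrite lerD2r.
have supS : has_sup S by split; [exists 0|exists (B + enorm y)].
set b := sup S.
have Sb t : S t -> t <= b by move=> St; apply: sup_upper_bound.
have dist s t : enorm (y + s *: v - (y + t *: v)) = `|s - t|.
  rewrite -[RHS]mulr1 -sv -enormZ; congr enorm; apply/rowP => j; rewrite !mxE; ring.
have Kb : closure D (y + b *: v).
  apply/closure_enormP => e e0; have e2 : 0 < e / 2 by rewrite divr_gt0.
  have [t St bt] := sup_adherent e2 supS; have tb := Sb _ St.
  have [z Dz zt] := (closure_enormP _ _).1 St _ e2.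
  exists z => //; have -> : z - (y + b *: v) = (z - (y + t *: v)) + (y + t *: v - (y + b *: v)).
    by rewrite addrA subrK.
  apply: (le_lt_trans (enormD _ _)); rewrite dist ler0_norm ?subr_le0//.
  rewrite -/b in bt; lra.
have [e e0 eD] := (open_enormP D).1 oD y Dy.
have b0 : 0 < b.
  apply: lt_le_trans (Sb (e / 2) _); first by rewrite divr_gt0.
  apply/subset_closure/eD; rewrite addrAC subrr add0r enormZ sv mulr1 gtr0_norm ?divr_gt0//; lra.
have nint : ~ (closure D)^° (y + b *: v).
  move=> /interior_enormP[r r0 rK].
  have : b + r / 2 <= b by apply/Sb/rK; rewrite dist ger0_norm; lra.
  by lra.
have Dlt t : 0 <= t -> t < b -> D (y + t *: v).
  move=> t0 tb; have -> : y + t *: v = y + (t / b) *: (y + b *: v - y).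
    by rewrite addrAC subrr add0r scalerA mulfVK// gt_eqF.
  apply: (segment_open oD cD) => //; first by rewrite divr_ge0// ltW.
  by rewrite ltr_pdivrMr// mul1r.
exists b; split; [exact: b0| |exact: Sb|move=> t t0; split; last exact: Dlt].
  by split; [exact: subset_closure|exact: nint].
move=> Dt; rewrite lt_neqAle Sb ?andbT; last exact: subset_closure.
apply/eqP => tb; apply: nint; rewrite -tb.
have [r r0 rD] := (open_enormP D).1 oD _ Dt.
by apply/interior_enormP; exists r => // z /rD; exact: subset_closure.
Qed.

Lemma chord_through y v : D y -> sphere v -> exists a b : R,
  [/\ a < 0, 0 < b, maximal_line (closure D) (y + a *: v) v (b - a) &
      forall t, D (y + t *: v) <-> a < t < b].
Proof.
move=> Dy sv; have [b [b0 bb bmax bD']] := chord_end Dy sv.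
have sNv : sphere (- v) by rewrite /sphere/= enormN.
have [a' [a'0 ba amax aD']] := chord_end Dy sNv.
exists (- a'), b.
have ND t : y + t *: - v = y + (- t) *: v by rewrite scalerN scaleNr.
have lineE t : line (y + - a' *: v) v t = y + (t - a') *: v.
  by rewrite /line -addrA -scalerDl; congr (_ + _ *: _); ring.
have Dab t : D (y + t *: v) <-> - a' < t < b.
  have [t0|t0] := leP 0 t.
    rewrite bD'//; split=> [->|/andP[]//]; rewrite andbT; lra.
  have nt0 : 0 <= - t by lra.
  have := aD' _ nt0; rewrite ND opprK => ->; split=> [ta|/andP[ta _]]; last lra.
  by apply/andP; split; lra.
have cl (K := closure D) : boundary K `<=` K.
  by move=> x [+ _]; rewrite -(closure_id K).1//; exact: closed_closure.
have [cKb cKa] := (cl _ bb, cl _ ba).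
have Kab t : - a' <= t -> t <= b -> closure D (y + t *: v).
  move=> ta tb; have [->|nb] := eqVneq t b; first exact: cKb.
  have [->|na] := eqVneq t (- a'); first by rewrite -ND.
  apply/subset_closure/Dab; rewrite !lt_neqAle ta tb nb eq_sym na//.
split; [by lra|exact: b0| |exact: Dab].
split; [exact: sv|by lra| | |].
- by move=> t /andP[t0 tT]; rewrite lineE; apply: Kab; lra.
- rewrite !lineE sub0r (_ : b - - a' - a' = b); last by ring.
  by split; [rewrite -ND; exact: ba|exact: bb].
- move=> s T s0 sT hK.
  have hs : closure D (line (y + - a' *: v) v s) by apply: hK; apply/andP; split; lra.
  have hT : closure D (line (y + - a' *: v) v T) by apply: hK; apply/andP; split; lra.
  rewrite !lineE in hs hT; have := bmax _ hT; have := amax (a' - s).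
  by rewrite ND opprB => /(_ hs) h1 h2; split; lra.
Qed.

(** A line that meets [D] meets it in an open chord, whose closure is a maximal line, so the X-ray
    hypothesis applies. On a line that misses [D], even one running along the boundary, the
    integrand is zero. *)
Lemma line_integral_vanish y v i : sphere v ->
  \int[mu]_t Dcoords (W ^~ v) i (y + t *: v) = 0.
Proof.
move=> sv; have tF := tame_W i sv; set F := Dcoords _ i in tF *.
have [_ F0 _] := tF.
have [[t0 Dt0]|nD] := pselect (exists t, D (y + t *: v)); last first.
  rewrite -[RHS](_ : \int[mu]_(t in setT) 0 = 0); last by rewrite /Rintegral integral0.
  by apply: eq_Rintegral => t _; apply: F0 => Dt; apply: nD; exists t.
have [a [b [a0 b0 ml Dab]]] := chord_through Dt0 sv.
have mF : measurable_fun setT (fun t : R => F (y + t *: v)).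
  by have H x := tame_line_measurable x v oD tF; refine (H _).
(* The shift makes the chord start at time 0, as in the definition of [xray]. *)
rewrite (@integral_affine _ 1 (t0 + a))//; last exact: tame_line_integrable.
rewrite mul1r; set T := b - a in ml.
pose h t := coords (W (y + t0 *: v + a *: v + t *: v) v *m f (y + t0 *: v + a *: v + t *: v)) i.
have hx : \int[mu]_(t in `[0, T]) h t = 0.
  have := congr1 (fun c : 'cV[cplx R]_N => part i.2 (c i.1 0)) (xray0 ml).
  by rewrite /= !mxE /Cintegral part0 /h /coords; case: i.2.
have hF t : F (y + (1 * t + (t0 + a)) *: v) = h t * \1_(`]0, T[) t.
  have -> : y + (1 * t + (t0 + a)) *: v = y + t0 *: v + a *: v + t *: v.
    by apply/rowP => j; rewrite !mxE; ring.
  rewrite /F /Dcoords -/(h t) !indicE; congr (_ * _%:R); apply: congr1.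
  have Dt : D (y + t0 *: v + a *: v + t *: v) <-> 0 < t < T.
    have -> : y + t0 *: v + a *: v + t *: v = y + t0 *: v + (a + t) *: v.
      by rewrite scalerDl addrA.
    rewrite Dab /T; split=> /andP[? ?]; apply/andP; split; lra.
  by apply/idP/idP; rewrite !inE/= in_itv/= => /Dt.
have mh : measurable_fun `]0, T[ h.
  have mF' : measurable_fun `]0, T[ (fun t => F (y + (1 * t + (t0 + a)) *: v)).
    apply: measurable_funTS.
    have -> : (fun t : R => F (y + (1 * t + (t0 + a)) *: v)) =
        fun t => F ((y + (t0 + a) *: v) + t *: v).
      by apply/funext => t; congr F; apply/rowP => j; rewrite !mxE; ring.
    have H x := tame_line_measurable x v oD tF; refine (H _).
  apply: eq_measurable_fun mF' => t tT; rewrite hF indicE.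
  by rewrite tT mulr1.
transitivity (\int[mu]_(t in `]0, T[) h t).
  rewrite [RHS]Rintegral_mkcond; apply: eq_Rintegral => t _.
  by rewrite hF /patch indicE; case: ifPn; rewrite ?mulr1 ?mulr0.
(* Measurability of [h] is known on the open interval only; the end points of the closed one form a
   null set. *)
rewrite -[RHS]hx /Rintegral; congr fine; apply/esym.
have mhE : measurable_fun `]0, T[ (EFin \o h) by exact/measurable_EFinP.
have H := @integral_itv_bndoo R 0 T (EFin \o h) true false mhE; refine H.
Qed.

End Xray.

(** * Linear algebra *)

(** The Fejer means of [g] at [x] lie between 0 and a multiple of the integral of [g], so they
    vanish, while they converge to [g x]. *)
Lemma sq_int_eq0_continuous (R : realType) (g : R * R -> R) x : bdd_mfun g ->
  (forall z, 0 <= g z) ->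
  sq_int g <= 0 -> 1 / 4 <= x.1 <= 3 / 4 -> 1 / 4 <= x.2 <= 3 / 4 ->
  {for x, continuous g} -> g x = 0.
Proof.
move=> bg g0 Ig x1 x2 cg.
have cv := fejer_conv_cvg bg x1 x2 cg.
have Ig0 : sq_int g = 0 by apply/eqP; rewrite eq_le Ig sq_int_ge0.
rewrite -(cvg_lim _ cv)//; apply: lim_near_cst => //; apply: nearW => n.
have [bK _] := fejer_mean12 n x; have [_ [M KM]] := bK.
apply/eqP; rewrite eq_le; apply/andP; split; last first.
  by apply: sq_int_ge0 => z; rewrite mulr_ge0// mulr_ge0// fejer_ge0.
have -> : 0 = sq_int (fun z => M * g z) by rewrite sq_intZ// Ig0 mulr0.
apply: sq_int_le; [exact: bdd_mfunM|exact: bdd_mfunZ|move=> z _].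
by rewrite mulrC ler_wpM2r// (le_trans (ler_norm _)).
Qed.

Section LinearAlgebra.
Variable R : realType.

Lemma left_kernel_nonzero n k (A : 'M[R]_(n, k)) : (k < n)%N ->
  exists2 u : 'rV_n, u != 0 & u *m A = 0.
Proof.
move=> kn; exists (nz_row (kermx A)).
  rewrite nz_row_eq0 kermx_eq0 /row_free neq_ltn.
  by rewrite (leq_ltn_trans (rank_leq_col A)).
by apply/sub_kermxP; exact: nz_row_sub.
Qed.

Lemma dotE n (x y : 'rV[R]_n) : x *m y^T = (dot x y)%:M.
Proof.
apply/matrixP => i j; rewrite !ord1 !mxE eqxx mulr1n; apply: eq_bigr => k _.
by rewrite mxE.
Qed.

Lemma dot_mx0 n (x y : 'rV[R]_n) : x *m y^T = 0 -> dot x y = 0.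
Proof. by rewrite dotE => /matrixP/(_ 0 0); rewrite !mxE eqxx mulr1n. Qed.

Lemma unit_multiple n (x : 'rV[R]_n) : x != 0 -> enorm ((enorm x)^-1 *: x) = 1.
Proof.
move=> x0; rewrite enormZ ger0_norm ?invr_ge0 ?enorm_ge0// mulVf//.
by apply: contra_neq x0; exact: enorm_eq0.
Qed.

(** The second vector solves two linear equations, orthogonality to [e] and to the first vector; a
    nonzero solution exists since n > 2. The vector [e] may be zero. *)
Lemma orthonormal_pair n (e : 'rV[R]_n) : (3 <= n)%N -> exists u1 u2 : 'rV[R]_n,
  [/\ enorm u1 = 1, enorm u2 = 1, dot u1 u2 = 0, dot u1 e = 0 & dot u2 e = 0].
Proof.
move=> n3; have [u u0 ue] := @left_kernel_nonzero n 1 e^T (leq_trans (isT : (1 < 3)%N) n3).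
have [v v0 vv] := @left_kernel_nonzero n (1 + 1) (row_mx e^T u^T) n3.
have {vv} [ve vu] : v *m e^T = 0 /\ v *m u^T = 0.
  by move: vv; rewrite mul_mx_row -[0]row_mx0 => /eq_row_mx[].
exists ((enorm u)^-1 *: u), ((enorm v)^-1 *: v); split.
- exact: unit_multiple.
- exact: unit_multiple.
- by rewrite dotZl dotZr dotC (dot_mx0 vu) !mulr0.
- by rewrite dotZl (dot_mx0 ue) mulr0.
- by rewrite dotZl (dot_mx0 ve) mulr0.
Qed.

(** Compactness of [-1, 1], once the norm of the inverse is known to be continuous. This follows
    from the identity B^-1 - A^-1 = B^-1 (A - B) A^-1. *)
Lemma invmx_bounded N (M : R -> 'M[cplx R]_N) (L : R) : 0 <= L ->
  (forall k k', `|k| <= 1 -> `|k'| <= 1 -> mnorm (M k - M k') <= L * `|k - k'|) ->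
  (forall k, `|k| <= 1 -> M k \in unitmx) ->
  exists2 C : R, 0 <= C & forall k, `|k| <= 1 -> mnorm (invmx (M k)) <= C.
Proof.
move=> L0 ML Mu; pose h k := mnorm (invmx (M k)).
have h0 k : 0 <= h k by exact: mnorm_ge0.
have itv1 k : k \in `[(-1 : R), 1] = (`|k| <= 1) by rewrite in_itv/= ler_norml.
have diff k k' : `|k| <= 1 -> `|k'| <= 1 ->
    `|h k' - h k| <= N%:R ^+ 2 * L * h k * h k' * `|k' - k|.
  move=> k1 k'1; apply: (le_trans (mnorm_dist_le _ _)).
  have -> : invmx (M k') - invmx (M k) = invmx (M k') *m (M k - M k') *m invmx (M k).
    by rewrite mulmxBr mulmxBl mulVmx ?Mu// mul1mx -mulmxA mulmxV ?Mu// mulmx1.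
  apply: (le_trans (mnormM _ _)).
  have := mnormM (invmx (M k')) (M k - M k'); rewrite -/(h k') => h1.
  apply: (@le_trans _ _ (N%:R * (N%:R * h k' * (L * `|k - k'|)) * h k)).
    apply: ler_wpM2r; first exact: h0.
    apply: ler_wpM2l => //; apply: (le_trans h1).
    by rewrite ler_wpM2l ?mulr_ge0// ML.
  by rewrite distrC le_eqVlt; apply/orP; left; apply/eqP; ring.
have [||c _ hc] := @EVT_max R h (-1) 1; first by lra.
  apply/subspace_continuousP => k /=; rewrite itv1 => k1.
  apply/cvgrPdist_lt => e e0; rewrite near_withinE.
  pose a := N%:R ^+ 2 * L * h k.
  have a0 : 0 <= a by rewrite !mulr_ge0// sqr_ge0.
  (* The estimate [diff] still contains the unknown [h k']. The first term of the minimum forces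
     [h k' <= 2 * h k]; the second then makes the increment less than [e]. *)
  pose d := Num.min (1 / (2 * (a + 1))) (e / (2 * h k * a + 1)).
  have b0 : 0 < 2 * h k * a + 1 by rewrite ltr_wpDl// !mulr_ge0.
  have d0 : 0 < d.
    by rewrite lt_min; apply/andP; split; rewrite divr_gt0// mulr_gt0// ltr_wpDl.
  apply/nbhs_ballP; exists d => //= k' + /=; rewrite /ball/= itv1 distrC => kk' k'1.
  move: kk'; rewrite lt_min => /andP[].
  rewrite ltr_pdivlMr ?mulr_gt0 ?ltr_wpDl// ltr_pdivlMr// => d1 d2.
  have := diff k k' k1 k'1; rewrite -/a => hd.
  have kk0 := normr_ge0 (k' - k).
  have ak : a * `|k' - k| <= 1 / 2 by nra.
  have h2 : h k' <= 2 * h k.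
    have : h k' - h k <= a * h k' * `|k' - k| by rewrite (le_trans (ler_norm _)).
    have := h0 k'; have := h0 k; nra.
  rewrite distrC; apply: (le_lt_trans hd).
  apply: (@le_lt_trans _ _ (`|k' - k| * (2 * h k * a))).
    rewrite mulrC ler_wpM2l// mulrC ler_wpM2r//.
  apply: le_lt_trans d2; rewrite mulrDr mulr1 lerDl//.
exists (h c) => // k k1; by apply: hc; rewrite itv1.
Qed.

Lemma coords_mulmx_bound N (A : 'M[cplx R]_N) (v : 'cV[cplx R]_N) i (a : R) : mnorm A <= a ->
  coords (A *m v) i ^+ 2 <= N%:R * a ^+ 2 * \sum_j coords v j ^+ 2.
Proof.
move=> Aa; have a0 : 0 <= a by rewrite (le_trans _ Aa)// mnorm_ge0.
rewrite sum_coords_sqr /coords -real_normK ?num_real//.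
have : `|part i.2 ((A *m v) i.1 0)| <= \sum_j a * cmod (v j 0).
  apply: (le_trans (part_le_cmod _ _)); rewrite mxE; apply: (le_trans (cmod_sum _ _ _)).
  apply: ler_sum => j _; rewrite [cmod _]cmodM ler_wpM2r ?cmod_ge0//.
  by rewrite (le_trans _ Aa)// mnorm_entry.
rewrite -ler_sqr ?nnegrE ?sumr_ge0// => [h|j _]; last by rewrite mulr_ge0// cmod_ge0.
apply: (le_trans h); rewrite -mulr_sumr exprMn.
rewrite (_ : N%:R * a ^+ 2 * _ = a ^+ 2 * (N%:R * \sum_(j < N) cmod (v j 0) ^+ 2)); last by ring.
by apply: ler_wpM2l; [exact: sqr_ge0|exact: sqr_sum_le].
Qed.

Lemma coordsD N (v w : 'cV[cplx R]_N) i : coords (v + w) i = coords v i + coords w i.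
Proof. by rewrite /coords mxE partD. Qed.

Lemma coordsN N (v : 'cV[cplx R]_N) i : coords (- v) i = - coords v i.
Proof. by rewrite /coords mxE partN. Qed.

Lemma coords0 N i : coords (0 : 'cV[cplx R]_N) i = 0.
Proof. by rewrite /coords mxE part0. Qed.

Lemma mnorm_eq0 p q (A : 'M[cplx R]_(p, q)) : mnorm A = 0 -> A = 0.
Proof.
move=> A0; apply/matrixP => i j; rewrite mxE; apply/eqP.
have := mnorm_entry A i j; rewrite A0 => Aij.
have : cmod (A i j) ^+ 2 = 0 by apply/eqP; rewrite sqrf_eq0 eq_le Aij cmod_ge0.
rewrite cmod_sqr => /eqP; rewrite paddr_eq0 ?sqr_ge0// !sqrf_eq0.
by case: (A i j) => a b /= /andP[/eqP -> /eqP ->].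
Qed.

Lemma coords_neq0 N (v : 'cV[cplx R]_N) : v != 0 -> exists i, coords v i != 0.
Proof.
move=> v0; have [//|/forallNP nv] := pselect (exists i, coords v i != 0).
exfalso; move/eqP: v0; apply; apply/colP => j; rewrite mxE.
have c0 b : part b (v j 0) = 0.
  by apply/eqP; have := nv (j, b) => /negP; rewrite negbK.
by have := c0 true; have := c0 false; rewrite /=; case: (v j 0) => a b /= -> ->.
Qed.

End LinearAlgebra.

(** * Vanishing near an extreme point of the support *)

Section Directions.
Variables (R : realType) (n : nat) (u1 u2 : 'rV[R]_n).
Hypotheses (e1 : enorm u1 = 1) (e2 : enorm u2 = 1) (e12 : dot u1 u2 = 0).

(** The velocity of the lines parametrized by [chart c k]. Its norm is at least 1, which makes the
    normalization Lipschitz in [k]. *)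
Definition raw_dir (c : bool) (k : R) : 'rV[R]_n :=
  if c then u1 + k *: u2 else k *: u1 + u2.

Definition dir c k : 'rV[R]_n := (enorm (raw_dir c k))^-1 *: raw_dir c k.

Lemma raw_dir_ge1 c k : 1 <= enorm (raw_dir c k).
Proof.
rewrite -ler_sqr ?nnegrE ?enorm_ge0// expr1n enorm_sqr.
have d1 : dot u1 u1 = 1 by rewrite -enorm_sqr e1 expr1n.
have d2 : dot u2 u2 = 1 by rewrite -enorm_sqr e2 expr1n.
by case: c; rewrite /raw_dir !dotDl !dotDr !dotZl !dotZr (dotC u2 u1) e12 d1 d2;
  have := sqr_ge0 k; rewrite expr2; lra.
Qed.

Lemma raw_dir_gt0 c k : 0 < enorm (raw_dir c k).
Proof. exact: lt_le_trans (raw_dir_ge1 c k). Qed.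

Lemma dir_sphere c k : sphere (dir c k).
Proof.
apply: unit_multiple; apply/eqP => r0.
by have := raw_dir_gt0 c k; rewrite r0 enorm0 ltxx.
Qed.

Lemma dir_lip c k k' : enorm (dir c k - dir c k') <= 2 * `|k - k'|.
Proof.
apply: (le_trans (normalize_lip (raw_dir_ge1 c k) (raw_dir_ge1 c k'))).
rewrite ler_wpM2l//; case: c; rewrite /raw_dir.
  have -> : u1 + k *: u2 - (u1 + k' *: u2) = (k - k') *: u2.
    by apply/rowP => i; rewrite !mxE; ring.
  by rewrite enormZ e2 mulr1.
have -> : k *: u1 + u2 - (k' *: u1 + u2) = (k - k') *: u1.
  by apply/rowP => i; rewrite !mxE; ring.
by rewrite enormZ e1 mulr1.
Qed.

Lemma plane_chart c0 (c : bool) (k b t : R) :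
  plane c0 u1 u2 (chart c k b t) = plane c0 u1 u2 (chart c k b 0) + (enorm (raw_dir c k) * t)
    *: dir c k.
Proof.
rewrite /dir scalerA mulrAC mulfV ?mul1r; last by rewrite gt_eqF// raw_dir_gt0.
by rewrite /plane /chart /raw_dir; case: c; apply/rowP => i; rewrite !mxE /=; ring.
Qed.

End Directions.

Section Local.
Variables (R : realType) (n N : nat) (D : set 'rV[R]_n).
Local Notation E := 'rV[R]_n.
Local Notation MN := 'M[cplx R]_N.
Local Notation mu := (@lebesgue_measure R).
Hypotheses (oD : open D) (cD : convex_set D) (bD : bounded_set D).
Variables (f : E -> 'cV[cplx R]_N) (W : E -> E -> MN).
Hypothesis cf : {within closure D, continuous f}.
Hypothesis W_cont : forall v, sphere v -> forall x, closure D x -> forall e : R, 0 < e ->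
  exists2 d : R, 0 < d &
     forall y, closure D y -> enorm (y - x) < d -> mnorm (W y v - W x v) < e.
Hypothesis W_bounded : forall v, sphere v -> exists M : R, forall x, closure D x ->
  mnorm (W x v) <= M.
Hypothesis xray0 : forall x v T, maximal_line (closure D) x v T -> xray W f x v T = 0.

Variables (x0 u1 u2 : E) (C1 kappa : R).
Hypotheses (e1 : enorm u1 = 1) (e2 : enorm u2 = 1) (e12 : dot u1 u2 = 0).
Hypothesis W0_unit : forall c k, W x0 (dir u1 u2 c k) \in unitmx.
Hypothesis W0_inv : forall c k, `|k| <= 1 -> mnorm (invmx (W x0 (dir u1 u2 c k))) <= C1.
Hypothesis kappa0 : 0 <= kappa.
Let C0 := N%:R * (N%:R * C1) ^+ 2.
Hypothesis kappa_small :
  4 * chain_cst * C0 * #|{: 'I_N * bool}|%:R * (4 * N%:R * kappa ^+ 2) < 1.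

Variable x1 : E.
Hypothesis Dx1 : D x1.

(** Centred so that [x1] is the image of (1/2, 1/2); points within 1/4 of [x1] then have both
    coordinates in [1/4, 3/4]. *)
Let P := plane (x1 - (1 / 2) *: u1 - (1 / 2) *: u2) u1 u2.

Hypothesis P_small : forall z, D (P z) -> f (P z) != 0 ->
  [/\ enorm (P z - x1) <= 1 / 4,
      forall v, sphere v -> mnorm (W (P z) v - W x0 v) <= kappa &
      forall v w, sphere v -> sphere w ->
        mnorm ((W (P z) v - W x0 v) - (W (P z) w - W x0 w)) <= kappa * enorm (v - w)].

Let PE z : P z - x1 = (z.1 - 1 / 2) *: u1 + (z.2 - 1 / 2) *: u2.
Proof. by rewrite /P /plane; apply/rowP => i; rewrite !mxE; ring. Qed.

Let P_coord z : enorm (P z - x1) <= 1 / 4 -> 1 / 4 <= z.1 <= 3 / 4 /\ 1 / 4 <= z.2 <= 3 / 4.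
Proof.
move=> h.
have d1 : dot u1 u1 = 1 by rewrite -enorm_sqr e1 expr1n.
have d2 : dot u2 u2 = 1 by rewrite -enorm_sqr e2 expr1n.
have a1 := cauchy_schwarz (P z - x1) u1; have a2 := cauchy_schwarz (P z - x1) u2.
have a3 := cauchy_schwarz (- (P z - x1)) u1; have a4 := cauchy_schwarz (- (P z - x1)) u2.
move: a1 a2 a3 a4; rewrite enormN !dotNl e1 e2 !mulr1.
have -> : dot (P z - x1) u1 = z.1 - 1 / 2.
  by rewrite PE dotDl !dotZl (dotC u2) e12 d1 mulr0 addr0 mulr1.
have -> : dot (P z - x1) u2 = z.2 - 1 / 2.
  by rewrite PE dotDl !dotZl e12 d2 mulr0 add0r mulr1.
by move=> *; split; apply/andP; split; lra.
Qed.

Let fj j : R * R -> R := Dcoords D f (fun _ => 1%:M) j \o P.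
Let w c k i j : R := realify (W x0 (dir u1 u2 c k)) i j.
Let G c k i : R * R -> R :=
  Dcoords D f (fun x => W x (dir u1 u2 c k) - W x0 (dir u1 u2 c k)) i \o P.

Let fjE j z : D (P z) -> fj j z = coords (f (P z)) j.
Proof. by move=> Dz; rewrite /fj /Dcoords /= indicE mem_set// mulr1 mul1mx. Qed.

Let GE c k i z : D (P z) ->
  G c k i z = coords ((W (P z) (dir u1 u2 c k) - W x0 (dir u1 u2 c k)) *m f (P z)) i.
Proof. by move=> Dz; rewrite /G /Dcoords /= indicE mem_set// mulr1. Qed.

Let out (A : E -> MN) i z : ~ D (P z) -> (Dcoords D f A i \o P) z = 0.
Proof. by move=> Dz; rewrite /Dcoords /= indicE memNset// mulr0. Qed.

Let tame_f j : tame D (Dcoords D f (fun _ => 1%:M) j).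
Proof.
apply: tame_Dcoords => // [x Dx e e0|].
  by exists 1 => // y _ _; rewrite subrr mnorm0.
by exists (mnorm (1%:M : MN)).
Qed.

Let tame_G c k i : tame D (Dcoords D f (fun x => W x (dir u1 u2 c k) - W x0 (dir u1 u2 c k)) i).
Proof.
have sv := dir_sphere e1 e2 e12 c k.
have DK x : D x -> closure D x by exact: subset_closure.
apply: tame_Dcoords => // [x Dx e e0|].
  have [d d0 hd] := W_cont sv (DK _ Dx) e0.
  exists d => // y Dy yx; have := hd _ (DK _ Dy) yx.
  by rewrite opprB addrA subrK.
have [M hM] := W_bounded sv; exists (M + mnorm (W x0 (dir u1 u2 c k))) => x /DK/hM h.
by apply: (le_trans (mnormB _ _)); rewrite lerD2r.
Qed.

Let sqn_ge0 z : 0 <= sum_sqr fj z.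
Proof. by apply: sumr_ge0 => j _; exact: sqr_ge0. Qed.

(** [N%:R] comes from the matrix-vector estimate, and 4 is the square of the Lipschitz constant 2 of
    the directions in the slope. *)
Let delta := 4 * N%:R * kappa ^+ 2.

Let delta_ge0 : 0 <= delta.
Proof. by rewrite !mulr_ge0// sqr_ge0. Qed.

Let sqnE z : D (P z) -> sum_sqr fj z = \sum_j coords (f (P z)) j ^+ 2.
Proof. by move=> Dz; apply: eq_bigr => j _; rewrite fjE. Qed.

Let G_bound c k i z : G c k i z ^+ 2 <= delta * sum_sqr fj z.
Proof.
have [Dz|nDz] := pselect (D (P z)); last by rewrite /G out// expr0n mulr_ge0.
have [fz|fz] := eqVneq (f (P z)) 0.
  by rewrite GE// fz mulmx0 coords0 expr0n mulr_ge0.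
have [_ hA _] := P_small Dz fz.
rewrite GE// sqnE//; apply: (le_trans (coords_mulmx_bound _ _ (hA _ (dir_sphere e1 e2 e12 c k)))).
apply: ler_wpM2r; first by apply: sumr_ge0 => j _; exact: sqr_ge0.
by rewrite /delta; have : 0 <= N%:R * kappa ^+ 2 by [rewrite mulr_ge0// sqr_ge0]; lra.
Qed.

Let G_lip c k k' i z : (G c k i z - G c k' i z) ^+ 2 <= delta * sum_sqr fj z * (k - k') ^+ 2.
Proof.
have rhs : 0 <= delta * sum_sqr fj z * (k - k') ^+ 2.
  by apply: mulr_ge0; [exact: mulr_ge0|exact: sqr_ge0].
have [Dz|nDz] := pselect (D (P z)); last by rewrite /G !out// subr0 expr0n.
have [fz|fz] := eqVneq (f (P z)) 0.
  by rewrite !GE// fz !mulmx0 coords0 subr0 expr0n.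
have [_ _ hA] := P_small Dz fz.
rewrite !GE// sqnE// -coordsN -coordsD -mulNmx -mulmxDl.
have hB : mnorm (W (P z) (dir u1 u2 c k) - W x0 (dir u1 u2 c k) -
   (W (P z) (dir u1 u2 c k') - W x0 (dir u1 u2 c k'))) <= kappa * (2 * `|k - k'|).
  apply: (le_trans (hA _ _ (dir_sphere e1 e2 e12 c k) (dir_sphere e1 e2 e12 c k'))).
  by rewrite ler_wpM2l// dir_lip.
apply: (le_trans (coords_mulmx_bound _ _ hB)).
rewrite !exprMn real_normK ?num_real// /delta le_eqVlt; apply/orP; left; apply/eqP; ring.
Qed.

Let lines_vanish c k b i :
  \int[mu]_t (\sum_j w c k i j * fj j (chart c k b t) + G c k i (chart c k b t)) = 0.
Proof.
set v := dir u1 u2 c k; have sv : sphere v by exact: dir_sphere.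
set s := enorm (raw_dir u1 u2 c k); have s0 : 0 < s by exact: raw_dir_gt0.
set y := P (chart c k b 0).
have E z : \sum_j w c k i j * fj j z + G c k i z = Dcoords D f (W ^~ v) i (P z).
  have [Dz|nDz] := pselect (D (P z)); last first.
    rewrite /G out// addr0 big1 => [|j _]; last by rewrite /fj out// mulr0.
    by rewrite -[RHS]/((Dcoords D f (W ^~ v) i \o P) z) out.
  rewrite GE// (eq_bigr (fun j => w c k i j * coords (f (P z)) j)) => [|j _]; last by rewrite fjE.
  rewrite sum_realify -coordsD -mulmxDl addrC subrK.
  by rewrite /Dcoords indicE mem_set// mulr1.
have tF : tame D (Dcoords D f (W ^~ v) i) by exact: tame_W.
have := line_integral_vanish oD cD bD cf W_cont W_bounded xray0 y i sv.
have mF : measurable_fun setT (fun t : R => Dcoords D f (W ^~ v) i (y + t *: v)).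
  by have H := tame_line_measurable y v oD tF; refine H.
have iF := tame_line_integrable oD bD y 0 tF sv s0.
rewrite (integral_affine s0 mF iF) => /eqP; rewrite mulf_eq0 gt_eqF//= => /eqP h.
rewrite -[RHS]h; apply: eq_Rintegral => t _; rewrite E addr0; congr (Dcoords _ _ _ _ _).
exact: plane_chart.
Qed.

Lemma local_vanishing : f x1 = 0.
Proof.
apply/eqP/negP => /negP f1.
pose z1 : R * R := (1 / 2, 1 / 2).
have Pz1 : P z1 = x1.
  by apply/eqP; rewrite -subr_eq0 PE /z1/= !subrr !scale0r addr0.
have z1_in : 1 / 4 <= z1.1 <= 3 / 4 /\ 1 / 4 <= z1.2 <= 3 / 4.
  by apply: P_coord; rewrite Pz1 subrr enorm0 divr_ge0.
have [j fj1] := coords_neq0 f1.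
have Dz1 : D (P z1) by rewrite Pz1.
have nz_D i z : fj i z != 0 -> D (P z) /\ f (P z) != 0.
  move=> h; have [Dz|nDz] := pselect (D (P z)); last by move: h; rewrite /fj out ?eqxx.
  split=> //; apply: contra_neq h => fz; by rewrite fjE// fz coords0.
have bf i : bdd_mfun (fj i) by have H := tame_bm _ u1 u2 oD (tame_f i); refine (H _).
have cfj i z : D (P z) -> {for z, continuous (fj i)}.
  by move=> Dz; have H := tame_plane_continuous oD (tame_f i) Dz; refine H.
have bG c k i : bdd_mfun (G c k i).
  by have H := tame_bm _ u1 u2 oD (tame_G c k i); refine (H _).
have C00 : 0 <= C0 by rewrite mulr_ge0// sqr_ge0.
have est := @plane_estimate R _ fj w G C0 delta bf
  (fun i z h => P_coord (let: And3 a _ _ := P_small (nz_D i z h).1 (nz_D i z h).2 in a))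
  (fun i z h => cfj i z (nz_D i z h).1) (fun c k i _ => bG c k i)
  (fun c k i z _ => G_bound c k i z) (fun c k k' i z _ _ => G_lip c k k' i z)
  C00 delta_ge0
  (fun c k x k1 => realify_inv x (W0_unit c k) (W0_inv c k1))
  (fun c k b i _ => lines_vanish c k b i).
(* The plane estimate reads E <= K * E with K < 1 and E >= 0. *)
have I0 : sq_int (sum_sqr fj) <= 0.
  have : 0 <= sq_int (sum_sqr fj) by apply: sq_int_ge0.
  move: kappa_small est; rewrite -/delta; set K := _ * delta => K1 est I0.
  nra.
have bs : bdd_mfun (sum_sqr fj) by apply: bdd_mfun_sum => i; exact: bdd_mfunM.
have bj2 : bdd_mfun (fj j \* fj j) by exact: bdd_mfunM.
have c2 : {for z1, continuous (fj j \* fj j)} by apply: continuousM; exact: cfj.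
have : (fj j \* fj j) z1 = 0.
  apply: (sq_int_eq0_continuous bj2 _ _ z1_in.1 z1_in.2 c2) => [z|].
    by rewrite /= -expr2 sqr_ge0.
  apply: le_trans I0; apply: sq_int_le => // z _; rewrite /sum_sqr (bigD1 j)//= -expr2 lerDl.
  by apply: sumr_ge0 => i _; exact: sqr_ge0.
by rewrite /= -expr2 fjE// Pz1 => /eqP; rewrite sqrf_eq0 (negPf fj1).
Qed.

End Local.

(** * Uniqueness *)

Section Uniqueness.
Variables (R : realType) (n N : nat) (beta : R) (D : set 'rV[R]_n).
Local Notation E := 'rV[R]_n.
Local Notation MN := 'M[cplx R]_N.
Hypotheses (n3 : (3 <= n)%N) (beta0 : 0 < beta).
Hypotheses (oD : open D) (cD : convex_set D) (bD : bounded_set D).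
Variable W : E -> E -> MN.
Hypothesis hW : hoelder_Lip (closure D) beta W.
Hypothesis W_unit : forall x v, closure D x -> sphere v -> W x v \in unitmx.

Lemma powR_small (c e : R) : 0 <= c -> 0 < e -> exists2 r : R, 0 < r &
  forall t : R, 0 <= t -> t <= r -> c * t `^ beta <= e.
Proof.
move=> c0 e0; have c1 : 0 < c + 1 by rewrite ltr_wpDl.
have ec : 0 < e / (c + 1) by rewrite divr_gt0.
exists ((e / (c + 1)) `^ beta^-1) => [|t t0 tr]; first exact: powR_gt0.
have h : t `^ beta <= e / (c + 1).
  apply: (@le_trans _ _ (((e / (c + 1)) `^ beta^-1) `^ beta)).
    by apply: ge0_ler_powR => //; rewrite ?nnegrE ?powR_ge0// ltW.
  by rewrite -powRrM mulVf ?gt_eqF// powRr1// ltW.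
apply: (@le_trans _ _ (c * (e / (c + 1)))); first by rewrite ler_wpM2l.
by rewrite mulrA ler_pdivrMr//; nra.
Qed.

Lemma hoelder_constant : exists2 C : R, 0 <= C & forall x y, closure D x -> closure D y ->
  (forall v, sphere v -> mnorm (W x v - W y v) <= C * enorm (x - y) `^ beta) /\
  (forall v w, sphere v -> sphere w ->
     mnorm ((W x v - W y v) - (W x w - W y w)) <= C * enorm (x - y) `^ beta * enorm (v - w)).
Proof.
have [_ [C hC]] := hW; exists `|C| => // x y Kx Ky.
have : (lip_norm (W x \- W y)%R <= (`|C| * enorm (x - y) `^ beta)%:E)%E.
  apply: (le_trans (hC x y Kx Ky)); rewrite lee_fin ler_wpM2r ?powR_ge0//.
  exact: ler_norm.
by move=> /lip_norm_bounds.
Qed.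

Lemma hoelder_W_cont v : sphere v -> forall x, closure D x -> forall e : R, 0 < e ->
  exists2 d : R, 0 < d &
     forall y, closure D y -> enorm (y - x) < d -> mnorm (W y v - W x v) < e.
Proof.
move=> sv x Kx e e0; have [C C0 hC] := hoelder_constant.
have e2 : 0 < e / 2 by rewrite divr_gt0.
have [r r0 hr] := powR_small C0 e2.
exists r => // y Ky /ltW yx; have [h _] := hC y x Ky Kx.
apply: (le_lt_trans (h v sv)); apply: (le_lt_trans (hr _ (enorm_ge0 _) yx)).
by rewrite ltr_pdivrMr// ltr_pMr// ltr1n.
Qed.

Lemma hoelder_W_bounded v : sphere v ->
  exists M : R, forall x, closure D x -> mnorm (W x v) <= M.
Proof.
move=> sv; have [C C0 hC] := hoelder_constant; have [B B0 DB] := bounded_enormP bD.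
have [[y Ky]|nK] := pselect (exists y, closure D y); last first.
  by exists 0 => x Kx; case: nK; exists x.
exists (C * (2 * B) `^ beta + mnorm (W y v)) => x Kx.
have := mnormD (W x v - W y v) (W y v); rewrite subrK => /le_trans -> //.
rewrite lerD2r; have [h _] := hC x y Kx Ky; apply: (le_trans (h v sv)).
apply: ler_wpM2l => //; apply: ge0_ler_powR; rewrite ?nnegrE ?enorm_ge0//.
- exact: ltW.
- by rewrite mulr_ge0// ltW.
- have := closure_enorm_le DB Kx; have := closure_enorm_le DB Ky.
  by have := enormB x y; lra.
Qed.

Lemma inverse_bound x0 (u1 u2 : E) : closure D x0 ->
  enorm u1 = 1 -> enorm u2 = 1 -> dot u1 u2 = 0 -> exists2 C1 : R, 0 <= C1 &
  forall c k, `|k| <= 1 -> mnorm (invmx (W x0 (dir u1 u2 c k))) <= C1.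
Proof.
move=> Kx0 e1 e2 e12.
have [L L0 hL] : exists2 L : R, 0 <= L & forall v w, sphere v -> sphere w ->
    mnorm (W x0 v - W x0 w) <= L * enorm (v - w).
  have := hW.1 _ Kx0; rewrite /Lip; case E : (lip_norm (W x0)) => [L||] // _.
    exists `|L| => // v w sv sw.
    have [_ h] := @lip_norm_bounds _ _ _ (W x0) L (eq_ind _ (fun a => (a <= L%:E)%E) (lexx _) _
      (esym E)).
    by apply: (le_trans (h v w sv sw)); rewrite ler_wpM2r ?enorm_ge0// ler_norm.
  have [_ h] := @lip_norm_bounds _ _ _ (W x0) 0 (eq_ind _ (fun a => (a <= 0%:E)%E) (leNye _) _
    (esym E)).
  by exists 0.
have bnd c : exists2 C1 : R, 0 <= C1 & forall k, `|k| <= 1 ->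
    mnorm (invmx (W x0 (dir u1 u2 c k))) <= C1.
  apply: (@invmx_bounded _ _ (fun k => W x0 (dir u1 u2 c k)) (L * 2)) => [|k k' _ _|k _].
  - by rewrite mulr_ge0.
  - apply: (le_trans (hL _ _ (dir_sphere e1 e2 e12 c k) (dir_sphere e1 e2 e12 c k'))).
    by rewrite -mulrA ler_wpM2l// dir_lip.
  - by apply: W_unit => //; exact: dir_sphere.
have [a a0 ha] := bnd true; have [b b0 hb] := bnd false.
exists (a + b) => [|c k k1]; first exact: addr_ge0.
by case: c; [apply: (le_trans (ha k k1)); rewrite lerDl|apply: (le_trans (hb k k1)); rewrite lerDr].
Qed.

Variable f : E -> 'cV[cplx R]_N.
Hypothesis cf : {within closure D, continuous f}.
Hypothesis xray0 : forall x v T, maximal_line (closure D) x v T -> xray W f x v T = 0.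

Let f_cont x (e : R) : D x -> 0 < e -> exists2 d : R, 0 < d &
  forall y, D y -> enorm (y - x) < d -> mnorm (f y - f x) < e.
Proof.
move=> Dx e0; have DK y : D y -> closure D y by exact: subset_closure.
have [d d0 hd] := within_continuous_mnorm cf (DK _ Dx) e0.
by exists d => // y /DK; exact: hd.
Qed.

(** Since [U] is open, the farthest point [x0] is found only in its closure and may lie on the
    boundary of [D]. The plane is therefore drawn through a nearby point [x1] of [U], where the
    local estimate contradicts [f x1 != 0]. *)
Lemma vanishing_interior x : D x -> f x = 0.
Proof.
move=> Dx; apply/eqP/negP => /negP fx.
pose U : set E := [set y | D y /\ f y != 0].
have oU : open U.
  apply/open_enormP => y [Dy fy].
  have m0 : 0 < mnorm (f y).
    by rewrite lt_neqAle mnorm_ge0 andbT eq_sym; apply: contra_neq fy; exact: mnorm_eq0.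
  have [d d0 hd] := f_cont Dy m0; have [e e0 eD] := (open_enormP D).1 oD y Dy.
  exists (Num.min d e) => [|z]; first by rewrite lt_min d0.
  rewrite lt_min => /andP[zd ze]; split; first exact: eD.
  apply: contraTneq (hd z (eD _ ze) zd) => ->.
  by rewrite sub0r mnormN ltxx.
have UD : U `<=` D by move=> y [].
have cU := closure_compact bD UD.
have U0 : closure U !=set0 by exists x; exact: subset_closure.
have [|x0] := compact_EVT_max (f := fun y : E => enorm y) U0 cU.
  apply: within_continuous_real => y _ e e0; exists e => // z _ zy.
  by apply: le_lt_trans zy; exact: enorm_dist_le.
rewrite inE => Ux0 hx0; set r := enorm x0 in hx0.
have Ur y : U y -> enorm y <= r by move=> Uy; apply: hx0; rewrite inE; exact: subset_closure.
have [u1 [u2 [e1 e2 e12 u1x u2x]]] := orthonormal_pair x0 n3.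
have Kx0 : closure D x0 by apply: closure_subset Ux0.
have [C1 C10 hC1] := inverse_bound Kx0 e1 e2 e12.
have [C C0 hC] := hoelder_constant.
(* [Q * kappa ^+ 2] is the contraction factor of the plane estimate; kappa = 1 / (1 + Q) is at most
   1 and makes already [Q * kappa] less than 1. *)
pose Q : R := 4 * chain_cst * (N%:R * (N%:R * C1) ^+ 2) * #|{: 'I_N * bool}|%:R * (4 * N%:R).
have Q0 : 0 <= Q.
  by rewrite /Q !mulr_ge0// ?sqr_ge0// /chain_cst exprn_ge0.
pose kappa : R := 1 / (1 + Q).
have Q1 : 0 < 1 + Q by rewrite ltr_pwDl.
have kappa0 : 0 < kappa by rewrite divr_gt0.
have kappa1 : kappa <= 1 by rewrite ler_pdivrMr// mul1r lerDl.
have Qk : Q * kappa < 1 by rewrite /kappa mul1r ltr_pdivrMr// mul1r ltrDr.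
have [rho' rho'0 hrho'] := powR_small C0 kappa0.
(* Within [rho'] of [x0] the weight deviates by at most [kappa]; with 1/8, two points within [rho]
   of [x0] are within 1/4 of each other. *)
pose rho := Num.min rho' (1 / 8).
have rho0 : 0 < rho by rewrite lt_min rho'0 divr_gt0.
have rho8 : rho <= 1 / 8 by rewrite ge_min lexx orbT.
have rhor : rho <= rho' by rewrite ge_min lexx.
(* If |y| <= r and the inner product of [y] with [x0] exceeds r^2 - eta, then |y - x0|^2 <= 2 r^2 -
   2 (r^2 - eta) = rho^2. That product is constant on the plane, so its value at [x1] decides for
   all points. *)
pose eta := rho ^+ 2 / 2.
have eta0 : 0 < eta by rewrite divr_gt0// exprn_gt0.
have r0 : 0 <= r by exact: enorm_ge0.
have r1 : 0 < r + 1 by rewrite ltr_wpDl.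
have [x1 Ux1 x1x0] := (closure_enormP U x0).1 Ux0 _ (divr_gt0 eta0 r1).
have dot1 : r ^+ 2 - eta < dot x1 x0.
  have h : dot (x0 - x1) x0 <= enorm (x0 - x1) * r by exact: cauchy_schwarz.
  move: h; rewrite dotDl dotNl -enorm_sqr -/r enorm_distC => h.
  have : enorm (x1 - x0) * r < eta.
    apply: (@le_lt_trans _ _ (eta / (r + 1) * r)); first by rewrite ler_wpM2r// ltW.
    by rewrite mulrAC ltr_pdivrMr// ltr_pM2l// ltrDl.
  by lra.
pose P := plane (x1 - (1 / 2) *: u1 - (1 / 2) *: u2) u1 u2.
have dotP z : dot (P z) x0 = dot x1 x0.
  by rewrite /P /plane !dotDl !dotNl !dotZl u1x u2x !mulr0 subr0 subr0 !addr0.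
have close y : U y -> dot y x0 = dot x1 x0 -> enorm (y - x0) <= rho.
  move=> Uy dy; rewrite -ler_sqr ?nnegrE ?enorm_ge0// ?ltW// enorm_sqr.
  rewrite dotDl !dotDr !dotNl !dotNr (dotC x0 y) dy -!enorm_sqr -/r.
  have : enorm y ^+ 2 <= r ^+ 2 by rewrite ler_sqr ?nnegrE ?enorm_ge0// Ur.
  by rewrite /eta in dot1; lra.
have [Dx1 fx1] := Ux1.
suff : f x1 = 0 by move/eqP; rewrite (negPf fx1).
apply: (@local_vanishing R n N D oD cD bD f W cf hoelder_W_cont hoelder_W_bounded xray0
  x0 u1 u2 C1 kappa e1 e2 e12 _ hC1 (ltW kappa0) _ x1 Dx1 _).
- by move=> c k; apply: W_unit => //; exact: dir_sphere.
- apply: le_lt_trans Qk.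
  have -> : 4 * chain_cst * (N%:R * (N%:R * C1) ^+ 2) * #|{: 'I_N * bool}|%:R *
     (4 * N%:R * kappa ^+ 2) = Q * kappa ^+ 2 by rewrite /Q mulrA.
  by apply: ler_wpM2l => //; rewrite expr2 ler_piMr// ltW.
move=> z DPz fPz; have UPz : U (P z) by [].
have c1 := close _ UPz (dotP z); have c2 := close _ Ux1 erefl.
have [hs hl] := hC _ _ (@subset_closure _ D _ DPz) Kx0.
have kap : C * enorm (P z - x0) `^ beta <= kappa.
  by apply: hrho'; [exact: enorm_ge0|exact: le_trans rhor].
split.
- have -> : P z - x1 = (P z - x0) - (x1 - x0) by rewrite opprB addrA subrK.
  by apply: (le_trans (enormB _ _)); lra.
- by move=> v sv; exact: le_trans (hs v sv) kap.
- move=> v w sv sw; apply: (le_trans (hl v w sv sw)).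
  by rewrite ler_wpM2r// enorm_ge0.
Qed.

Lemma vanishing x : closure D x -> f x = 0.
Proof.
move=> Kx; apply: mnorm_eq0; apply/eqP; rewrite eq_le mnorm_ge0 andbT.
apply/ler_addgt0Pr => e e0; rewrite add0r.
have [d d0 hd] := within_continuous_mnorm cf Kx e0.
have [y Dy yx] := (closure_enormP D x).1 Kx d d0.
have := hd y (@subset_closure _ D _ Dy) yx.
by rewrite vanishing_interior// sub0r mnormN => /ltW.
Qed.

End Uniqueness.

(** * C^{1,beta} weights *)

Section MeanValue.
Variables (R : realType) (p q : nat).

(** Continuation argument: let [c] be the supremum of the times up to which the bound with slope
    [L + e] holds. The local estimate at [c] carries the bound to [c] from the left, and beyond [c]
    if c < 1. *)
Lemma mean_value_inequality (g : R -> 'M[cplx R]_(p, q)) (L : R) : 0 <= L ->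
  (forall t, 0 <= t <= 1 -> forall e : R, 0 < e -> exists2 d : R, 0 < d &
     forall s, 0 <= s <= 1 -> `|s - t| < d -> mnorm (g s - g t) <= (L + e) * `|s - t|) ->
  mnorm (g 1 - g 0) <= L.
Proof.
move=> L0 hg; apply/ler_addgt0Pr => e e0.
pose S := [set t : R | 0 <= t <= 1 /\ mnorm (g t - g 0) <= (L + e) * t].
have S0 : S 0 by split; rewrite ?lexx ?ler01// subrr mnorm0 mulr0.
have S1 t : S t -> t <= 1 by move=> [/andP[]].
have supS : has_sup S by split; [exists 0|exists 1].
set c := sup S.
have Sc t : S t -> t <= c by move=> St; apply: sup_upper_bound.
have c0 : 0 <= c by exact: Sc.
have c1 : c <= 1 by apply: sup_le_ub; [exists 0|move=> t /S1].
have c01 : 0 <= c <= 1 by rewrite c0.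
have [d d0 hd] := hg c c01 e e0.
have inS : S c.
  have [t St ct] := sup_adherent d0 supS; have tc := Sc _ St.
  have [/andP[t0 t1] ht] := St.
  have h : mnorm (g t - g c) <= (L + e) * `|t - c|.
    by apply: hd; rewrite ?t0// ler0_norm ?subr_le0// -/c in ct *; lra.
  split=> //; have := mnormD (g c - g t) (g t - g 0); rewrite addrA subrK.
  rewrite ler0_norm ?subr_le0// mnorm_distC in h; nra.
have [c_eq|cn] := eqVneq c 1; first by have [_] := inS; rewrite c_eq mulr1.
have clt : c < 1 by rewrite lt_neqAle cn.
pose s := Num.min 1 (c + d / 2).
have d2 : 0 < d / 2 by rewrite divr_gt0.
have cos_wave : c < s by rewrite lt_min clt ltrDl.
have s1 : s <= 1 by rewrite ge_min lexx.
have s2 : s <= c + d / 2 by rewrite ge_min lexx orbT.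
have Ss : S s.
  have s01 : 0 <= s <= 1 by rewrite s1 andbT; lra.
  split=> //.
  have h : mnorm (g s - g c) <= (L + e) * `|s - c|.
    by apply: hd => //; rewrite gtr0_norm ?subr_gt0//; lra.
  rewrite gtr0_norm ?subr_gt0// in h; have [_ h'] := inS.
  have := mnormD (g s - g c) (g c - g 0); rewrite addrA subrK; nra.
by have := Sc _ Ss; rewrite leNgt cos_wave.
Qed.

End MeanValue.

(** * From pointwise to global Lipschitz bounds on the sphere *)

Section Sphere.
Variables (R : realType) (n N : nat).
Local Notation E := 'rV[R]_n.
Local Notation MN := 'M[cplx R]_N.

Lemma sphere_compact : compact (@sphere R n).
Proof.
apply: bounded_closed_compact.
  exists 1; split; first exact: num_real.
  move=> M M1 x sx; apply: (le_trans (norm_le_enorm x)); rewrite sx; exact: ltW.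
move=> x /closure_enormP cx; apply/eqP; rewrite eq_le.
apply/andP; split; apply/ler_addgt0Pr => e e0; have [y sy yx] := cx e e0.
  have := enormD (x - y) y; rewrite subrK sy enorm_distC; lra.
by have := enormD (y - x) x; rewrite subrK sy; lra.
Qed.

Variables (h : E -> MN) (L : R).
Hypothesis L0 : 0 <= L.
Hypothesis hL : forall v, sphere v -> forall e : R, 0 < e -> exists2 d : R, 0 < d &
  forall w, sphere w -> enorm (w - v) < d -> mnorm (h w - h v) <= (L + e) * enorm (w - v).

Lemma sphere_bounded : exists2 M : R, 0 <= M & forall v, sphere v -> mnorm (h v) <= M.
Proof.
have [s0|/set0P s0] := eqVneq (@sphere R n) set0.
  by exists 0 => // v; rewrite s0.
have [|c _ hc] := compact_EVT_max (f := fun x => mnorm (h x)) s0 sphere_compact; last first.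
  by exists (mnorm (h c)) => [|v sv]; [exact: mnorm_ge0|apply: hc; rewrite inE].
apply: within_continuous_real => v sv e e0.
have [d d0 hd] := hL sv (@ltr01 R).
have L1 : 0 < L + 1 by rewrite ltr_wpDl.
exists (Num.min d (e / (L + 1))) => [|w sw]; first by rewrite lt_min d0 divr_gt0.
rewrite lt_min => /andP[wd we]; apply: (le_lt_trans (mnorm_dist_le _ _)).
by apply: (le_lt_trans (hd w sw wd)); rewrite mulrC -ltr_pdivlMr.
Qed.

(* Nearby points are joined by the normalized chord. *)
Lemma sphere_lipschitz (M : R) : (forall v, sphere v -> mnorm (h v) <= M) ->
  forall v w, sphere v -> sphere w -> mnorm (h v - h w) <= (4 * L + 4 * M) * enorm (v - w).
Proof.
move=> hM v w sv sw; have M0 : 0 <= M by rewrite (le_trans _ (hM v sv))// mnorm_ge0.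
have vw0 := enorm_ge0 (v - w).
(* Points at distance at least 1/2 need only the sup bound: 2 M <= 4 M |v - w|. *)
have [far|near] := leP (1 / 2) (enorm (v - w)).
  apply: (le_trans (mnormB _ _)); have := hM v sv; have := hM w sw.
  have d0 : 0 <= enorm (v - w) - 1 / 2 by rewrite subr_ge0.
  have := mulr_ge0 L0 vw0; have := mulr_ge0 M0 d0; lra.
(* A chord shorter than 1/2 stays at distance at least 1/2 from the origin; doubling it brings it
   into the range of [normalize_lip]. *)
pose r t : E := 2 *: (v + t *: (w - v)).
have r1 t : 0 <= t <= 1 -> 1 <= enorm (r t).
  move=> /andP[t0 t1]; rewrite /r enormZ ger0_norm//.
  have := enormB (v + t *: (w - v)) (t *: (w - v)).
  rewrite addrK sv enormZ ger0_norm// (enorm_distC w); nra.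
pose a t : E := (enorm (r t))^-1 *: r t.
have sa t : 0 <= t <= 1 -> sphere (a t).
  move=> t01; apply: unit_multiple; apply/eqP => r0.
  by have := r1 t t01; rewrite r0 enorm0 leNgt ltr01.
have a_lip s t : 0 <= s <= 1 -> 0 <= t <= 1 -> enorm (a s - a t) <= 4 * enorm (v - w) * `|s - t|.
  move=> s01 t01; apply: (le_trans (normalize_lip (r1 s s01) (r1 t t01))).
  have -> : r s - r t = (2 * (s - t)) *: (w - v).
    by apply/rowP => i; rewrite !mxE; ring.
  rewrite enormZ normrM ger0_norm// (enorm_distC w).
  by rewrite le_eqVlt; apply/orP; left; apply/eqP; ring.
have a0 : a 0 = v.
  by rewrite /a /r scale0r addr0 enormZ sv mulr1 scalerA ger0_norm// mulVf// scale1r.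
have a1 : a 1 = w.
  by rewrite /a /r scale1r addrC subrK enormZ sw mulr1 scalerA ger0_norm// mulVf// scale1r.
have K0 : 0 <= L * (4 * enorm (v - w)) by rewrite !mulr_ge0.
have := @mean_value_inequality R N N (h \o a) _ K0; rewrite /= a0 a1 mnorm_distC.
move=> mv; have {mv} : mnorm (h v - h w) <= L * (4 * enorm (v - w)).
  apply: mv => t t01 e e0.
  pose e' := e / (4 * enorm (v - w) + 1).
  have b0 : 0 < 4 * enorm (v - w) + 1 by rewrite ltr_wpDl// mulr_ge0.
  have e'0 : 0 < e' by rewrite divr_gt0.
  have [d d0 hd] := hL (sa t t01) e'0.
  exists (d / (4 * enorm (v - w) + 1)) => [|s s01 st]; first by rewrite divr_gt0.
  have al := a_lip s t s01 t01; have st0 := normr_ge0 (s - t).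
  rewrite ltr_pdivlMr// in st.
  have close : enorm (a s - a t) < d by nra.
  apply: (le_trans (hd _ (sa s s01) close)).
  have Le : 0 <= L + e' by rewrite addr_ge0// ltW.
  apply: (le_trans (ler_wpM2l Le al)).
  rewrite (_ : (L + e') * _ = (L + e') * (4 * enorm (v - w)) * `|s - t|); last by ring.
  apply: ler_wpM2r => //.
  have ee : e' * (4 * enorm (v - w) + 1) = e by rewrite /e' mulfVK// gt_eqF.
  by rewrite mulrDl lerD2l; nra.
have := mulr_ge0 M0 vw0; lra.
Qed.

End Sphere.

Section C1Weights.
Variables (R : realType) (n N : nat) (beta : R) (D : set 'rV[R]_n).
Local Notation E := 'rV[R]_n.
Local Notation MN := 'M[cplx R]_N.
Local Notation K := (closure D).
Hypotheses (beta0 : 0 < beta) (beta1 : beta <= 1).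
Hypotheses (oD : open D) (cD : convex_set D) (bD : bounded_set D).

Lemma hoelder_SM_uniform (A : 'I_n -> E -> E -> MN) : (forall i, hoelder_SM K beta (A i)) ->
  exists2 H : R, 0 <= H & forall i x v y w, K x -> sphere v -> K y -> sphere w ->
    mnorm (A i x v - A i y w) <= H * (enorm (x - y) + enorm (v - w)) `^ beta.
Proof.
move=> /(_ _)/cid hA; pose c i := projT1 (hA i).
exists (\sum_i `|c i|) => [|i x v y w Kx sv Ky sw]; first by apply: sumr_ge0.
apply: (le_trans (projT2 (hA i) x v y w Kx sv Ky sw)); rewrite ler_wpM2r ?powR_ge0//.
apply: (le_trans (ler_norm _)); rewrite (bigD1 i)//= lerDl.
exact: sumr_ge0.
Qed.

Lemma hoelder_SM_bounded (A : 'I_n -> E -> E -> MN) : (forall i, hoelder_SM K beta (A i)) ->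
  exists2 B : R, 0 <= B & forall i x v, K x -> sphere v -> mnorm (A i x v) <= B.
Proof.
move=> hA; have [H H0 hH] := hoelder_SM_uniform hA; have [r r0 Dr] := bounded_enormP bD.
have Kr := closure_enorm_le Dr.
have [[[y w] [Ky sw]]|nK] := pselect (exists p : E * E, K p.1 /\ sphere p.2); last first.
  by exists 0 => // i x v Kx sv; case: nK; exists (x, v).
rewrite /= in Ky sw.
have HP : 0 <= H * (2 * r + 2) `^ beta by rewrite mulr_ge0// powR_ge0.
exists (H * (2 * r + 2) `^ beta + \sum_i mnorm (A i y w)) => [|i x v Kx sv].
  by rewrite addr_ge0//; apply: sumr_ge0 => i _; exact: mnorm_ge0.
have := mnormD (A i x v - A i y w) (A i y w); rewrite subrK => /le_trans -> //.
apply: lerD; last first.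
  by rewrite (bigD1 i)//= lerDl; apply: sumr_ge0 => j _; exact: mnorm_ge0.
apply: (le_trans (hH i x v y w Kx sv Ky sw)); apply: ler_wpM2l => //.
have := Kr _ Kx; have := Kr _ Ky; have := enormB x y; have := enormB v w.
rewrite sv sw => h1 h2 h3 h4.
apply: ge0_ler_powR; rewrite ?nnegrE ?addr_ge0 ?enorm_ge0//; [exact: ltW|lra|lra].
Qed.

Lemma mnorm_linear_combination (a : E) (A : 'I_n -> MN) (B : R) :
  (forall i, mnorm (A i) <= B) ->
  mnorm (\sum_i ((a 0 i)%:C)%C *: A i) <= n%:R * B * enorm a.
Proof.
move=> AB; apply: (le_trans (mnorm_sum _ _ _)).
apply: (@le_trans _ _ (\sum_(i < n) B * enorm a)).
  apply: ler_sum => i _; apply: (le_trans (mnormZ _ _)); rewrite mulrC.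
  by apply: ler_pM; rewrite ?mnorm_ge0 ?enorm_entry.
by rewrite sumr_const card_ord -[leLHS]mulr_natl mulrA.
Qed.

(** With beta <= 1, this turns a Lipschitz bound on a set of diameter at most [r] into a Hoelder
    bound. *)
Lemma le_powR_bounded (t r : R) : 0 <= t -> t <= r -> t <= r `^ (1 - beta) * t `^ beta.
Proof.
move=> t0 tr; have [->|tn0] := eqVneq t 0; first by rewrite mulr_ge0// powR_ge0.
have {1}-> : t = t `^ (1 - beta) * t `^ beta.
  by rewrite -powRD ?subrK ?powRr1// tn0 implybT.
rewrite ler_wpM2r ?powR_ge0//; apply: ge0_ler_powR; rewrite ?nnegrE ?subr_ge0//.
exact: le_trans tr.
Qed.

(** The function W(x) - W(y) of [v] has the differential Wv(x, v) - Wv(y, v), of size |x - y|^beta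
    by Hoelder continuity. Together with a sup bound of the same order, from the mean value
    inequality on the segment between [x] and [y], this controls its Lipschitz constant on the
    sphere. *)
Lemma C1_hoelder_Lip (W : E -> E -> MN) : C1_hoelder_SM K beta W -> hoelder_Lip K beta W.
Proof.
move=> [Wx [Wv [hx hv dW]]].
have [B B0 hB] := hoelder_SM_bounded hx; have [B' B'0 hB'] := hoelder_SM_bounded hv.
have [H H0 hH] := hoelder_SM_uniform hv; have [r r0 Dr] := bounded_enormP bD.
have Kr := closure_enorm_le Dr.
have diff_v x v (e : R) : K x -> sphere v -> 0 < e -> exists2 d : R, 0 < d &
    forall w, sphere w -> enorm (w - v) < d ->
    mnorm (W x w - W x v - \sum_i (((w - v) 0 i)%:C)%C *: Wv i x v) <= e * enorm (w - v).
  move=> Kx sv e0; have [d d0 hd] := dW x v Kx sv e e0.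
  exists d => // w sw wv; have := hd x w Kx sw.
  rewrite subrr enorm0 add0r => /(_ wv); congr (mnorm (_ - _) <= _).
  by apply: eq_bigr => i _; rewrite mxE scale0r add0r.
have diff_x x v (e : R) : K x -> sphere v -> 0 < e -> exists2 d : R, 0 < d &
    forall y, K y -> enorm (y - x) < d -> mnorm (W y v - W x v) <= (n%:R * B + e) * enorm (y - x).
  move=> Kx sv e0; have [d d0 hd] := dW x v Kx sv e e0.
  exists d => // y Ky yx; have := hd y v Ky sv.
  rewrite subrr enorm0 addr0 => /(_ yx); set S := \sum_i _ => h.
  have -> : W y v - W x v = (W y v - W x v - S) + S by rewrite subrK.
  apply: (le_trans (mnormD _ _)); rewrite mulrDl addrC lerD//.
  have -> : S = \sum_i (((y - x) 0 i)%:C)%C *: Wx i x v.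
    by apply: eq_bigr => i _; rewrite [(0 : E) 0 i]mxE scale0r addr0.
  by apply: mnorm_linear_combination => i; exact: hB.
have sup_x x y v : K x -> K y -> sphere v -> mnorm (W x v - W y v) <= n%:R * B * enorm (x - y).
  move=> Kx Ky sv; pose p t := y + t *: (x - y).
  have Kp t : 0 <= t <= 1 -> K (p t).
    by move=> /andP[t0 t1]; exact: closure_convex.
  have L0 : 0 <= n%:R * B * enorm (x - y) by rewrite !mulr_ge0// enorm_ge0.
  have := @mean_value_inequality R N N (fun t => W (p t) v) _ L0.
  rewrite /p scale1r scale0r addr0 [y + (x - y)]addrC subrK; apply=> t t01 e e0.
  have xy0 := enorm_ge0 (x - y); have xy1 : 0 < enorm (x - y) + 1 by rewrite ltr_wpDl.
  have e'0 : 0 < e / (enorm (x - y) + 1) by rewrite divr_gt0.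
  have [d d0 hd] := diff_x _ _ _ (Kp t t01) sv e'0.
  exists (d / (enorm (x - y) + 1)) => [|s s01 st]; first by rewrite divr_gt0.
  have ps : p s - p t = (s - t) *: (x - y) by apply/rowP => i; rewrite !mxE; ring.
  have st0 := normr_ge0 (s - t).
  have close : enorm (p s - p t) < d.
    by rewrite ps enormZ; rewrite ltr_pdivlMr// in st; nra.
  apply: (le_trans (hd _ (Kp s s01) close)); rewrite ps enormZ.
  rewrite (_ : (n%:R * B + _) * _ = (n%:R * B + e / (enorm (x - y) + 1)) * enorm (x - y) * `|
    s - t|);
    last by ring.
  apply: ler_wpM2r => //.
  have ee : e / (enorm (x - y) + 1) * (enorm (x - y) + 1) = e by rewrite mulfVK// gt_eqF.
  by rewrite mulrDl lerD2l; nra.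
split=> [x Kx|].
  have nB0 : 0 <= n%:R * B' by rewrite mulr_ge0.
  have hL v : sphere v -> forall e : R, 0 < e -> exists2 d : R, 0 < d &
      forall w, sphere w -> enorm (w - v) < d ->
      mnorm (W x w - W x v) <= (n%:R * B' + e) * enorm (w - v).
    move=> sv e e0; have [d d0 hd] := diff_v x v e Kx sv e0.
    exists d => // w sw wv; have := hd w sw wv; set S := \sum_i _ => h.
    have -> : W x w - W x v = (W x w - W x v - S) + S by rewrite subrK.
    apply: (le_trans (mnormD _ _)); rewrite mulrDl addrC lerD//.
    by apply: mnorm_linear_combination => i; exact: hB'.
  have [M M0 hM] := sphere_bounded nB0 hL.
  rewrite /Lip; apply: (@le_lt_trans _ _ (M + (4 * (n%:R * B') + 4 * M))%:E); last exact: ltry.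
  apply: lip_norm_le => //.
  - by rewrite addr_ge0// mulr_ge0// mulr_ge0.
  - exact: sphere_lipschitz hM.
pose A := n%:R * B * (2 * r) `^ (1 - beta).
have A0 : 0 <= A by rewrite !mulr_ge0// powR_ge0.
(* [A] bounds the supremum norm; the bracket is the constant of [sphere_lipschitz] for the slope
   [n%:R * H] and the sup bound [A], all up to the factor |x - y|^beta. *)
exists (A + (4 * (n%:R * H) + 4 * A)) => x y Kx Ky.
set t := enorm (x - y) `^ beta; have t0 : 0 <= t by exact: powR_ge0.
have sup_h v : sphere v -> mnorm (W x v - W y v) <= A * t.
  move=> sv; apply: (le_trans (sup_x x y v Kx Ky sv)).
  rewrite /A -[leRHS]mulrA; apply: ler_wpM2l; first by rewrite mulr_ge0.
  apply: le_powR_bounded; first exact: enorm_ge0.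
  by apply: (le_trans (enormB _ _)); have := Kr _ Kx; have := Kr _ Ky; lra.
have -> : (A + (4 * (n%:R * H) + 4 * A)) * t = A * t + (4 * (n%:R * H * t) + 4 * (A * t)) by ring.
have nH0 : 0 <= n%:R * H * t by rewrite !mulr_ge0.
apply: lip_norm_le => //.
- by have := mulr_ge0 A0 t0; lra.
- have := @sphere_lipschitz R n N (W x \- W y) _ nH0 _ _ sup_h; apply.
  move=> v sv e e0; have e2 : 0 < e / 2 by rewrite divr_gt0.
  have [d d0 hd] := diff_v x v _ Kx sv e2; have [d' d'0 hd'] := diff_v y v _ Ky sv e2.
  exists (Num.min d d') => [|w sw]; first by rewrite lt_min d0.
  rewrite lt_min => /andP[wd wd']; have h1 := hd w sw wd; have h2 := hd' w sw wd'.
  set Sx := \sum_i _ in h1; set Sy := \sum_i _ in h2.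
  have hS : mnorm (Sx - Sy) <= n%:R * (H * t) * enorm (w - v).
    have -> : Sx - Sy = \sum_i (((w - v) 0 i)%:C)%C *: (Wv i x v - Wv i y v).
      by rewrite /Sx /Sy -sumrB; apply: eq_bigr => i _; rewrite scalerBr.
    apply: mnorm_linear_combination => i.
    by have := hH i x v y v Kx sv Ky sv; rewrite subrr enorm0 addr0.
  have -> : (W x \- W y) w - (W x \- W y) v =
     (W x w - W x v - Sx) - (W y w - W y v - Sy) + (Sx - Sy).
    rewrite /=; apply/matrixP => i j; rewrite !mxE; ring.
  apply: (le_trans (mnormD _ _)).
  apply: (le_trans (lerD (le_trans (mnormB _ _) (lerD h1 h2)) hS)).
  by rewrite -mulrDl -splitr -mulrDl addrC mulrA.
Qed.

End C1Weights.

Theorem theorem7p2 (R : realType) (n N : nat) (beta : R) (D : set 'rV[R]_n) :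
  (3 <= n)%N -> 0 < beta -> bounded_convex_domain D ->
  (forall W : 'rV[R]_n -> 'rV[R]_n -> 'M[cplx R]_N,
     hoelder_Lip (closure D) beta W ->
     (forall x v, closure D x -> sphere v -> W x v \in unitmx) ->
     forall f : 'rV[R]_n -> 'cV[cplx R]_N,
       {within closure D, continuous f} ->
       (forall x v T, maximal_line (closure D) x v T -> xray W f x v T = 0) ->
       forall x, closure D x -> f x = 0) /\
  (beta <= 1 ->
   forall W : 'rV[R]_n -> 'rV[R]_n -> 'M[cplx R]_N,
     C1_hoelder_SM (closure D) beta W -> hoelder_Lip (closure D) beta W).
Proof.
move=> n3 beta0 [_ oD cD bD]; split=> [W hW uW f cf If x Kx|beta1 W].
  exact: (vanishing n3 beta0 oD cD bD hW uW cf If Kx).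
exact: C1_hoelder_Lip.
Qed.
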